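(* Let $T_0>0$ and let $(F,\Psi,\mathfrak{P})$ be a Wu solution on $[0,T_0]$ (as defined in the context), with associated homeomorphisms $h(\cdot,t):\mathbb{R}\to\mathbb{R}$, singular sets $S(t)$ and non-singular sets $NS(t)$. Then: (1) For every fixed $t\in[0,T_0]$, the functions $\left(\frac{1}{\Psi_{z'}}F_{z'}\right)(\cdot,t)$ and $\left(\frac{1}{\Psi_{z'}}\overline{F_{z'}}\right)(\cdot,t)$ on $P_-$ extend to continuous functions on $\overline{P}_-$, with $$\left(\frac{1}{\Psi_{z'}}F_{z'}\right)(\alpha',t)=\left(\frac{1}{\Psi_{z'}}\overline{F_{z'}}\right)(\alpha',t)=0\quad\text{for all }\alpha'\in S(t).$$ (2) If $t\in[0,T_0]$, then $$\frac{Z_{,\alpha'}}{|Z_{,\alpha'}|}(h(\alpha,t),t)=\frac{Z_{,\alpha'}}{|Z_{,\alpha'}|}(\alpha,0)\exp\left\{i\,\mathrm{Im}\left(\int_0^t\left(\frac{1}{\Psi_{z'}}\overline{F_{z'}}\right)(h(\alpha,s),s)\,ds\right)\right\}\quad\text{for all }\alpha\in NS(0).$$ Moreover, if $\alpha\in S(0)$ and $\{\alpha_n\}$ is any sequence with $\alpha_n\in NS(0)$ for all $n$ and $\alpha_n\to\alpha$, then $$\lim_{n\to\infty}\frac{\frac{Z_{,\alpha'}}{|Z_{,\alpha'}|}(h(\alpha_n,t),t)}{\frac{Z_{,\alpha'}}{|Z_{,\alpha'}|}(\alpha_n,0)}=1.$$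
   Context: **Notation.** Identify $\mathbb{R}^2$ with $\mathbb{C}$. $P_-=\{z'=x'+iy' : y'<0\}$ is the lower half plane, $\overline{P}_-$ its closure, with boundary $\mathbb{R}$. $\partial_{z'}=\frac12(\partial_{x'}-i\partial_{y'})$; subscripts $t,z',\alpha,\alpha'$ denote partial derivatives (except in the symbols $Z_t,Z_{tt}$, defined below). $\|\cdot\|_p$ is the $L^p(\mathbb{R})$ norm; $\|f\|_{\dot H^{1/2}}=\||\xi|^{1/2}\hat f\|_2$. $K_y(x)=\frac{-y}{\pi(x^2+y^2)}$ for $y<0$ is the Poisson kernel; $*$ is convolution in the real variable. Compositions and inverses are in the spatial variable. $f_\epsilon\Rightarrow f$ on $U$ means uniform convergence on compact subsets of $U$. $C(\cdot)$ denotes finite quantities depending only on the indicated arguments. Convention: if a function (or a product such as $\frac{1}{\Psi_{z'}}F_{z'}$) defined on $P_-$ extends continuously to $\overline{P}_-$, its value at a boundary point is that of the continuous extension. **Water wave system in $P_-$.** For $F,\Psi$ complex valued and $\mathfrak P$ real valued: (i) $F_t-\Psi_t\frac{F_{z'}}{\Psi_{z'}}+\overline F\frac{F_{z'}}{\Psi_{z'}}=-\frac{1}{\Psi_{z'}}(\partial_{x'}-i\partial_{y'})\mathfrak P+i$ on $P_-$; (ii) $F(\cdot,t)$ holomorphic and $\Psi(\cdot,t)$ conformal on $P_-$; (iii) $\mathfrak P=0$ on $\partial P_-$; (iv) the trace of $\frac{1}{\Psi_{z'}}(\overline F-\Psi_t)$ on $\partial P_-$ is real valued; with $F\to0$, $(\partial_{x'}-i\partial_{y'})\mathfrak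 P\to i$, $\Psi_{z'}\to1$, $\Psi_t\to0$ as $z'\to\infty$. **Energy.** All norms are in $x'$ at height $y'$: $\mathcal E_1(t)=\sup_{y'<0}\|F_{z'}\|_{L^2}^2+\sup_{y'<0}\|\frac{1}{\Psi_{z'}}F_{z'}\|_{\dot H^{1/2}}^2+\sup_{y'<0}\|\frac{1}{\Psi_{z'}}\partial_{z'}(\frac{1}{\Psi_{z'}}F_{z'})\|_{L^2}^2+\sup_{y'<0}\|\frac{1}{\Psi_{z'}^2}\partial_{z'}(\frac{1}{\Psi_{z'}}F_{z'})\|_{\dot H^{1/2}}^2+\sup_{y'<0}\|\frac{1}{\Psi_{z'}}\|_{L^\infty}^2+\sup_{y'<0}\|\partial_{z'}(\frac{1}{\Psi_{z'}})\|_{L^2}^2+\sup_{y'<0}\|\frac{1}{\Psi_{z'}}\partial_{z'}(\frac{1}{\Psi_{z'}}\partial_{z'}(\frac{1}{\Psi_{z'}}))\|_{L^2}^2$. **Initial data.** $F(\cdot,0),\Psi(\cdot,0)$ are holomorphic on $P_-$, $\Psi(\cdot,0)$ is conformal onto a domain whose boundary is a Jordan curve, $\Psi_{z'}(z',0)\to1$ as $z'\to\infty$; $\mathfrak P(\cdot,0)$ is the unique solution of $\Delta\mathfrak P=-2|F_{z'}|^2$ on $P_-$, $\mathfrak P=0$ on $\partial P_-$, $(\partial_{x'}+i\partial_{y'})\mathfrak P\to-i$ at infinity; and $\mathcal E_1(0)<\infty$, $c_0:=\sup_{y'<0}\|F(\cdot+iy',0)\|_{L^2}+\sup_{y'<0}\|\frac{1}{\Psi_{z'}(\cdot+iy',0)}-1\|_{L^2}<\infty$.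 **Wu solution on $[0,T_0]$.** This is a solution produced by Wu's existence theorem from such data. Concretely it is a solution $(F,\Psi,\mathfrak P)$ of the system on $[0,T_0]$ with the following properties. (1) $\Psi$ is $C^1$ on $P_-\times[0,T_0]$, each $\Psi(\cdot,t)$ is conformal, and $\Psi,\frac1{\Psi_{z'}},\frac{\Psi_t}{\Psi_{z'}}$ are continuous on $\overline P_-\times[0,T_0]$; $F$ is bounded and continuous on $\overline P_-\times[0,T_0]$, $C^1$ on $P_-\times[0,T_0]$, each $F(\cdot,t)$ holomorphic; $\mathfrak P$ is continuous on $\overline P_-\times[0,T_0]$ and $C^1$ on $P_-\times[0,T_0]$; for all $t$, $\mathcal E_1(t)<\infty$ and $\sup_{y'<0}\|F(\cdot+iy',t)\|_{L^2}+\sup_{y'<0}\|\frac1{\Psi_{z'}(\cdot+iy',t)}-1\|_{L^2}<\infty$. (2) Smooth approximations. For each $0<\epsilon\le1$ there is a solution $(F^\epsilon,\Psi^\epsilon,\mathfrak P^\epsilon)$ of the system on $[0,T_0]$, smooth up to the boundary, with $F^\epsilon(z',0)=F(z'-\epsilon i,0)$, $\Psi^\epsilon(z',0)=\Psi(z'-\epsilon i,0)$. Write $Z^\epsilon(\alpha',t)=\Psi^\epsilon(\alpha',t)$, $Z^\epsilon_{,\alpha'}=\partial_{\alpha'}Z^\epsilon$, $Z_t^\epsilon=\overline{F^\epsilon}|_{\mathbb R}$, $Z^\epsilon_{t,\alpha'}=\partial_{\alpha'}Z^\epsilon_t$, $b^\epsilon=\frac{1}{\Psi^\epsilon_{z'}}(\overline{F^\epsilon}-\Psi^\epsilon_t)|_{\mathbb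 R}$; $h^\epsilon$ is the flow $h^\epsilon_t=b^\epsilon\circ h^\epsilon$, $h^\epsilon(\alpha,0)=\alpha$; $z^\epsilon=Z^\epsilon\circ h^\epsilon$ (so $z^\epsilon_t=Z_t^\epsilon\circ h^\epsilon$), $Z^\epsilon_{tt}=z^\epsilon_{tt}\circ(h^\epsilon)^{-1}$; $A_1^\epsilon(\alpha',t)=1+\frac1{2\pi}\int\frac{|Z_t^\epsilon(\alpha',t)-Z_t^\epsilon(\beta',t)|^2}{(\alpha'-\beta')^2}d\beta'$. On $\mathbb R$: $\frac{1}{\Psi^\epsilon_{z'}}(\partial_{x'}-i\partial_{y'})\mathfrak P^\epsilon=i\frac{A_1^\epsilon}{Z^\epsilon_{,\alpha'}}$ and $\overline{Z^\epsilon_{tt}}-i=-i\frac{A_1^\epsilon}{Z^\epsilon_{,\alpha'}}$. Moreover $\mathfrak P^\epsilon=-\frac12|F^\epsilon|^2-y'+\frac12K_{y'}*(|Z_t^\epsilon|^2)$. (3) Uniform bounds for all $0<\epsilon\le1$, $t\in[0,T_0]$: the quantities $\|Z^\epsilon_{t,\alpha'}\|_2$, $\|\partial_{\alpha'}\frac1{Z^\epsilon_{,\alpha'}}\|_2$, $\|A_1^\epsilon\|_\infty$, $\|\frac1{Z^\epsilon_{,\alpha'}}\partial_{\alpha'}A_1^\epsilon\|_2$, $\|b^\epsilon_{\alpha'}\|_\infty$, $\|\frac{h^\epsilon_{t\alpha}}{h^\epsilon_\alpha}\|_\infty$, $\|\frac{z^\epsilon_{t\alpha}}{z^\epsilon_\alpha}\|_\infty$,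 $\|\partial_{\alpha'}(\frac{1}{(Z^\epsilon_{,\alpha'})^2}Z^\epsilon_{t,\alpha'})\|_2$ (and the same with $\overline{Z^\epsilon_{t,\alpha'}}$ in place of $Z^\epsilon_{t,\alpha'}$) are at most $C(\mathcal E_1(0))$; $\|Z_t^\epsilon\|_\infty+\|\frac1{Z^\epsilon_{,\alpha'}}\|_\infty\le C(c_0,\mathcal E_1(0))$; and there are $0<c_1,c_2<\infty$ depending only on $\mathcal E_1(0)$ with $c_1\le|h^\epsilon_\alpha(\alpha,t)|\le c_2$, $c_1|z^\epsilon_\alpha(\alpha,0)|\le|z^\epsilon_\alpha(\alpha,t)|\le c_2|z^\epsilon_\alpha(\alpha,0)|$, $|z^\epsilon_{t\alpha}(\alpha,t)|\le c_2|z^\epsilon_\alpha(\alpha,0)|$. (4) Convergence along a sequence $\epsilon=\epsilon_j\to0$. There is a continuous $h:\mathbb R\times[0,T_0]\to\mathbb R$, each $h(\cdot,t)$ a homeomorphism, $h(\alpha,0)=\alpha$, with $h^\epsilon\Rightarrow h$, $(h^\epsilon)^{-1}\Rightarrow h^{-1}$ on $\mathbb R\times[0,T_0]$, and $0<c_1\le\frac{h(\alpha,t)-h(\beta,t)}{\alpha-\beta}\le c_2<\infty$ for $\alpha\ne\beta$. There is a continuous $z:\mathbb R\times[0,T_0]\to\mathbb C$, twice continuously differentiable in $t$ with $z_t,z_{tt}$ bounded and continuous, and $z^\epsilon\Rightarrow z$, $z^\epsilon_t\Rightarrow z_t$, $z^\epsilon_{tt}\Rightarrow z_{tt}$. Put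 $Z=z\circ h^{-1}$, $Z_t=z_t\circ h^{-1}$, $Z_{tt}=z_{tt}\circ h^{-1}$; then $Z^\epsilon\Rightarrow Z$, $Z_t^\epsilon\Rightarrow Z_t$, $Z_{tt}^\epsilon\Rightarrow Z_{tt}$ on $\mathbb R\times[0,T_0]$, $Z(\alpha',t)=\Psi(\alpha',t)$ and $\overline{Z_t}(\alpha',t)=F(\alpha',t)$. On $\overline P_-\times[0,T_0]$: $\Psi^\epsilon\Rightarrow\Psi$, $\frac1{\Psi^\epsilon_{z'}}\Rightarrow\frac1{\Psi_{z'}}$, $\frac{\Psi^\epsilon_t}{\Psi^\epsilon_{z'}}\Rightarrow\frac{\Psi_t}{\Psi_{z'}}$, $F^\epsilon\Rightarrow F$, $\mathfrak P^\epsilon\Rightarrow\mathfrak P$. On $P_-\times[0,T_0]$: $\Psi^\epsilon_t\Rightarrow\Psi_t$, $\Psi^\epsilon_{z'}\Rightarrow\Psi_{z'}$, $F^\epsilon_{z'}\Rightarrow F_{z'}$, $F^\epsilon_t\Rightarrow F_t$, $(\partial_{x'}-i\partial_{y'})\mathfrak P^\epsilon\Rightarrow(\partial_{x'}-i\partial_{y'})\mathfrak P$. Finally $\mathfrak P=-\frac12|F|^2-y'+\frac12K_{y'}*(|Z_t|^2)$ on $P_-\times[0,T_0]$. **Singular set.** $S(t)=\{\alpha'\in\mathbb{R} : \frac{1}{\Psi_{z'}}(\alpha',t)=0\}$ and $NS(t)=\mathbb{R}\setminus S(t)$. For $\alpha'\in NS(t)$, $Z_{,\alpha'}(\alpha',t)\neq0$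 denotes $\partial_{\alpha'}Z(\alpha',t)$, i.e. the boundary value of $\Psi_{z'}(\cdot,t)$ at $\alpha'$ (the reciprocal of the boundary value of $\frac1{\Psi_{z'}}$). One has $h(\alpha,t)\in NS(t)$ if and only if $\alpha\in NS(0)$. *)

(* Defs.v *)
From HB Require Import structures.
From mathcomp Require Import all_boot all_order all_algebra.
From mathcomp Require Import all_classical all_reals all_analysis.

Set Implicit Arguments.
Unset Strict Implicit.
Unset Printing Implicit Defensive.

Import Order.TTheory GRing.Theory Num.Theory.
Import numFieldNormedType.Exports.
From mathcomp Require Import complex.
Import Normc.

Local Open Scope classical_set_scope.
Local Open Scope ring_scope.
Local Open Scope complex_scope.

(* Complex numbers are [R[i]]; they carry the usual topology and the structure
   of a normed space over themselves through the alias [R[i]^o]. The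
   real-valued modulus is [normc]. Functions on the (closed) lower half plane
   and functions of time are total; their values outside the region of
   interest are never used: limits at the boundary of P_- are taken from
   inside P_-, and the derivatives in y' at the boundary, or in t at 0 and
   T, are one-sided. *)

Section Calculus.
Context {R : realType}.
Implicit Types (A D : set R) (T : R).

Definition derivable_in A (f : R -> R) (x : R) : Prop :=
  cvg (s^-1 * (f (x + s) - f x) @[s --> within [set s | A (x + s)] 0^']).

Definition derive_in A (f : R -> R) (x : R) : R :=
  lim (s^-1 * (f (x + s) - f x) @[s --> within [set s | A (x + s)] 0^']).

Definition cderivable_in A (f : R -> R[i]) (x : R) : Prop :=
  derivable_in A (fun s => Re (f s)) x /\ derivable_in A (fun s => Im (f s)) x.

Definition cderive_in A (f : R -> R[i]) (x : R) : R[i] :=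
  derive_in A (fun s => Re (f s)) x +i* derive_in A (fun s => Im (f s)) x.

Definition cderivable (f : R -> R[i]) (x : R) : Prop :=
  derivable (fun s => Re (f s)) x 1 /\ derivable (fun s => Im (f s)) x 1.

Definition cderive (f : R -> R[i]) (x : R) : R[i] :=
  derive1 (fun s => Re (f s)) x +i* derive1 (fun s => Im (f s)) x.

Definition cintegral A (f : R -> R[i]) : R[i] :=
  (\int[lebesgue_measure]_(x in A) Re (f x))
    +i* (\int[lebesgue_measure]_(x in A) Im (f x)).

Definition cintegrable A (f : R -> R[i]) : Prop :=
  lebesgue_measure.-integrable A (fun x => (Re (f x))%:E) /\
  lebesgue_measure.-integrable A (fun x => (Im (f x))%:E).

Definition expi (x : R) : R[i] := cos x +i* sin x.

Definition Pminus : set R[i] := [set z | Im z < 0].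
Definition clPminus : set R[i] := [set z | Im z <= 0].

Definition timeI T : set R := `[0, T].

Definition cinfty : set_system R[i] :=
  [set A | exists M : R, forall z, Pminus z -> M < normc z -> A z].

(* Tends to l as z' -> infinity in P_-. *)
Definition tends_at_infty (g : R[i] -> R[i]) (l : R[i]) : Prop :=
  g z @[z --> cinfty] --> (l : R[i]^o).

Definition dx (g : R[i] -> R[i]) (z : R[i]) : R[i] :=
  cderive (fun x => g (x +i* Im z)) (Re z).

Definition dy (g : R[i] -> R[i]) (z : R[i]) : R[i] :=
  cderive_in [set y | y <= 0] (fun y => g (Re z +i* y)) (Im z).

Definition dminus (g : R[i] -> R[i]) (z : R[i]) : R[i] := dx g z - 'i * dy g z.
Definition dplus (g : R[i] -> R[i]) (z : R[i]) : R[i] := dx g z + 'i * dy g z.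

Definition dz (g : R[i] -> R[i]) (z : R[i]) : R[i] := 2^-1 * dminus g z.

Definition dt T (X : Type) (f : X -> R -> R[i]) (p : X) (t : R) : R[i] :=
  cderive_in (timeI T) (f p) t.

Definition da (f : R -> R -> R[i]) (a t : R) : R[i] := cderive (f^~ t) a.

Definition toC (X : Type) (f : X -> R -> R) (p : X) (t : R) : R[i] := (f p t)%:C.

Definition holomorphic (g : R[i] -> R[i]) : Prop :=
  forall z, Pminus z -> derivable (g : R[i]^o -> R[i]^o) z 1.

Definition conformal (g : R[i] -> R[i]) : Prop :=
  holomorphic g /\ forall z, Pminus z -> dz g z <> 0.

(* The value at a point of the closed half plane of the continuous extension
   of a function known on P_-. *)
Definition ext (g : R[i] -> R[i]) (z : R[i]) : R[i] :=
  lim ((g w : R[i]^o) @[w --> within Pminus (nbhs (z : R[i]^o))]).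

Definition extends_continuously (g : R[i] -> R[i]) : Prop :=
  exists G : R[i]^o -> R[i]^o,
    {within (clPminus : set R[i]^o), continuous G} /\
    forall z, Pminus z -> G z = g z.

Definition cont_on (X Y : topologicalType) (A : set (X * R)) (f : X -> R -> Y) :
  Prop := {within A, continuous (fun p => f p.1 p.2)}.

(* Uniform convergence on compact subsets of U. *)
Definition cvg_compacts (X : topologicalType) (Y : uniformType)
    (U : set (X * R)) (f_ : nat -> X -> R -> Y) (f : X -> R -> Y) : Prop :=
  {family [set K | compact K /\ K `<=` U],
    (fun n (p : X * R) => f_ n p.1 p.2) @ \oo --> (fun p => f p.1 p.2)}.

Definition half_cont T (D : set R[i]) (f : R[i] -> R -> R[i]) : Prop :=
  @cont_on R[i]^o R[i]^o (D `*` timeI T) f.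

Definition half_cvg T (D : set R[i]) (f_ : nat -> R[i] -> R -> R[i])
  (f : R[i] -> R -> R[i]) : Prop :=
  @cvg_compacts R[i]^o R[i]^o (D `*` timeI T) f_ f.

Definition line_cont T (f : R -> R -> R[i]) : Prop :=
  @cont_on R R[i]^o (setT `*` timeI T) f.

Definition line_cvg T (f_ : nat -> R -> R -> R[i]) (f : R -> R -> R[i]) : Prop :=
  @cvg_compacts R R[i]^o (setT `*` timeI T) f_ f.

(* Of class C^n on D x [0,T], jointly in (x',y',t), where D is P_- or its
   closure. *)
Fixpoint half_Cn T (D : set R[i]) (n : nat) (f : R[i] -> R -> R[i]) : Prop :=
  half_cont T D f /\
  if n is m.+1 then
    [/\ forall z t, D z -> timeI T t ->
          [/\ cderivable (fun x => f (x +i* Im z) t) (Re z),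
              cderivable_in [set y | y <= 0] (fun y => f (Re z +i* y) t) (Im z)
            & cderivable_in (timeI T) (f z) t],
        half_Cn T D m (fun z t => dx (f^~ t) z),
        half_Cn T D m (fun z t => dy (f^~ t) z)
      & half_Cn T D m (dt T f)]
  else True.

Definition smooth_upto_boundary T (f : R[i] -> R -> R[i]) : Prop :=
  forall n, half_Cn T clPminus n f.

Fixpoint line_Cn T (n : nat) (f : R -> R -> R[i]) : Prop :=
  line_cont T f /\
  if n is m.+1 then
    [/\ forall a t, timeI T t ->
          cderivable (f^~ t) a /\ cderivable_in (timeI T) (f a) t,
        line_Cn T m (da f)
      & line_Cn T m (dt T f)]
  else True.

(* Inverse and composition in the spatial variable; hinv is the inverse of
   h(.,t) whenever h(.,t) is a bijection. *)
Definition hinv (h : R -> R -> R) (a t : R) : R := xget 0 [set b | h b t = a].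
Definition comp_sp (X : Type) (f : R -> R -> X) (g : R -> R -> R) (a t : R) : X :=
  f (g a t) t.

Definition homeomorphism (g : R -> R) : Prop :=
  exists g' : R -> R,
    [/\ cancel g g', cancel g' g, continuous g & continuous g'].

End Calculus.

Section Norms.
Context {R : realType}.
Implicit Types f g : R -> R[i].

Definition L2norm f : \bar R :=
  Lnorm lebesgue_measure 2%:E (fun x => (normc (f x))%:E).

Definition Linfnorm f : \bar R :=
  Lnorm lebesgue_measure +oo%E (fun x => (normc (f x))%:E).

Definition truncated_fourier f (N xi : R) : R[i] :=
  (Num.sqrt (2 * pi))^-1%:C *
    cintegral `[- N, N] (fun x => f x * expi (- (x * xi))).

(* g is the L^2 Fourier(-Plancherel) transform of f. *)
Definition is_fourier f g : Prop :=
  [/\ measurable_fun [set: R] (fun x => Re (g x)),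
      measurable_fun [set: R] (fun x => Im (g x)),
      (L2norm g < +oo)%E
    & L2norm (fun xi => truncated_fourier f N xi - g xi) @[N --> +oo] --> 0%E].

(* || |xi|^{1/2} f^ ||_2: the transform is unique almost everywhere, so that the infimum is over a
   single value; it is +oo if f has no Fourier transform in L^2. *)
Definition Hhalfnorm f : \bar R :=
  ereal_inf [set L2norm (fun xi => (Num.sqrt `|xi|)%:C * g xi) | g in is_fourier f].

Definition sup_heights (N : (R -> R[i]) -> \bar R) (g : R[i] -> R[i]) : \bar R :=
  ereal_sup [set N (fun x => g (x +i* y)) | y in [set y : R | y < 0]].

Definition invd (Psi : R[i] -> R[i]) (z : R[i]) : R[i] := (dz Psi z)^-1.

Definition energy (F Psi : R[i] -> R[i]) : \bar R :=
  let q := invd Psi in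
  let DF z := q z * dz F z in
  let sq (N : (R -> R[i]) -> \bar R) f := (N f ^+ 2)%E in
  (sup_heights (sq L2norm) (dz F)
   + sup_heights (sq Hhalfnorm) DF
   + sup_heights (sq L2norm) (fun z => (q z * dz DF z)%R)
   + sup_heights (sq Hhalfnorm) (fun z => (q z ^+ 2 * dz DF z)%R)
   + sup_heights (sq Linfnorm) q
   + sup_heights (sq L2norm) (dz q)
   + sup_heights (sq L2norm)
       (fun z => (q z * dz (fun w => q w * dz q w) z)%R))%E.

Definition l2size (F Psi : R[i] -> R[i]) : \bar R :=
  (sup_heights L2norm F + sup_heights L2norm (fun z => (invd Psi z - 1)%R))%E.

Definition poisson (y x : R) : R := - y / (pi * (x ^+ 2 + y ^+ 2)).

Definition poisson_conv (f : R -> R) (z : R[i]) : R :=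
  \int[lebesgue_measure]_s (poisson (Im z) (Re z - s) * f s).

End Norms.

Section WaterWaves.
Context {R : realType}.

Record wave := Wave {
  wF : R[i] -> R -> R[i];
  wPsi : R[i] -> R -> R[i];
  wP : R[i] -> R -> R }.

Implicit Types (T : R) (U V : wave).

Definition Ft T U := dt T (wF U).
Definition Psit T U := dt T (wPsi U).
Definition Fz U (z : R[i]) (t : R) : R[i] := dz ((wF U)^~ t) z.
Definition Psiz U (z : R[i]) (t : R) : R[i] := dz ((wPsi U)^~ t) z.
Definition iPsiz U (z : R[i]) (t : R) : R[i] := (Psiz U z t)^-1.
Definition gradP U (z : R[i]) (t : R) : R[i] := dminus ((toC (wP U))^~ t) z.

Definition extT (f : R[i] -> R -> R[i]) (z : R[i]) (t : R) : R[i] :=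
  ext (f^~ t) z.

Record water_wave T U : Prop := {
  ww_euler : forall z t, Pminus z -> timeI T t ->
    Ft T U z t - Psit T U z t * (Fz U z t / Psiz U z t)
      + (wF U z t)^* * (Fz U z t / Psiz U z t)
    = - (Psiz U z t)^-1 * gradP U z t + 'i;
  ww_holo : forall t, timeI T t -> holomorphic ((wF U)^~ t);
  ww_conf : forall t, timeI T t -> conformal ((wPsi U)^~ t);
  ww_pressure0 : forall (x : R) t, timeI T t -> wP U x%:C t = 0;
  ww_trace : forall (x : R) t, timeI T t -> exists b : R,
    ((Psiz U w t)^-1 * ((wF U w t)^* - Psit T U w t) : R[i]^o)
      @[w --> within Pminus (nbhs (x%:C : R[i]^o))] --> (b%:C : R[i]^o);
  ww_F_infty : forall t, timeI T t -> tends_at_infty ((wF U)^~ t) 0;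
  ww_gradP_infty : forall t, timeI T t -> tends_at_infty ((gradP U)^~ t) 'i;
  ww_Psiz_infty : forall t, timeI T t -> tends_at_infty ((Psiz U)^~ t) 1;
  ww_Psit_infty : forall t, timeI T t -> tends_at_infty ((Psit T U)^~ t) 0 }.

(* Fluid domains are unbounded: their boundary is a Jordan curve through the
   point at infinity. *)
Definition jordan_curve (G : set R[i]) : Prop :=
  exists g : R -> R[i],
    [/\ continuous (g : R -> R[i]^o), injective g,
        (normc (g x) @[x --> +oo] --> +oo) /\ (normc (g x) @[x --> -oo] --> +oo)
      & G = range g].

Definition boundary_set (A : set R[i]) : set R[i] :=
  closure (A : set R[i]^o) `\` interior (A : set R[i]^o).

Definition energy_at U (t : R) : \bar R := energy ((wF U)^~ t) ((wPsi U)^~ t).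
Definition l2size_at U (t : R) : \bar R := l2size ((wF U)^~ t) ((wPsi U)^~ t).

Record initial_data T U : Prop := {
  id_F_holo : holomorphic ((wF U)^~ 0);
  id_Psi_conf : conformal ((wPsi U)^~ 0);
  id_Psi_inj : {in Pminus &, injective ((wPsi U)^~ 0)};
  id_jordan : jordan_curve (boundary_set ((wPsi U)^~ 0 @` Pminus));
  id_Psiz_infty : tends_at_infty ((Psiz U)^~ 0) 1;
  (* constant extension in time: this is C^2 regularity in (x',y') *)
  id_P_C2 : half_Cn T Pminus 2 (fun z _ => (wP U z 0)%:C);
  id_P_laplace : forall z, Pminus z ->
    let p w := (wP U w 0)%:C in
    dx (dx p) z + dy (dy p) z = - (2 * normc (Fz U z 0) ^+ 2)%:C;
  id_P_bdry : forall x : R, wP U x%:C 0 = 0;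
  id_P_infty : tends_at_infty (dplus ((toC (wP U))^~ 0)) (- 'i);
  id_energy : (energy_at U 0 < +oo)%E;
  id_l2size : (l2size_at U 0 < +oo)%E }.

Record wave_regularity T U : Prop := {
  wr_Psi_C1 : half_Cn T Pminus 1 (wPsi U);
  wr_Psi_cont : half_cont T clPminus (wPsi U);
  wr_iPsiz_cont : half_cont T clPminus (extT (iPsiz U));
  wr_Psit_cont :
    half_cont T clPminus (extT (fun z t => Psit T U z t / Psiz U z t));
  wr_F_bounded : exists M : R, forall z t, clPminus z -> timeI T t ->
    normc (wF U z t) <= M;
  wr_F_cont : half_cont T clPminus (wF U);
  wr_F_C1 : half_Cn T Pminus 1 (wF U);
  wr_P_cont : half_cont T clPminus (toC (wP U));
  wr_P_C1 : half_Cn T Pminus 1 (toC (wP U));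
  wr_energy : forall t, timeI T t -> (energy_at U t < +oo)%E;
  wr_l2size : forall t, timeI T t -> (l2size_at U t < +oo)%E }.

(* Quantities on the boundary attached to a solution V smooth up to the
   boundary and to its flow g. *)
Definition bZ V (a t : R) : R[i] := wPsi V a%:C t.
Definition bZa V : R -> R -> R[i] := da (bZ V).
Definition biZa V (a t : R) : R[i] := (bZa V a t)^-1.
Definition bZt V (a t : R) : R[i] := (wF V a%:C t)^*.
Definition bZta V : R -> R -> R[i] := da (bZt V).
Definition bvel T V (a t : R) : R[i] :=
  (Psiz V a%:C t)^-1 * ((wF V a%:C t)^* - Psit T V a%:C t).
Definition bz V (g : R -> R -> R) : R -> R -> R[i] := comp_sp (bZ V) g.
Definition bzt T V g : R -> R -> R[i] := dt T (bz V g).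
Definition bztt T V g : R -> R -> R[i] := dt T (bzt T V g).
Definition bZtt T V g : R -> R -> R[i] := comp_sp (bztt T V g) (hinv g).

Definition A1_integrand V (a t s : R) : R :=
  normc (bZt V a t - bZt V s t) ^+ 2 / (a - s) ^+ 2.
Definition A1 V (a t : R) : R :=
  1 + (2 * pi)^-1 * \int[lebesgue_measure]_s A1_integrand V a t s.

Definition pressure_formula V (Zt : R -> R -> R[i]) (z : R[i]) (t : R) : Prop :=
  wP V z t = - 2^-1 * normc (wF V z t) ^+ 2 - Im z
             + 2^-1 * poisson_conv (fun s => normc (Zt s t) ^+ 2) z.

Record approximation T U (e : R) V (g : R -> R -> R) : Prop := {
  ap_sol : water_wave T V;
  ap_F_smooth : smooth_upto_boundary T (wF V);
  ap_Psi_smooth : smooth_upto_boundary T (wPsi V);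
  ap_P_smooth : smooth_upto_boundary T (toC (wP V));
  ap_F_init : forall z, clPminus z -> wF V z 0 = wF U (z - e%:C * 'i) 0;
  ap_Psi_init : forall z, clPminus z -> wPsi V z 0 = wPsi U (z - e%:C * 'i) 0;
  ap_Za_neq0 : forall a t, timeI T t -> bZa V a t <> 0;
  ap_flow_smooth : forall n, line_Cn T n (toC g);
  ap_flow : forall a t, timeI T t -> dt T (toC g) a t = bvel T V (g a t) t;
  ap_flow0 : forall a, g a 0 = a;
  ap_flow_homeo : forall t, timeI T t -> homeomorphism (g^~ t);
  ap_zt : forall a t, timeI T t -> bzt T V g a t = bZt V (g a t) t;
  ap_A1_finite : forall a t, timeI T t ->
    lebesgue_measure.-integrable [set: R] (fun s => (A1_integrand V a t s)%:E);
  ap_gradP : forall a t, timeI T t ->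
    (Psiz V a%:C t)^-1 * gradP V a%:C t = 'i * ((A1 V a t)%:C / bZa V a t);
  ap_Ztt : forall a t, timeI T t ->
    (bZtt T V g a t)^* - 'i = - 'i * ((A1 V a t)%:C / bZa V a t);
  ap_pressure : forall z t, Pminus z -> timeI T t ->
    pressure_formula V (bZt V) z t }.

Record uniform_bounds T V (g : R -> R -> R) (M M' c1 c2 : R) : Prop := {
  ub_Zta : forall t, timeI T t -> (L2norm ((bZta V)^~ t) <= M%:E)%E;
  ub_diZa : forall t, timeI T t -> (L2norm ((da (biZa V))^~ t) <= M%:E)%E;
  ub_A1 : forall t, timeI T t -> (Linfnorm ((toC (A1 V))^~ t) <= M%:E)%E;
  ub_DA1 : forall t, timeI T t ->
    (L2norm (fun a => (biZa V a t * da (toC (A1 V)) a t)%R) <= M%:E)%E;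
  ub_ba : forall t, timeI T t -> (Linfnorm ((da (bvel T V))^~ t) <= M%:E)%E;
  ub_hta : forall t, timeI T t ->
    (Linfnorm (fun a => (da (dt T (toC g)) a t / da (toC g) a t)%R) <= M%:E)%E;
  ub_zta : forall t, timeI T t ->
    (Linfnorm (fun a => (da (bzt T V g) a t / da (bz V g) a t)%R) <= M%:E)%E;
  ub_dZta : forall t, timeI T t ->
    (L2norm ((da (fun a s => (biZa V a s ^+ 2 * bZta V a s)%R))^~ t) <= M%:E)%E;
  ub_dZtabar : forall t, timeI T t ->
    (L2norm ((da (fun a s => (biZa V a s ^+ 2 * (bZta V a s)^*)%R))^~ t)
       <= M%:E)%E;
  ub_sup : forall t, timeI T t ->
    (Linfnorm ((bZt V)^~ t) + Linfnorm ((biZa V)^~ t) <= M'%:E)%E;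
  ub_ha : forall a t, timeI T t -> c1 <= normc (da (toC g) a t) <= c2;
  ub_za : forall a t, timeI T t ->
    c1 * normc (da (bz V g) a 0) <= normc (da (bz V g) a t)
      <= c2 * normc (da (bz V g) a 0);
  ub_zta0 : forall a t, timeI T t ->
    normc (da (bzt T V g) a t) <= c2 * normc (da (bz V g) a 0) }.

Definition line_bounded T (f : R -> R -> R[i]) : Prop :=
  exists M : R, forall a t, timeI T t -> normc (f a t) <= M.

Record limit_maps T U (h : R -> R -> R) (z : R -> R -> R[i]) (c1 c2 : R) :
    Prop := {
  lm_h_cont : line_cont T (toC h);
  lm_h_homeo : forall t, timeI T t -> homeomorphism (h^~ t);
  lm_h0 : forall a, h a 0 = a;
  lm_h_bilip : forall a b t, timeI T t -> a <> b ->
    c1 <= (h a t - h b t) / (a - b) <= c2;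
  lm_z_cont : line_cont T z;
  lm_z_t : forall a t, timeI T t -> cderivable_in (timeI T) (z a) t;
  lm_zt_cont : line_cont T (dt T z);
  lm_zt_bounded : line_bounded T (dt T z);
  lm_z_tt : forall a t, timeI T t -> cderivable_in (timeI T) (dt T z a) t;
  lm_ztt_cont : line_cont T (dt T (dt T z));
  lm_ztt_bounded : line_bounded T (dt T (dt T z));
  lm_Z : forall a t, timeI T t -> comp_sp z (hinv h) a t = wPsi U a%:C t;
  lm_Zt : forall a t, timeI T t ->
    (comp_sp (dt T z) (hinv h) a t)^* = wF U a%:C t;
  lm_pressure : forall w t, Pminus w -> timeI T t ->
    pressure_formula U (comp_sp (dt T z) (hinv h)) w t }.

Record convergence T U (h : R -> R -> R) (z : R -> R -> R[i])
    (V : nat -> wave) (g : nat -> R -> R -> R) : Prop := {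
  cv_h : line_cvg T (fun n => toC (g n)) (toC h);
  cv_hinv : line_cvg T (fun n => toC (hinv (g n))) (toC (hinv h));
  cv_z : line_cvg T (fun n => bz (V n) (g n)) z;
  cv_zt : line_cvg T (fun n => bzt T (V n) (g n)) (dt T z);
  cv_ztt : line_cvg T (fun n => bztt T (V n) (g n)) (dt T (dt T z));
  cv_Z : line_cvg T (fun n => bZ (V n)) (comp_sp z (hinv h));
  cv_Zt : line_cvg T (fun n => bZt (V n)) (comp_sp (dt T z) (hinv h));
  cv_Ztt : line_cvg T (fun n => bZtt T (V n) (g n))
             (comp_sp (dt T (dt T z)) (hinv h));
  cv_Psi : half_cvg T clPminus (fun n => wPsi (V n)) (wPsi U);
  cv_iPsiz : half_cvg T clPminus (fun n => iPsiz (V n)) (extT (iPsiz U));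
  cv_PsitPsiz : half_cvg T clPminus
    (fun n w t => Psit T (V n) w t / Psiz (V n) w t)
    (extT (fun w t => Psit T U w t / Psiz U w t));
  cv_F : half_cvg T clPminus (fun n => wF (V n)) (wF U);
  cv_P : half_cvg T clPminus (fun n => toC (wP (V n))) (toC (wP U));
  cv_Psit : half_cvg T Pminus (fun n => Psit T (V n)) (Psit T U);
  cv_Psiz : half_cvg T Pminus (fun n => Psiz (V n)) (Psiz U);
  cv_Fz : half_cvg T Pminus (fun n => Fz (V n)) (Fz U);
  cv_Ft : half_cvg T Pminus (fun n => Ft T (V n)) (Ft T U);
  cv_gradP : half_cvg T Pminus (fun n => gradP (V n)) (gradP U) }.

(* C, C', c1, c2 are the bounds, as functions of E_1(0) (and of c_0 for C');
   V e and g e are the approximation with parameter e and its flow, h and z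
   the limits along the sequence eps. *)
Record wu_solution T (C : R -> R) (C' : R -> R -> R) (c1 c2 : R -> R)
    U (V : R -> wave) (g : R -> R -> R -> R) (eps : nat -> R)
    (h : R -> R -> R) (z : R -> R -> R[i]) : Prop := {
  wu_sol : water_wave T U;
  wu_init : initial_data T U;
  wu_reg : wave_regularity T U;
  wu_approx : forall e, 0 < e <= 1 -> approximation T U e (V e) (g e);
  wu_c_gt0 : 0 < c1 (fine (energy_at U 0)) /\ 0 < c2 (fine (energy_at U 0));
  wu_bounds : forall e, 0 < e <= 1 ->
    let E0 := fine (energy_at U 0) in
    uniform_bounds T (V e) (g e) (C E0) (C' (fine (l2size_at U 0)) E0)
      (c1 E0) (c2 E0);
  wu_eps : forall n, 0 < eps n <= 1;
  wu_eps0 : eps @ \oo --> 0;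
  wu_limit : limit_maps T U h z
    (c1 (fine (energy_at U 0))) (c2 (fine (energy_at U 0)));
  wu_cvg : convergence T U h z (V \o eps) (g \o eps) }.

Definition singular U (t : R) : set R := [set a | extT (iPsiz U) a%:C t = 0].
Definition nonsingular U (t : R) : set R := ~` singular U t.

Definition DF U (w : R[i]) (t : R) : R[i] := (Psiz U w t)^-1 * Fz U w t.
Definition DFbar U (w : R[i]) (t : R) : R[i] := (Psiz U w t)^-1 * (Fz U w t)^*.

(* Z_{,alpha'}/|Z_{,alpha'}| where Z = z \o h^{-1} *)
Definition tangent (h : R -> R -> R) (z : R -> R -> R[i]) (a t : R) : R[i] :=
  let Za := da (comp_sp z (hinv h)) a t in Za / (normc Za)%:C.

End WaterWaves.

Arguments wave R : clear implicits.

(* Main.v *)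
Require Import Defs.
From HB Require Import structures.
From mathcomp Require Import all_boot all_order all_algebra.
From mathcomp Require Import all_classical all_reals all_analysis.

Set Implicit Arguments.
Unset Strict Implicit.
Unset Printing Implicit Defensive.

Import Order.TTheory GRing.Theory Num.Theory.
Import numFieldNormedType.Exports.
From mathcomp Require Import complex measurable_realfun.
From mathcomp Require Import ring lra.
Import Normc.

Local Open Scope classical_set_scope.
Local Open Scope ring_scope.
Local Open Scope complex_scope.

(* Write f = 1/Psi_z', p = F_z'. At a fixed time the energy bounds p, f (f p)'
   and f' in L^2 of the horizontal lines, uniformly in the height. At a
   nonsingular point f p is horizontally equicontinuous and its averages are
   pinned down by the increments of F, which is continuous up to the boundary;
   so f p has a limit. At a singular point (f p)^2 is equicontinuous, because
   ((f p)^2)' = 2 p (f (f p)') and p is equi-integrable, while the uniform bound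
   on the integral of |p|^2 = |f p|^2 / |f|^2 with |f|^2 = O(|x - x0|) near the
   boundary forces f p to be small somewhere nearby; so f p -> 0.

   For the tangent, let D(s) = z(b,s) - z(a,s) be a chord of the interface moving
   with the flow. The argument of D turns at the rate Im (D'/D), and as b -> a
   the rate D'/D converges to the value of conj(F_z') / Psi_z' at h(a,s) while
   D / |D| converges to the tangent. The uniform estimates on the
   approximations give |f(h(a,s),s)| ~ |f(a,0)| and |D'(s)| <= K |b - a| with
   K ~ 1 / |f(a,0)|. So these rates are dominated, and the limit rate is bounded
   independently of a; since it vanishes at the singular points, dominated
   convergence also yields the last claim. *)

(** * Complex calculus *)

(** At a singular point (f p)' = q / f is out of control where f vanishes, whereas the derivative of
    the square factors into p and q = f (f p)', both bounded in L^2. Boundedness of p alone would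
    only keep the increments of the square bounded; equi-integrability makes them small. It is
    obtained without boundary values or Fourier analysis: for a Hardy function the inner product of
    the lines at heights m + s and m - s does not depend on s, so the parallelogram identity
    compares the L^2 distance of two lines with their energies and the energy of the line halfway.
    The energy is then midpoint convex and bounded, hence monotone and convergent at the boundary,
    and the lines are Cauchy in L^2.

    Chords are used for the tangent because the approximations of F_z' converge only inside P_-,
    while those of F, Psi and 1/Psi_z' converge up to the boundary: the differentiated equation on
    the smooth interfaces has no evident limit. A chord involves only z and z_t. The flow h is
    merely bi-Lipschitz in space, and its increments cancel in D'/D. *)

Section ComplexModulus.
Context {R : realType}.
Implicit Types (z w : R[i]) (x y : R).

Lemma normc_modulusE z : `|z| = (normc z)%:C. Proof. by []. Qed.

Lemma normc_ge0 z : 0 <= normc z.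
Proof. by case: z => a b; exact: sqrtr_ge0. Qed.

Lemma normc_eq0 z : (normc z == 0) = (z == 0).
Proof. by apply/eqP/eqP => [/eq0_normc//|->]; rewrite normc0. Qed.

Lemma normc_gt0 z : (0 < normc z) = (z != 0).
Proof. by rewrite lt_def normc_ge0 andbT normc_eq0. Qed.

Lemma normc_real x : normc x%:C = `|x|.
Proof. by rewrite /= expr0n addr0 sqrtr_sqr. Qed.

Lemma normci : normc 'i = 1 :> R.
Proof. by rewrite /= expr0n expr1n add0r sqrtr1. Qed.

Lemma normc_opp z : normc (- z) = normc z.
Proof. by case: z => a b /=; rewrite !sqrrN. Qed.

Lemma normc_conj z : normc z^* = normc z.
Proof. by case: z => a b /=; rewrite sqrrN. Qed.

Lemma normcD_le z w : normc (z + w) <= normc z + normc w.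
Proof. exact: le_normcD. Qed.

Lemma normc_distC z w : normc (z - w) = normc (w - z).
Proof. by rewrite -normc_opp opprB. Qed.

Lemma normcB_le z w : normc (z - w) <= normc z + normc w.
Proof. by rewrite (le_trans (normcD_le _ _))// normc_opp. Qed.

Lemma normc_dist_triangle z1 z2 z3 :
  normc (z1 - z3) <= normc (z1 - z2) + normc (z2 - z3).
Proof. by rewrite (le_trans _ (normcD_le _ _))// addrA subrK. Qed.

Lemma ler_normcB z w : normc z - normc w <= normc (z - w).
Proof.
by rewrite lerBlDr; have := normcD_le (z - w) w; rewrite subrK.
Qed.

Lemma sqr_normcE z : normc z ^+ 2 = Re z ^+ 2 + Im z ^+ 2.
Proof. by case: z => a b /=; rewrite sqr_sqrtr// addr_ge0// sqr_ge0. Qed.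

Lemma normc_Re_le z : `|Re z| <= normc z.
Proof.
by rewrite -ler_sqr ?nnegrE ?normc_ge0// sqr_normcE real_normK ?num_real// lerDl sqr_ge0.
Qed.

Lemma normc_Im_le z : `|Im z| <= normc z.
Proof.
by rewrite -ler_sqr ?nnegrE ?normc_ge0// sqr_normcE real_normK ?num_real// lerDr sqr_ge0.
Qed.

Lemma normc_le_sum z : normc z <= `|Re z| + `|Im z|.
Proof.
case: z => a b; have -> : a +i* b = a%:C + 'i * b%:C by simpc.
apply: (le_trans (normcD_le _ _)); rewrite normcM normci mul1r !normc_real.
by simpc => /=; rewrite lexx.
Qed.

Lemma Re_add z w : Re (z + w) = Re z + Re w. Proof. by case: z; case: w. Qed.
Lemma Im_add z w : Im (z + w) = Im z + Im w. Proof. by case: z; case: w. Qed.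
Lemma Re_opp z : Re (- z) = - Re z. Proof. by case: z. Qed.
Lemma Im_opp z : Im (- z) = - Im z. Proof. by case: z. Qed.
Lemma Re_mul z w : Re (z * w) = Re z * Re w - Im z * Im w.
Proof. by case: z; case: w. Qed.
Lemma Im_mul z w : Im (z * w) = Re z * Im w + Im z * Re w.
Proof. by case: z; case: w. Qed.

End ComplexModulus.

(** * Limits of complex functions with real radii *)

Section ComplexTopology.
Context {R : realType}.
Implicit Types (z w : R[i]) (x y : R).

Lemma cvg_normcP (T : Type) (F : set_system T) (FF : Filter F) (f : T -> R[i]) (l : R[i]) :
  (f x : R[i]^o) @[x --> F] --> (l : R[i]^o) <->
  (forall e : R, 0 < e -> \forall x \near F, normc (f x - l) < e).
Proof.
split=> [/cvgrPdist_lt fl e e0|fl].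
  have := fl e%:C; rewrite ltcR => /(_ e0); apply: filterS => x /=.
  by rewrite normc_modulusE ltcR normc_distC.
apply/cvgrPdist_lt => -[e e']; rewrite ltcE /= => /andP[/eqP e'0 e0].
have := fl e e0; apply: filterS => x.
by rewrite normc_modulusE normc_distC ltcE /= e'0 eqxx.
Qed.

Lemma nbhs_normcP (z : R[i]) (A : set R[i]) :
  nbhs (z : R[i]^o) A <->
  exists2 d : R, 0 < d & forall w, normc (w - z) < d -> A w.
Proof.
split=> [|[d d0 dA]].
  move=> /nbhs_ballP[[d d']]/=; rewrite ltcE /= => /andP[/eqP d'0 d0] dA.
  exists d => // w wz; apply: dA; rewrite /ball/= normc_modulusE normc_distC ltcE /= d'0 eqxx//.
apply/nbhs_ballP; exists d%:C; rewrite /= ?ltcR// => w; rewrite /ball/=.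
by rewrite normc_modulusE ltcR normc_distC => /dA.
Qed.

Lemma near_normcP (z : R[i]) (D P : set R[i]) :
  (\forall w \near within D (nbhs (z : R[i]^o)), P w) <->
  exists2 d : R, 0 < d & forall w, normc (w - z) < d -> D w -> P w.
Proof. exact: nbhs_normcP. Qed.

(** The balls of [R[i]^o] have complex radii; this form has real ones, and [climP] translates. The
    point [z] is not excluded when it lies in [D], so [clim setT f z (f z)] is continuity. *)
Definition clim (D : set R[i]) (f : R[i] -> R[i]) (z l : R[i]) : Prop :=
  forall e : R, 0 < e -> exists2 d : R, 0 < d &
    forall w, normc (w - z) < d -> D w -> normc (f w - l) < e.

Lemma climP (D : set R[i]) (f : R[i] -> R[i]) (z l : R[i]) :
  clim D f z l <->
  (f w : R[i]^o) @[w --> within D (nbhs (z : R[i]^o))] --> (l : R[i]^o).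
Proof.
have FF := @within_filter _ D _ (nbhs_filter (z : R[i]^o)).
split=> [H|/(cvg_normcP FF) H e e0]; last exact/near_normcP/H.
by apply/(cvg_normcP FF) => e e0; exact/near_normcP/H.
Qed.

Lemma near_realP (x : R) (P : set R) :
  (\forall s \near x, P s) <->
  exists2 d : R, 0 < d & forall s, `|s - x| < d -> P s.
Proof.
split=> [/nbhs_ballP[d d0 dP]|[d d0 dP]].
  by exists d => // s sx; apply: dP; rewrite /ball/= distrC.
by apply/nbhs_ballP; exists d => // s; rewrite /ball/= distrC; exact: dP.
Qed.

Section ComplexLimits.
Variables (D : set R[i]) (z : R[i]).
Implicit Types (f g : R[i] -> R[i]) (a b : R[i]).

Let FF := @within_filter _ D _ (nbhs_filter (z : R[i]^o)).

Lemma climD f g a b : clim D f z a -> clim D g z b ->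
  clim D (fun w => f w + g w) z (a + b).
Proof. by move=> /climP fa /climP gb; apply/climP; exact: (@cvgD R[i] R[i]^o R[i] _ FF f g a b fa gb). Qed.

Lemma climN f a : clim D f z a -> clim D (fun w => - f w) z (- a).
Proof. by move=> /climP fa; apply/climP; exact: (@cvgN R[i] R[i]^o R[i] _ FF f a fa). Qed.

Lemma climM f g a b : clim D f z a -> clim D g z b ->
  clim D (fun w => f w * g w) z (a * b).
Proof. by move=> /climP fa /climP gb; apply/climP; exact: (@cvgM R[i] R[i] _ FF f g a b fa gb). Qed.

Lemma climV f a : a != 0 -> clim D f z a -> clim D (fun w => (f w)^-1) z a^-1.
Proof. by move=> a0 /climP fa; apply/climP; exact: (@cvgV R[i] R[i] _ FF f a a0 fa). Qed.

Lemma clim_cst a : clim D (fun=> a) z a.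
Proof. by move=> e e0; exists 1 => // w _ _; rewrite subrr normc0. Qed.

Lemma clim_conj f a : clim D f z a -> clim D (fun w => (f w)^*) z a^*.
Proof.
move=> fa e e0; have [d d0 H] := fa e e0; exists d => // w wd Dw.
by rewrite -raddfB /= normc_conj H.
Qed.

Lemma clim_eq f g a : (forall w, D w -> f w = g w) -> clim D f z a -> clim D g z a.
Proof.
move=> fg fa e e0; have [d d0 H] := fa e e0; exists d => // w wd Dw.
by rewrite -fg// H.
Qed.

Lemma clim_norm0 f g : (forall w, D w -> normc (f w) <= normc (g w)) ->
  clim D g z 0 -> clim D f z 0.
Proof.
move=> fg g0 e e0; have [d d0 H] := g0 e e0; exists d => // w wd Dw.
by have := H w wd Dw; rewrite !subr0; apply: le_lt_trans; exact: fg.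
Qed.

End ComplexLimits.

Lemma clim_sub (D E : set R[i]) f (z a : R[i]) : D `<=` E -> clim E f z a -> clim D f z a.
Proof.
move=> DE fa e e0; have [d d0 H] := fa e e0; exists d => // w wd Dw.
by apply: H => //; exact: DE.
Qed.

Lemma clim_neq0 (D : set R[i]) f (z a : R[i]) : a != 0 -> clim D f z a ->
  exists2 d : R, 0 < d & forall w, normc (w - z) < d -> D w -> f w != 0.
Proof.
move=> a0 fa; have := fa (normc a); rewrite normc_gt0 => /(_ a0)[d d0 H].
exists d => // w wd /(H w wd); apply: contraTneq => ->.
by rewrite sub0r normc_opp ltxx.
Qed.

End ComplexTopology.

(** * Complex derivatives, and derivatives of curves in the complex plane *)

Section ComplexDerivative.
Context {R : realType}.
Implicit Types (z w l : R[i]) (x y : R) (H : R[i] -> R[i]) (f : R -> R[i]).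

(** The increment form with a weak inequality makes sense at [k = 0] as well, so that chain and
    product rules need no case distinction on vanishing increments. *)
Definition cder H z l := forall e : R, 0 < e -> exists2 d : R, 0 < d &
  forall k, normc k < d -> normc (H (z + k) - H z - l * k) <= e * normc k.

Definition vder f x l := forall e : R, 0 < e -> exists2 d : R, 0 < d &
  forall s, `|s| < d -> normc (f (x + s) - f x - l * s%:C) <= e * `|s|.

Lemma cder_vder H f x l m : cder H (f x) l -> vder f x m ->
  vder (H \o f) x (l * m).
Proof.
move=> Hl fm e e0.
pose K := normc m + 1; have K0 : 0 < K by rewrite ltr_pwDr// normc_ge0.
pose L := normc l + 1; have L0 : 0 < L by rewrite ltr_pwDr// normc_ge0.
have eK : 0 < e / (2 * K) by rewrite divr_gt0// mulr_gt0.
have [d1 d10 H1] := Hl _ eK.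
have e1 : 0 < Num.min 1 (e / (2 * L)).
  by rewrite lt_min ltr01/= divr_gt0// mulr_gt0.
have [d2 d20 H2] := fm _ e1.
exists (Num.min d2 (d1 / K)) => [|s].
  by rewrite lt_min d20 divr_gt0.
rewrite lt_min => /andP[sd2 sd1].
have H2s := H2 s sd2.
set k := f (x + s) - f x in H2s.
have kK : normc k <= K * `|s|.
  rewrite -[k](subrK (m * s%:C)) (le_trans (normcD_le _ _))// normcM normc_real.
  have -> : K * `|s| = 1 * `|s| + normc m * `|s| by rewrite /K; ring.
    rewrite (le_trans (lerD H2s (lexx _)))// lerD2r.
  by rewrite ler_wpM2r// ge_min lexx.
have kd1 : normc k < d1.
  by rewrite (le_lt_trans kK)// mulrC -ltr_pdivlMr.
have H1k := H1 k kd1.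
have -> : (H \o f) (x + s) - (H \o f) x - l * m * s%:C =
   (H (f x + k) - H (f x) - l * k) + l * (k - m * s%:C).
  by rewrite /= /k (addrC (f x)) subrK; ring.
rewrite (le_trans (normcD_le _ _))// normcM.
have A : normc (H (f x + k) - H (f x) - l * k) <= e / 2 * `|s|.
  rewrite (le_trans H1k)//.
  have -> : e / 2 * `|s| = e / (2 * K) * (K * `|s|).
    by rewrite mulrA; congr (_ * _); field; rewrite gt_eqF.
  by rewrite ler_wpM2l// divr_ge0// ?mulr_ge0// ltW.
have B : normc l * normc (k - m * s%:C) <= e / 2 * `|s|.
  have -> : e / 2 * `|s| = L * (e / (2 * L) * `|s|).
    by rewrite mulrA; congr (_ * _); field; rewrite gt_eqF.
  apply: ler_pM; rewrite ?normc_ge0//; first by rewrite /L lerDl.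
  by rewrite (le_trans H2s)// ler_wpM2r// ge_min lexx orbT.
by rewrite (le_trans (lerD A B))// -mulrDl -splitr.
Qed.

(** Caratheodory's form: a slope function continuous at [z] reduces the rules for sums, products and
    inverses to the algebra of limits. *)
Lemma cder_caratheodory H z l : cder H z l <->
  exists2 phi : R[i] -> R[i], clim setT phi z l &
    phi z = l /\ forall w, H w = H z + phi w * (w - z).
Proof.
split=> [Hl|[phi phil [_ Hphi]] e e0]; last first.
  have [d d0 phid] := phil e e0.
  exists d => // k kd; rewrite Hphi (addrC z) addrK.
  rewrite (_ : _ - _ - _ = (phi (k + z) - l) * k); last by ring.
  by rewrite normcM ler_wpM2r ?normc_ge0// ltW// phid// addrK.
exists (fun w => if w == z then l else (H w - H z) / (w - z)).
  move=> e e0; have [d d0 Hd] := Hl (e / 2) (divr_gt0 e0 (ltr0Sn R 1)).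
  exists d => // w wd _; case: eqP => [_|/eqP]; first by rewrite subrr normc0.
  rewrite -subr_eq0 => k0; have := Hd _ wd; rewrite (addrC z) subrK => {}Hd.
  have -> : (H w - H z) / (w - z) - l = (H w - H z - l * (w - z)) / (w - z) by field.
  rewrite normcM normcV ltr_pdivrMr ?normc_gt0//.
  rewrite (le_lt_trans Hd)// ltr_pM2r ?normc_gt0// ltr_pdivrMr// ltr_pMr//.
  by rewrite ltr1n.
split=> [|w]; first by rewrite eqxx.
case: eqP => [->|/eqP]; first by rewrite subrr mulr0 addr0.
by rewrite -subr_eq0 => k0; rewrite divfK// [RHS]addrC subrK.
Qed.

Lemma cder_cont H z l : cder H z l -> clim setT H z (H z).
Proof.
move=> Hl e e0; have [d d0 H1] := Hl 1 ltr01; pose K := 1 + normc l.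
have K0 : 0 < K by rewrite ltr_pwDl// normc_ge0.
exists (Num.min d (e / K)) => [|w]; first by rewrite lt_min d0 divr_gt0.
rewrite lt_min => /andP[wd we] _; have := H1 _ wd; rewrite (addrC z) subrK mul1r => H2.
rewrite (_ : H w - H z = (H w - H z - l * (w - z)) + l * (w - z)); last by rewrite subrK.
rewrite (le_lt_trans (normcD_le _ _))//.
rewrite (le_lt_trans (lerD H2 (lexx _)))// normcM -{1}[normc (w - z)]mul1r -mulrDl.
by rewrite mulrC -ltr_pdivlMr.
Qed.

Lemma cder_unique H z l m : cder H z l -> cder H z m -> l = m.
Proof.
move=> Hl Hm; apply/eqP; rewrite -subr_eq0 -normc_eq0; apply/eqP.
apply/le_anti; rewrite normc_ge0 andbT; apply/ler_addgt0Pr => e e0; rewrite add0r.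
have e20 : 0 < e / 2 by rewrite divr_gt0.
have [d1 d10 H1] := Hl _ e20; have [d2 d20 H2] := Hm _ e20.
pose k := Num.min d1 d2 / 2.
have k0 : 0 < k by rewrite divr_gt0// lt_min d10.
have kd : k < Num.min d1 d2 by rewrite /k ltr_pdivrMr// ltr_pMr ?ltr1n// lt_min d10.
move: kd; rewrite lt_min => /andP[kd1 kd2].
have nk : normc k%:C = k by rewrite normc_real gtr0_norm.
have H1k := H1 k%:C; rewrite nk in H1k; have {}H1k := H1k kd1.
have H2k := H2 k%:C; rewrite nk in H2k; have {}H2k := H2k kd2.
rewrite -(ler_pM2r k0) -[X in _ * X <= _]nk -normcM.
have -> : (l - m) * k%:C = (H (z + k%:C) - H z - m * k%:C)
   - (H (z + k%:C) - H z - l * k%:C) by ring.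
rewrite (le_trans (normcB_le _ _))// (le_trans (lerD H2k H1k))//.
by rewrite -mulrDl -splitr.
Qed.

Lemma cderM H G z l m : cder H z l -> cder G z m ->
  cder (fun w => H w * G w) z (l * G z + H z * m).
Proof.
move=> Hl Gm; have Gc := cder_cont Gm; move: Hl Gm.
move=> /cder_caratheodory[p pl [p0 Hp]] /cder_caratheodory[q qm [q0 Gq]].
apply/cder_caratheodory; exists (fun w => p w * G w + H z * q w).
  by apply: climD; apply: climM => //; exact: clim_cst.
by split=> [|w]; [rewrite p0 q0|rewrite {1}Hp mulrDl {1}Gq; ring].
Qed.

Lemma cderV H z l : H z != 0 -> cder H z l ->
  cder (fun w => (H w)^-1) z (- l / H z ^+ 2).
Proof.
move=> Hz0 Hl; have Hc := cder_cont Hl.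
have [d d0 Hd] := clim_neq0 Hz0 Hc.
move: Hl => /cder_caratheodory[p pl [p0 Hp]].
apply/cder_caratheodory.
(* [H] may vanish far from [z]: the algebraic slope is used in the ball where [H] is nonzero, and
   the plain difference quotient outside, where it has no effect on the limit. *)
exists (fun w => if normc (w - z) < d then - p w / (H z * H w)
   else ((H w)^-1 - (H z)^-1) / (w - z)).
  have L : clim setT (fun w => - p w / (H z * H w)) z (- l / H z ^+ 2).
    rewrite expr2; apply: climM; first exact: climN.
    apply: climV; first by rewrite mulf_neq0.
    by apply: climM => //; exact: clim_cst.
  move=> e e0; have [d1 d10 H1] := L e e0.
  exists (Num.min d d1) => [|w]; first by rewrite lt_min d0.
  by rewrite lt_min => /andP[wd wd1]; rewrite wd; exact: H1.
split=> [|w]; first by rewrite subrr normc0 d0 p0 expr2.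
case: ifPn => [wd|wd].
  have Hw0 := Hd w wd I; have Ew := Hp w; set k := w - z in Ew *.
  have -> : - p w / (H z * H w) * k = - (p w * k) / (H z * H w) by ring.
  have -> : p w * k = H w - H z by rewrite Ew; ring.
  by field; apply/andP.
have k0 : w - z != 0 by apply/eqP => k0; move: wd; rewrite k0 normc0 d0.
by rewrite divfK// [RHS]addrC subrK.
Qed.

Lemma cder_derivable H z l : cder H z l <->
  derivable (H : R[i]^o -> R[i]^o) z 1 /\ 'D_1 (H : R[i]^o -> R[i]^o) z = l.
Proof.
have E : cder H z l <-> (h^-1 *: (H (h *: 1 + z) - H z) : R[i]^o) @[h --> within (fun h => h != 0) (nbhs (0 : R[i]^o))] --> (l : R[i]^o).
  split=> [Hl|/climP Hl].
    apply/climP => e e0.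
    have [d d0 Hd] := Hl (e / 2) (divr_gt0 e0 (ltr0Sn R 1)).
    exists d => // k; rewrite subr0 => kd k0.
    have -> : k^-1 *: (H (k *: 1 + z) - H z) - l = (H (z + k) - H z - l * k) / k.
      by rewrite /GRing.scale/= mulr1 (addrC k); field.
    rewrite normcM normcV ltr_pdivrMr ?normc_gt0//.
    rewrite (le_lt_trans (Hd k kd))// ltr_pM2r ?normc_gt0// ltr_pdivrMr// ltr_pMr//.
    by rewrite ltr1n.
  move=> e e0; have [d d0 Hd] := Hl e e0; exists d => // k kd.
  have [->|k0] := eqVneq k 0; first by rewrite addr0 subrr mulr0 subrr normc0 mulr0.
  have := Hd k; rewrite subr0 => /(_ kd k0) /ltW.
  have -> : k^-1 *: (H (k *: 1 + z) - H z) - l = (H (z + k) - H z - l * k) / k.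
    by rewrite /GRing.scale/= mulr1 (addrC k); field.
  by rewrite normcM normcV ler_pdivrMr ?normc_gt0.
rewrite E; split=> [Hl|[Hd <-]]; last exact: Hd.
split; first by apply/cvg_ex; exists l.
apply: (cvg_lim _ Hl) => //; exact: (@Proper_dnbhs_numFieldType R[i] (0 : R[i]^o)).
Qed.

Lemma vder_is_derive f x l : vder f x l <->
  is_derive x 1 (fun s => Re (f s)) (Re l) /\ is_derive x 1 (fun s => Im (f s)) (Im l).
Proof.
have E (u : R -> R) m : is_derive x 1 u m <->
    (forall e, 0 < e -> exists2 d, 0 < d & forall s, `|s| < d -> `|u (x + s) - u x - m * s| <= e * `|s|).
  split=> [um|um].
    have /derivable1P: derivable u x 1 by exact: ex_derive.
    have um1 : 'D_1 u x = m by rewrite derive_val.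
    have /cvgrPdist_lt : h^-1 *: (u (h *: 1 + x) - u x) @[h --> 0^'] --> m.
      by rewrite -um1; exact: ex_derive.
    move=> ul _ e e0; have /nbhs_ballP[d d0 Hd] := ul e e0.
    exists d => // s sd; have [->|s0] := eqVneq s 0.
      by rewrite addr0 subrr mulr0 subrr normr0 mulr0.
    have := Hd s; rewrite /ball/= sub0r normrN => /(_ sd s0) /ltW.
    have -> : m - s^-1 *: (u (s *: 1 + x) - u x) = - (u (x + s) - u x - m * s) / s.
      by rewrite /GRing.scale/= mulr1 (addrC s); field.
    by rewrite normrM normfV normrN ler_pdivrMr ?normr_gt0.
  have L : h^-1 *: (u (h *: 1 + x) - u x) @[h --> 0^'] --> m.
    apply/cvgrPdist_le => e e0; have [d d0 Hd] := um e e0.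
    apply/nbhs_ballP; exists d => // s; rewrite /ball/= sub0r normrN => sd s0.
    have -> : m - s^-1 *: (u (s *: 1 + x) - u x) = - (u (x + s) - u x - m * s) / s.
      by rewrite /GRing.scale/= mulr1 (addrC s); field.
    by rewrite normrM normfV normrN ler_pdivrMr ?normr_gt0// Hd.
  by apply: DeriveDef; [apply/cvg_ex; exists m|exact: cvg_lim L].
split=> [fl|[]/E fR /E fI e e0].
  split; apply/E => e e0; have [d d0 Hd] := fl e e0; exists d => // s sd.
    apply: le_trans (Hd s sd); apply: le_trans (normc_Re_le _); rewrite !(Re_add, Re_opp, Re_mul)/=.
    by rewrite mulr0 subr0.
  apply: le_trans (Hd s sd); apply: le_trans (normc_Im_le _); rewrite !(Im_add, Im_opp, Im_mul)/=.
  by rewrite mulr0 add0r.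
have e20 : 0 < e / 2 by rewrite divr_gt0.
have [d1 d10 H1] := fR _ e20; have [d2 d20 H2] := fI _ e20.
exists (Num.min d1 d2) => [|s]; first by rewrite lt_min d10.
rewrite lt_min => /andP[s1 s2]; rewrite (le_trans (normc_le_sum _))//.
rewrite !(Re_add, Re_opp, Re_mul, Im_add, Im_opp, Im_mul)/= mulr0 subr0 mulr0 add0r.
by rewrite (le_trans (lerD (H1 s s1) (H2 s s2)))// -mulrDl -splitr.
Qed.

End ComplexDerivative.

(** * Mean value inequality, uniformity over segments, continuity of curves *)

Section CurveCalculus.
Context {R : realType}.
Implicit Types (z w l : R[i]) (x y : R) (H : R[i] -> R[i]) (f : R -> R[i]).

Lemma cderD H G z l m : cder H z l -> cder G z m -> cder (fun w => H w + G w) z (l + m).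
Proof.
move=> /cder_caratheodory[p pl [p0 Hp]] /cder_caratheodory[q qm [q0 Gq]].
apply/cder_caratheodory; exists (fun w => p w + q w); first exact: climD.
by split=> [|w]; [rewrite p0 q0|rewrite {1}Hp {1}Gq; ring].
Qed.

Lemma cder_cst (c z : R[i]) : cder (fun=> c) z 0.
Proof.
by move=> e e0; exists 1 => // k _; rewrite subrr mul0r subrr normc0 mulr_ge0 ?normc_ge0// ltW.
Qed.

Lemma cder_id z : cder id z 1.
Proof.
move=> e e0; exists 1 => // k _; rewrite (_ : _ - _ - _ = 0); last by rewrite mul1r; ring.
by rewrite normc0 mulr_ge0 ?normc_ge0// ltW.
Qed.

Lemma vder_affine (a b : R[i]) x : vder (fun s => a + b * s%:C) x b.
Proof.
move=> e e0; exists 1 => // s _; rewrite (_ : _ - _ - _ = 0).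
  by rewrite normc0 mulr_ge0// ltW.
by rewrite raddfD/=; ring.
Qed.

Lemma vder_eq f g x l m : f =1 g -> l = m -> vder f x l -> vder g x m.
Proof. by move=> /funext -> ->. Qed.

Lemma complex_split x y : x +i* y = x%:C + 'i * y%:C.
Proof. by simpc. Qed.

Lemma cder_horizontal H x y l : cder H (x +i* y) l -> vder (fun s => H (s +i* y)) x l.
Proof.
move=> Hl; apply: (@vder_eq (H \o (fun s => 'i * y%:C + 1 * s%:C)) _ _ (l * 1)).
- by move=> s /=; congr H; rewrite mul1r addrC complex_split.
- by rewrite mulr1.
apply: cder_vder; last exact: vder_affine.
by rewrite mul1r addrC -complex_split.
Qed.

Lemma cder_vertical H x y l : cder H (x +i* y) l -> vder (fun s => H (x +i* s)) y (l * 'i).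
Proof.
move=> Hl; apply: (@vder_eq (H \o (fun s => x%:C + 'i * s%:C)) _ _ (l * 'i)).
- by move=> s /=; congr H; rewrite complex_split.
- by [].
apply: cder_vder; last exact: vder_affine.
by rewrite -complex_split.
Qed.

Lemma vder_Re f x l : vder f x l -> is_derive x 1 (fun s => Re (f s)) (Re l).
Proof. by case/vder_is_derive. Qed.

Lemma vder_Im f x l : vder f x l -> is_derive x 1 (fun s => Im (f s)) (Im l).
Proof. by case/vder_is_derive. Qed.

Lemma vderZ (c : R[i]) f x l : vder f x l -> vder (fun s => c * f s) x (c * l).
Proof.
move=> fl; apply: (@vder_eq ((fun w => c * w) \o f) _ _ ((0 * f x + c * 1) * l)) => //.
  by ring.
by apply: cder_vder => //; apply: cderM; [exact: cder_cst|exact: cder_id].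
Qed.

Lemma is_derive_cts (u : R -> R) (x l : R) : is_derive x 1 u l -> {for x, continuous u}.
Proof. by move=> ul; apply/differentiable_continuous/derivable1_diffP; exact: ex_derive. Qed.

Lemma is_derive_within (u v : R -> R) (a b : R) :
  (forall x, a <= x <= b -> is_derive x 1 u (v x)) ->
  {within `[a, b], continuous u}.
Proof.
move=> uv; apply: continuous_in_subspaceT => x; rewrite inE/= in_itv/= => xab.
exact: is_derive_cts (uv x xab).
Qed.

Lemma is_derive_nondecreasing (u v : R -> R) (a b : R) : a <= b ->
  (forall x, a < x < b -> is_derive x 1 u (v x)) -> (forall x, a < x < b -> 0 <= v x) ->
  {within `[a, b], continuous u} -> u a <= u b.
Proof.
move=> ab uv v0 cu; have [->//|a_b] := eqVneq a b.
have ab' : a < b by rewrite lt_neqAle a_b.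
have uv' x : x \in `]a, b[ -> is_derive x 1 u (v x) by rewrite in_itv/=; exact: uv.
have [c] := MVT ab' uv' cu.
rewrite in_itv/= => cab E; rewrite -subr_ge0 E mulr_ge0//; first exact: v0.
by rewrite subr_ge0.
Qed.

(** Complex curves satisfy no mean value equality. The increment is rotated onto the real axis, and
    [Phi] minus the real part of the rotated curve is nondecreasing. *)
Lemma vder_increment_le f f' (Phi phi : R -> R) (a b : R) : a <= b ->
  (forall x, a <= x <= b -> vder f x (f' x)) ->
  (forall x, a <= x <= b -> is_derive x 1 Phi (phi x)) ->
  (forall x, a <= x <= b -> normc (f' x) <= phi x) ->
  normc (f b - f a) <= Phi b - Phi a.
Proof.
move=> ab ff' Phi' f'phi; set v := f b - f a.
have [v0|v0] := eqVneq v 0.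
  rewrite v0 normc0 subr_ge0; apply: (is_derive_nondecreasing (v := phi)) => //.
  - by move=> x /andP[/ltW ax /ltW xb]; apply: Phi'; rewrite ax.
  - move=> x /andP[/ltW ax /ltW xb]; apply: le_trans (f'phi x _); rewrite ?normc_ge0//.
    by rewrite ax.
  - exact: is_derive_within Phi'.
(* Unit factor with [u * v] equal to [normc v]. *)
pose u := v^* / (normc v)%:C.
have u1 : normc u = 1.
  by rewrite normcM normcV normc_conj normc_real ger0_norm ?normc_ge0// divff ?normc_eq0.
have uv : u * v = (normc v)%:C.
  have n0 : (normc v)%:C != 0 by rewrite -normc_eq0 normc_real normr_eq0 normc_eq0.
  have E : v * v^* = (normc v)%:C ^+ 2 by rewrite -sqr_normc.
  by rewrite /u (_ : _ * v = v * v^* / (normc v)%:C); [rewrite E expr2 mulfK|ring].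
have der x : a <= x <= b -> is_derive x 1 (fun s => Phi s - Re (u * f s)) (phi x - Re (u * f' x)).
  move=> xab; apply: is_deriveB; first exact: Phi'.
  exact/vder_Re/vderZ/ff'.
suff : Phi a - Re (u * f a) <= Phi b - Re (u * f b).
  have : normc v = Re (u * f b) - Re (u * f a).
    by rewrite -Re_opp -Re_add -mulrBr uv.
  lra.
apply: (is_derive_nondecreasing (u := fun s => Phi s - Re (u * f s))
   (v := fun x => phi x - Re (u * f' x))) => //.
- by move=> x /andP[/ltW ax /ltW xb]; apply: der; rewrite ax.
- move=> x /andP[/ltW ax /ltW xb]; rewrite subr_ge0.
  have xab : a <= x <= b by rewrite ax.
  apply: le_trans (f'phi x xab); apply: le_trans (ler_norm _) _.
  by rewrite (le_trans (normc_Re_le _))// normcM u1 mul1r.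
- exact: is_derive_within der.
Qed.

Lemma is_derive_mull (k : R) (u : R -> R) (x l : R) :
  is_derive x 1 u l -> is_derive x 1 (fun t => k * u t) (k * l).
Proof. by move=> ul; exact: (@is_deriveZ R R R u k x 1 l ul). Qed.

Lemma is_derive_linear (M x : R) : is_derive x 1 (fun t : R => M * t) M.
Proof.
have E : is_derive x 1 (fun t : R => M *: t) (M *: 1) by exact: is_deriveZ.
by move: E; rewrite /GRing.scale/= mulr1.
Qed.

Lemma vder_increment_le_cst f f' (M a b : R) : a <= b ->
  (forall x, a <= x <= b -> vder f x (f' x)) ->
  (forall x, a <= x <= b -> normc (f' x) <= M) ->
  normc (f b - f a) <= M * (b - a).
Proof.
move=> ab ff' f'M; rewrite mulrBr.
apply: (vder_increment_le (f' := f') (Phi := fun x => M * x) (phi := fun=> M)) => // x _.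
exact: is_derive_linear.
Qed.

(** Compactness: local radii give one radius for the whole segment, as soon as the property survives
    shrinking the radius. *)
Lemma segment_uniform (a b : R) (P : R -> R -> Prop) :
  (forall t d d', 0 < d' <= d -> P d t -> P d' t) ->
  (forall t, a <= t <= b -> exists2 d, 0 < d &
     forall t', a <= t' <= b -> `|t' - t| < d -> P d t') ->
  exists2 d, 0 < d & forall t, a <= t <= b -> P d t.
Proof.
move=> Pmono Ploc.
have /compact_near_coveringP cov := @segment_compact R a b.
have [] := cov R (nbhs 0^'+) (fun d t => a <= t <= b -> P d t) _.
  move=> t; rewrite /= in_itv/= => tab; have [d d0 Pd] := Ploc t tab.
  exists ([set t' | `|t' - t| < d], [set d' | 0 < d' < d]) => /=.
    split; first by apply/near_realP; exists d.
    apply/near_realP; exists d => // s; rewrite subr0 => sd s0.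
    by apply/andP; split => //; exact: le_lt_trans (ler_norm _) sd.
  move=> [t' d']/= [t'd /andP[d'0 d'd]] t'ab; apply: (Pmono _ d); rewrite ?d'0 ?ltW//.
  exact: Pd.
move=> d d0 Hd; have d2 : 0 < d / 2 by rewrite divr_gt0.
exists (d / 2) => // t tab; apply: Hd => //=.
by rewrite distrC subr0 gtr0_norm// ltr_pdivrMr// ltr_pMr// ltr1n.
Qed.

Definition vcont (phi : R -> R[i]) (t : R) := forall e, 0 < e -> exists2 d, 0 < d &
  forall s, `|s - t| < d -> normc (phi s - phi t) < e.

(** The point [w] is not confined to the curve. Hence the radius of a circle or the height of a line
    may vary under an integral with uniform control. *)
Lemma curve_uniform_cont (H : R[i] -> R[i]) (phi : R -> R[i]) (a b : R) :
  (forall t, a <= t <= b -> vcont phi t) ->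
  (forall t, a <= t <= b -> clim setT H (phi t) (H (phi t))) ->
  forall e, 0 < e -> exists2 d, 0 < d & forall t, a <= t <= b ->
    forall w, normc (w - phi t) < d -> normc (H w - H (phi t)) < e.
Proof.
move=> cphi cH e e0.
apply: (segment_uniform (P := fun d t => forall w, normc (w - phi t) < d -> normc (H w - H (phi t)) < e)).
  by move=> t d d' /andP[_ d'd] Pd w wd; apply: Pd; exact: lt_le_trans d'd.
move=> t tab; have e20 : 0 < e / 2 by rewrite divr_gt0.
have [r r0 Hr] := cH t tab _ e20; have r20 : 0 < r / 2 by rewrite divr_gt0.
have [d d0 Hd] := cphi t tab _ r20.
exists (Num.min d (r / 2)) => [|t' t'ab]; first by rewrite lt_min d0.
rewrite lt_min => /andP[t'd _] w; rewrite lt_min => /andP[_ wr].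
have A : normc (phi t' - phi t) < r / 2 by exact: Hd.
have B : normc (w - phi t) < r.
  by rewrite (le_lt_trans (normc_dist_triangle _ (phi t') _))// (splitr r) ltrD.
rewrite (le_lt_trans (normc_dist_triangle _ (H (phi t)) _))// (splitr e) ltrD//.
  exact: Hr.
rewrite normc_distC; apply: Hr => //; rewrite (lt_trans A)//.
by rewrite ltr_pdivrMr// ltr_pMr// ltr1n.
Qed.

Lemma vder_vcont f x l : vder f x l -> vcont f x.
Proof.
move=> fl e e0; have [d d0 H1] := fl 1 ltr01; pose K := 1 + normc l.
have K0 : 0 < K by rewrite ltr_pwDl// normc_ge0.
exists (Num.min d (e / K)) => [|s]; first by rewrite lt_min d0 divr_gt0.
rewrite lt_min => /andP[wd we]; have := H1 _ wd; rewrite (addrC x) subrK mul1r => H2.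
rewrite (_ : f s - f x = (f s - f x - l * (s - x)%:C) + l * (s - x)%:C); last by rewrite subrK.
rewrite (le_lt_trans (normcD_le _ _))//.
rewrite (le_lt_trans (lerD H2 (lexx _)))// normcM normc_real -{1}[`|s - x|]mul1r -mulrDl.
by rewrite mulrC -ltr_pdivlMr.
Qed.

Lemma clim_vcont H phi t : clim setT H (phi t) (H (phi t)) -> vcont phi t -> vcont (H \o phi) t.
Proof.
move=> cH cphi e e0; have [r r0 Hr] := cH e e0; have [d d0 Hd] := cphi r r0.
by exists d => // s sd; apply: Hr => //; exact: Hd.
Qed.

Lemma vcontB f g t : vcont f t -> vcont g t -> vcont (fun s => f s - g s) t.
Proof.
move=> cf cg e e0; have e20 : 0 < e / 2 by rewrite divr_gt0.
have [d d0 Hd] := cf _ e20; have [d' d'0 Hd'] := cg _ e20.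
exists (Num.min d d') => [|s]; first by rewrite lt_min d0.
rewrite lt_min => /andP[/Hd A /Hd' B]; rewrite (splitr e).
rewrite (le_lt_trans _ (ltrD A B))// (le_trans _ (normcB_le _ _))//.
by rewrite le_eqVlt; apply/orP; left; apply/eqP; congr normc; ring.
Qed.

Lemma vcontZ (c : R[i]) f t : vcont f t -> vcont (fun s => c * f s) t.
Proof.
move=> cf e e0; have K0 : 0 < normc c + 1 by rewrite ltr_pwDr// normc_ge0.
have [d d0 Hd] := cf _ (divr_gt0 e0 K0).
exists d => // s /Hd; rewrite -mulrBr normcM ltr_pdivlMr//; apply: le_lt_trans.
by rewrite mulrC ler_wpM2l ?normc_ge0// lerDl.
Qed.

Lemma vcontD f g t : vcont f t -> vcont g t -> vcont (fun s => f s + g s) t.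
Proof.
move=> cf cg; have := vcontB cf (vcontZ (- 1) cg).
by under eq_fun do rewrite mulN1r opprK.
Qed.

Lemma vcont_conj f t : vcont f t -> vcont (fun s => (f s)^*) t.
Proof.
by move=> cf e e0; have [d d0 Hd] := cf e e0; exists d => // s /Hd; rewrite -rmorphB /= normc_conj.
Qed.

Lemma vcontM f g t : vcont f t -> vcont g t -> vcont (fun s => f s * g s) t.
Proof.
move=> cf cg e e0.
pose K := normc (f t) + 1; pose K' := normc (g t) + 1.
have K0 : 0 < K by rewrite ltr_pwDr// normc_ge0.
have K'0 : 0 < K' by rewrite ltr_pwDr// normc_ge0.
have e1 : 0 < e / (2 * K) by rewrite divr_gt0// mulr_gt0.
have e2 : 0 < Num.min 1 (e / (2 * K')) by rewrite lt_min ltr01 divr_gt0// mulr_gt0.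
have [d d0 Hd] := cf _ e2; have [d' d'0 Hd'] := cg _ e1.
exists (Num.min d d') => [|s]; first by rewrite lt_min d0.
rewrite lt_min => /andP[/Hd + /Hd' B]; rewrite lt_min => /andP[A1 A2'].
have fK : normc (f s) <= K.
  rewrite (_ : f s = f t + (f s - f t)); last by ring.
  by rewrite (le_trans (normcD_le _ _))// lerD2l ltW.
rewrite (_ : _ - _ = f s * (g s - g t) + (f s - f t) * g t); last by ring.
rewrite (le_lt_trans (normcD_le _ _))// !normcM (splitr e).
apply: ltr_leD.
  rewrite (@le_lt_trans _ _ (K * normc (g s - g t)))// ?ler_wpM2r ?normc_ge0//.
  by rewrite mulrC -ltr_pdivlMr// -mulrA -invfM.
rewrite (@le_trans _ _ (normc (f s - f t) * K'))// ?ler_wpM2l ?normc_ge0// ?lerDl//.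
by rewrite -ler_pdivlMr// -mulrA -invfM ltW.
Qed.

Lemma vcont_Re f t : vcont f t -> {for t, continuous (fun s => Re (f s))}.
Proof.
move=> cf; apply/cvgrPdist_lt => e e0; have [d d0 Hd] := cf e e0.
apply/near_realP; exists d => // s sd.
by rewrite distrC -Re_opp -Re_add (le_lt_trans (normc_Re_le _))// Hd.
Qed.

Lemma vcont_Im f t : vcont f t -> {for t, continuous (fun s => Im (f s))}.
Proof.
move=> cf; apply/cvgrPdist_lt => e e0; have [d d0 Hd] := cf e e0.
apply/near_realP; exists d => // s sd.
by rewrite distrC -Im_opp -Im_add (le_lt_trans (normc_Im_le _))// Hd.
Qed.

End CurveCalculus.

(** * Integrals over segments *)

Section SegmentIntegral.
Context {R : realType}.
Implicit Types (f g u : R -> R) (a b c : R).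

(** Unoriented: the value is 0 when [b < a]. *)
Definition segint a b f : R := \int[lebesgue_measure]_(x in `[a, b]) f x.

Lemma segint_integrable a b f : continuous f ->
  lebesgue_measure.-integrable `[a, b] (EFin \o f).
Proof.
move=> cf; apply: continuous_compact_integrable; first exact: segment_compact.
exact: continuous_subspaceT.
Qed.

Lemma eq_segint a b f g : (forall x, a <= x <= b -> f x = g x) -> segint a b f = segint a b g.
Proof. by move=> fg; apply: eq_Rintegral => x; rewrite inE/= in_itv/=; exact: fg. Qed.

Lemma segintD a b f g : continuous f -> continuous g ->
  segint a b (fun x => f x + g x) = segint a b f + segint a b g.
Proof. by move=> cf cg; rewrite /segint RintegralD//; exact: segint_integrable. Qed.

Lemma segintB a b f g : continuous f -> continuous g ->
  segint a b (fun x => f x - g x) = segint a b f - segint a b g.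
Proof. by move=> cf cg; rewrite /segint RintegralB//; exact: segint_integrable. Qed.

Lemma segintZ a b k f : continuous f -> segint a b (fun x => k * f x) = k * segint a b f.
Proof. by move=> cf; rewrite /segint RintegralZl//; exact: segint_integrable. Qed.

Lemma segint_cst a b k : a <= b -> segint a b (fun=> k) = k * (b - a).
Proof.
move=> ab; rewrite /segint Rintegral_cst//= lebesgue_measure_itv/= lte_fin.
case: ltP => [_|ba]; first by rewrite -EFinB.
by rewrite (_ : a = b) ?subrr//; apply/eqP; rewrite eq_le ab.
Qed.

Lemma segint_le a b f g : continuous f -> continuous g ->
  (forall x, a <= x <= b -> f x <= g x) -> segint a b f <= segint a b g.
Proof.
move=> cf cg fg; by apply: le_Rintegral => //; exact: segint_integrable.
Qed.

Lemma segint_ge0 a b f : (forall x, a <= x <= b -> 0 <= f x) -> 0 <= segint a b f.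
Proof. by move=> f0; apply: Rintegral_ge0 => x; rewrite /= in_itv/=; exact: f0. Qed.

Lemma segint_norm a b f M : a <= b -> continuous f ->
  (forall x, a <= x <= b -> `|f x| <= M) -> `|segint a b f| <= M * (b - a).
Proof.
move=> ab cf fM; have cM k : continuous (fun _ : R => k : R) by exact: cst_continuous.
rewrite ler_norml -mulNr -!segint_cst//; apply/andP; split; (apply: segint_le; [by []|by []|move=> x xab]);
  by have := fM x xab; rewrite ler_norml => /andP[].
Qed.

Lemma segint_FTC a b (F f : R -> R) : a <= b -> continuous f ->
  (forall x, a <= x <= b -> is_derive x 1 F (f x)) -> segint a b f = F b - F a.
Proof.
rewrite le_eqVlt => /predU1P[-> cf _|ab cf FF'].
  by rewrite /segint set_itv1 Rintegral_set1 subrr.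
have E : (\int[lebesgue_measure]_(x in `[a, b]) (f x)%:E = (F b)%:E - (F a)%:E)%E.
  apply: continuous_FTC2 => //; first exact: continuous_subspaceT.
  - split.
    + by move=> x /itvP xab; have := FF' x; rewrite !xab => /(_ isT) ?; exact: ex_derive.
    + apply: cvg_at_right_filter; have := FF' a; rewrite lexx ltW// => /(_ isT) Fa.
      exact: is_derive_cts Fa.
    + apply: cvg_at_left_filter; have := FF' b; rewrite lexx ltW// => /(_ isT) Fb.
      exact: is_derive_cts Fb.
  - move=> x /itvP xab; have := FF' x; rewrite !xab => /(_ isT) ?.
    by rewrite derive1E derive_val.
by rewrite /segint /Rintegral E.
Qed.

(** The base point [c] is meant to lie to the left of the segment of interest, so that the
    derivative at the left end is two-sided. *)
Lemma continuous_primitive f c : continuous f ->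
  exists F : R -> R, forall x, c < x -> is_derive x 1 F (f x).
Proof.
move=> cf; exists (fun x => segint c x f) => x cx.
have xx : x < x + 1 by rewrite ltrDl.
have [D1 D2] := continuous_FTC1_closed xx (@segint_integrable c (x + 1) f cf) cx (cf x).
by apply: DeriveDef; [exact: D1|rewrite -derive1E; exact: D2].
Qed.

Lemma segint_subset a b c (d : R) f : c <= a -> b <= d -> continuous f ->
  (forall x, c <= x <= d -> 0 <= f x) -> segint a b f <= segint c d f.
Proof.
move=> ca bd cf f0; rewrite /segint /Rintegral fine_le//.
- exact/integrable_fin_num/segint_integrable.
- exact/integrable_fin_num/segint_integrable.
apply: ge0_subset_integral => //.
- apply/measurable_EFinP/measurable_funTS; exact: continuous_measurable_fun.
by move=> x; rewrite /= !in_itv/= => /andP[ax xb]; rewrite (le_trans ca)//= (le_trans xb).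
Qed.

Lemma segint_derive (u du : R -> R -> R) a b (s0 r M : R) : 0 < r ->
  (forall s, `|s - s0| < r -> continuous (u s)) ->
  (forall s x, `|s - s0| < r -> a <= x <= b -> is_derive s 1 (u^~ x) (du s x)) ->
  (forall s x, `|s - s0| < r -> a <= x <= b -> `|du s x| <= M) ->
  is_derive s0 1 (fun s => segint a b (u s)) (segint a b (du s0)).
Proof.
move=> r0 cu udu duM.
have I s : [set` `]s0 - r, s0 + r[] s -> `|s - s0| < r.
  by rewrite /= in_itv/= ltr_distl.
have I0 : [set` `]s0 - r, s0 + r[] s0 by rewrite /= in_itv/= ltrBlDr ltrDl r0.
have H1 s : [set` `]s0 - r, s0 + r[] s -> lebesgue_measure.-integrable `[a, b] (EFin \o u s).
  by move=> /I /cu; exact: segint_integrable.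
have H2 s x : [set` `]s0 - r, s0 + r[] s -> [set` `[a, b]] x -> derivable (u^~ x) s 1.
  by move=> /I ss; rewrite /= in_itv/= => xab; have ? := udu s x ss xab; exact: ex_derive.
(* The maximum with 0 gives a nonnegative dominating constant even when the segment is empty and [M]
   is negative. *)
have H4 s x : [set` `]s0 - r, s0 + r[] s -> [set` `[a, b]] x ->
    `|partial1of2 u s x| <= Num.max M 0.
  move=> /I ss; rewrite /= in_itv/= => xab; have ? := udu s x ss xab.
  by rewrite partial1of2E derive_val le_max duM.
have H3 : lebesgue_measure.-integrable `[a, b] (EFin \o (fun _ : R => Num.max M 0)).
  by apply: segint_integrable; exact: cst_continuous.
have M0 (y : R) : 0 <= Num.max M 0 by rewrite le_max lexx orbT.
have mI : measurable ([set` `[a, b]] : set (measurableTypeR R)) by exact: measurable_itv.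
apply: DeriveDef; first exact: (derivable_under_integral mI I0 H1 H2 M0 H3 H4).
rewrite -derive1E (differentiation_under_integral mI I0 H1 H2 M0 H3 H4).
apply: eq_Rintegral => x; rewrite inE/= in_itv/= => xab.
have ss : `|s0 - s0| < r by rewrite subrr normr0.
by have ? := udu s0 x ss xab; rewrite partial1of2E derive_val.
Qed.

End SegmentIntegral.

(** * Holomorphic functions in the half plane *)

Section CircleFormula.
Context {R : realType}.
Implicit Types (z w l : R[i]) (H D Q : R[i] -> R[i]).

Lemma normc_expi (t : R) : normc (expi t) = 1.
Proof. by rewrite /expi /= cos2Dsin2 sqrtr1. Qed.

Lemma expi_neq0 (t : R) : expi t != 0.
Proof. by rewrite -normc_eq0 normc_expi oner_neq0. Qed.

Lemma vder_expi (t : R) : vder expi t ('i * expi t).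
Proof.
apply/vder_is_derive; rewrite /expi; split => /=.
  have -> : 0 * cos t - 1 * sin t = - sin t by ring.
  exact: is_derive_cos.
have -> : 0 * sin t + 1 * cos t = cos t by ring.
exact: is_derive_sin.
Qed.

Lemma vder_circle (z : R[i]) (r t : R) :
  vder (fun t => z + r%:C * expi t) t (r%:C * ('i * expi t)).
Proof.
have V := cder_vder (H := fun w => z + r%:C * w) (l := 0 + (0 * expi t + r%:C * 1)) _ (vder_expi t).
apply: (vder_eq _ _ (V _)) => //; first by ring.
apply: cderD; first exact: cder_cst.
by apply: cderM; [exact: cder_cst|exact: cder_id].
Qed.

Lemma vcont_circle (z : R[i]) (r t : R) : vcont (fun t => z + r%:C * expi t) t.
Proof. exact: vder_vcont (vder_circle _ _ _). Qed.

(** The derivative in [r] is the integral of [Re (Q' e^(it))], which is [1 / r] times the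
    [t]-derivative of [Im Q] along the circle and integrates to 0 over a period. [Q] may be singular
    at [z]. *)
Lemma circle_average_constant z (rho : R) Q Q' :
  (forall w, 0 < normc (w - z) < rho -> cder Q w (Q' w)) ->
  (forall w, 0 < normc (w - z) < rho -> clim setT Q' w (Q' w)) ->
  forall r, 0 < r < rho ->
  is_derive r 1 (fun r => segint 0 (2 * pi) (fun t => Re (Q (z + r%:C * expi t)))) 0.
Proof.
move=> QQ' cQ' r0 /andP[r00 r0rho].
have on r t : 0 < r < rho -> 0 < normc (z + r%:C * expi t - z) < rho.
  by move=> /andP[? ?]; rewrite (addrC z) addrK normcM normc_real normc_expi mulr1 gtr0_norm// ; apply/andP.
have pi2 : 0 <= 2 * pi :> R by rewrite mulr_ge0// pi_ge0.
have r0r : 0 < r0 < rho by rewrite r00.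
have [d d0 Hd] := curve_uniform_cont (a := 0) (b := 2 * pi)
  (fun t _ => vcont_circle z r0 t) (fun t _ => cQ' _ (on r0 t r0r)) ltr01.
have cc r : 0 < r < rho -> continuous (fun t => Re (Q' (z + r%:C * expi t) * expi t)).
  move=> rr t; apply: vcont_Re => /=.
  have K : clim setT (fun w => Q' w * ((w - z) / r%:C)) (z + r%:C * expi t)
      (Q' (z + r%:C * expi t) * ((z + r%:C * expi t - z) / r%:C)).
    apply: climM; first exact/cQ'/on.
    apply: climM; last exact: clim_cst.
    apply: climD; last exact: clim_cst.
    by have := cder_cont (cder_id (z + r%:C * expi t)).
  have r'0 : r%:C != 0 :> R[i].
    by rewrite -normc_eq0 normc_real normr_eq0 gt_eqF//; case/andP: rr.
  have := clim_vcont K (vcont_circle z r t); rewrite /comp.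
  have -> // : (fun x => Q' (z + r%:C * expi x) * ((z + r%:C * expi x - z) / r%:C)) =
    (fun t => Q' (z + r%:C * expi t) * expi t).
  by apply/funext => x; rewrite (addrC z) addrK mulrAC divff// mul1r.
have [M HM] : exists M, forall t, 0 <= t <= 2 * pi -> `|Re (Q' (z + r0%:C * expi t) * expi t)| <= M.
  have cg : continuous (fun t => `|Re (Q' (z + r0%:C * expi t) * expi t)|).
    by move=> t; apply: continuous_comp; [exact: cc|exact: norm_continuous].
  have [c _ Hc] := EVT_max pi2 (continuous_subspaceT (A := [set` `[0, 2 * pi]]) cg).
  exists `|Re (Q' (z + r0%:C * expi c) * expi c)| => t tt.
  by apply: Hc; rewrite in_itv.
have E0 : segint 0 (2 * pi) (fun t => Re (Q' (z + r0%:C * expi t) * expi t)) = 0.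
  have Hd2 t : 0 <= t <= 2 * pi -> is_derive t 1 (fun t => r0^-1 * Im (Q (z + r0%:C * expi t)))
      (Re (Q' (z + r0%:C * expi t) * expi t)).
    move=> _; have V := cder_vder (QQ' _ (on r0 t r0r)) (vder_circle z r0 t).
    have -> : Re (Q' (z + r0%:C * expi t) * expi t) =
       r0^-1 * Im (Q' (z + r0%:C * expi t) * (r0%:C * ('i * expi t))).
      rewrite !Re_mul !Im_mul !Re_mul !Im_mul /= !mul0r !mul1r; field.
      by rewrite gt_eqF.
    exact: is_derive_mull (vder_Im V).
  by rewrite (segint_FTC pi2 (cc _ r0r) Hd2) /expi mulr_natl cos0 sin0 cos2pi sin2pi subrr.
(* Radii this close to [r0] stay inside the punctured disc and within the range where [Q'] differs
   by less than 1 from its values on the circle of radius [r0]. *)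
pose r1 := Num.min d (Num.min r0 (rho - r0)).
have r1r s : `|s - r0| < r1 -> (`|s - r0| < d) /\ (0 < s < rho).
  rewrite !lt_min => /and3P[-> + +]; rewrite !ltr_norml => /andP[A _] /andP[_ B].
  by split => //; apply/andP; split; lra.
apply: is_derive_eq E0; apply: (@segint_derive R (fun r t => Re (Q (z + r%:C * expi t))) (fun r t => Re (Q' (z + r%:C * expi t) * expi t)) _ _ r0 r1 (M + 1)).
- by rewrite !lt_min d0 r00 subr_gt0.
- move=> s /r1r[_ ss] t; apply: vcont_Re.
  exact: clim_vcont (cder_cont (QQ' _ (on s t ss))) (vcont_circle _ _ _).
- move=> s t /r1r[_ ss] _.
  have A : vder (fun s => z + expi t * s%:C) s (expi t) by exact: vder_affine.
  have E : z + expi t * s%:C = z + s%:C * expi t by rewrite mulrC.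
  have B : cder Q (z + expi t * s%:C) (Q' (z + s%:C * expi t)).
    by rewrite E; exact/QQ'/on.
  have := vder_Re (cder_vder B A); rewrite /comp.
  by have -> : (fun s => Re (Q (z + expi t * s%:C))) = (fun r => Re (Q (z + r%:C * expi t)))
    by apply/funext => x; rewrite mulrC.
- move=> s t /r1r[sd ss] tt.
  have K : normc (Q' (z + s%:C * expi t) - Q' (z + r0%:C * expi t)) < 1.
    apply: Hd => //.
    have -> : z + s%:C * expi t - (z + r0%:C * expi t) = (s - r0)%:C * expi t.
      by rewrite raddfB/=; ring.
    by rewrite normcM normc_real normc_expi mulr1.
  have -> : Re (Q' (z + s%:C * expi t) * expi t) = Re (Q' (z + r0%:C * expi t) * expi t) +
     Re ((Q' (z + s%:C * expi t) - Q' (z + r0%:C * expi t)) * expi t).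
    by rewrite -Re_add; congr Re; ring.
  rewrite (le_trans (ler_normD _ _))// lerD ?HM//.
  by rewrite (le_trans (normc_Re_le _))// normcM normc_expi mulr1 ltW.
Qed.

End CircleFormula.

(** * Cauchy's formula for the derivative, on circles *)

Section HolomorphicDerivative.
Context {R : realType}.
Implicit Types (z w l : R[i]) (H D Q : R[i] -> R[i]).

Lemma is_derive_increment_le (u v : R -> R) (M a b : R) : a <= b ->
  (forall x, a <= x <= b -> is_derive x 1 u (v x)) ->
  (forall x, a <= x <= b -> `|v x| <= M) -> `|u b - u a| <= M * (b - a).
Proof.
move=> ab uv vM.
have ff' x : a <= x <= b -> vder (fun s => (u s)%:C) x (v x)%:C.
  by move=> xab; apply/vder_is_derive; split; [exact: uv|exact: is_derive_cst].
have vM' x : a <= x <= b -> normc (v x)%:C <= M by move=> /vM; rewrite normc_real.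
by have := vder_increment_le_cst ab ff' vM'; rewrite -raddfB normc_real.
Qed.

(* The difference quotient is holomorphic off [z], so its mean over a circle does
   not depend on the radius, which may tend to 0. *)
Lemma circle_formula_Re H D z (rho : R) :
  (forall w, normc (w - z) < rho -> cder H w (D w)) ->
  (forall w, normc (w - z) < rho -> clim setT D w (D w)) ->
  forall r, 0 < r < rho ->
  segint 0 (2 * pi) (fun t => Re ((H (z + r%:C * expi t) - H z) / (r%:C * expi t)))
  = 2 * pi * Re (D z).
Proof.
move=> HD cD r /andP[r0 rrho].
have rho0 : 0 < rho by exact: lt_trans rrho.
pose Q w := (H w - H z) * (w - z)^-1.
pose Q' w := (D w + 0) * (w - z)^-1 + (H w - H z) * (- (1 + 0) / (w - z) ^+ 2).
have nz w : 0 < normc (w - z) -> w - z != 0 by rewrite normc_gt0.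
have QQ' w : 0 < normc (w - z) < rho -> cder Q w (Q' w).
  move=> /andP[w0 wrho]; apply: cderM.
    by apply: cderD; [exact: HD|exact: cder_cst].
  by apply: cderV; [exact: nz|apply: cderD; [exact: cder_id|exact: cder_cst]].
have idc w : clim setT (fun w => w - z) w (w - z).
  by apply: climD; [exact: cder_cont (cder_id w)|exact: clim_cst].
have cQ' w : 0 < normc (w - z) < rho -> clim setT Q' w (Q' w).
  move=> /andP[/nz w0 wrho]; apply: climD; apply: climM.
  - by apply: climD; [exact: cD|exact: clim_cst].
  - exact: climV.
  - by apply: climD; [exact: cder_cont (HD w wrho)|exact: clim_cst].
  - apply: climM; first exact: clim_cst.
    by rewrite !expr2; apply: climV; [rewrite mulf_neq0|apply: climM].
pose Phi r := segint 0 (2 * pi) (fun t => Re (Q (z + r%:C * expi t))).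
have on s t : 0 < s -> normc (z + s%:C * expi t - z) = s.
  by move=> s0; rewrite (addrC z) addrK normcM normc_real normc_expi mulr1 gtr0_norm.
have pi2 : 0 <= 2 * pi :> R by rewrite mulr_ge0// pi_ge0.
have pi0 : 0 < 2 * pi :> R by rewrite mulr_gt0// pi_gt0.
have Phic s : 0 < s <= r -> Phi s = Phi r.
  move=> /andP[s0 sr]; apply/eqP; rewrite eq_sym -subr_eq0 -normr_le0.
  have := @is_derive_increment_le Phi (fun=> 0) 0 s r sr; rewrite mul0r; apply => x.
    move=> /andP[sx xr]; apply: (circle_average_constant QQ' cQ').
    by rewrite (lt_le_trans s0)//= (le_lt_trans xr).
  by rewrite normr0.
have -> : segint 0 (2 * pi) (fun t => Re ((H (z + r%:C * expi t) - H z) / (r%:C * expi t))) = Phi r.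
  by apply: eq_segint => t _; rewrite /Q (addrC z) addrK.
apply/eqP; rewrite -subr_eq0 -normr_le0; apply/ler_addgt0Pr => e e0; rewrite add0r.
have e20 : 0 < e / (2 * pi) by rewrite divr_gt0.
have zz : normc (z - z) < rho by rewrite subrr normc0.
have [d d0 Hd] := HD z zz _ e20.
(* On the circle of radius [s] the quotient is within [e / (2 * pi)] of [D z], and the mean is the
   same as on the circle of radius [r]. *)
pose s := Num.min r (d / 2).
have s0 : 0 < s by rewrite lt_min r0 divr_gt0.
have sd : s < d.
  by rewrite (@le_lt_trans _ _ (d / 2)) ?ge_min ?lexx ?orbT// ltr_pdivrMr// ltr_pMr// ltr1n.
have sr : s <= r by rewrite ge_min lexx.
rewrite -(Phic s) ?s0// /Phi (mulrC _ (Re (D z))).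
have cst : continuous (fun _ : R => Re (D z)) by exact: cst_continuous.
have cq : continuous (fun t => Re (Q (z + s%:C * expi t))).
  move=> t; apply: vcont_Re.
  apply: clim_vcont (vcont_circle _ _ _); apply: (cder_cont (l := Q' (z + s%:C * expi t))).
  by apply: QQ'; rewrite on// s0 (le_lt_trans sr).
have -> : Re (D z) * (2 * pi) = segint 0 (2 * pi) (fun=> Re (D z)) by rewrite segint_cst// subr0.
rewrite -segintB//.
have -> : e = e / (2 * pi) * (2 * pi - 0) by rewrite subr0 divfK// gt_eqF.
apply: segint_norm => //.
  by move=> t; apply: continuousB; [exact: cq|exact: cst].
move=> t _; rewrite -Re_opp -Re_add (le_trans (normc_Re_le _))//.
have k0 : s%:C * expi t != 0.
  by rewrite mulf_neq0 ?expi_neq0// -normc_eq0 normc_real normr_eq0 gt_eqF.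
have nk : normc (s%:C * expi t) = s by rewrite normcM normc_real normc_expi mulr1 gtr0_norm.
have := Hd (s%:C * expi t); rewrite nk => /(_ sd).
set k := s%:C * expi t in k0 nk *.
have -> : Q (z + k) - D z = (H (z + k) - H z - D z * k) / k.
  by rewrite /Q (addrC z k) addrK; field.
by rewrite normcM normcV nk ler_pdivrMr.
Qed.

Definition csegint a b (f : R -> R[i]) : R[i] :=
  segint a b (fun t => Re (f t)) +i* segint a b (fun t => Im (f t)).

Lemma csegintB a b f g : (forall t, vcont f t) -> (forall t, vcont g t) ->
  csegint a b (fun t => f t - g t) = csegint a b f - csegint a b g.
Proof.
move=> cf cg; rewrite /csegint; simpc; congr Complex; rewrite -segintB.
- by apply: eq_segint => t _; rewrite Re_add Re_opp.
- by move=> t; exact: vcont_Re.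
- by move=> t; exact: vcont_Re.
- by apply: eq_segint => t _; rewrite Im_add Im_opp.
- by move=> t; exact: vcont_Im.
- by move=> t; exact: vcont_Im.
Qed.

Lemma csegintZ a b f c : (forall t, vcont f t) ->
  csegint a b (fun t => c * f t) = c * csegint a b f.
Proof.
move=> cf; have cR : continuous (fun t => Re (f t)) by move=> t; exact: vcont_Re.
have cI : continuous (fun t => Im (f t)) by move=> t; exact: vcont_Im.
have cR' k : continuous (fun t => k * Re (f t)).
  by move=> t; apply: continuousM; [exact: cst_continuous|exact: cR].
have cI' k : continuous (fun t => k * Im (f t)).
  by move=> t; apply: continuousM; [exact: cst_continuous|exact: cI].
case: c => c1 c2; rewrite /csegint; simpc; congr Complex.
  by rewrite -!segintZ// -segintB//; apply: eq_segint => t _; rewrite Re_mul.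
by rewrite -!segintZ// -segintD//; apply: eq_segint => t _; rewrite Im_mul.
Qed.

(** The factor 2 is the price of bounding the real and imaginary parts separately. *)
Lemma csegint_norm (a b : R) f M : a <= b -> (forall t, vcont f t) ->
  (forall t, a <= t <= b -> normc (f t) <= M) -> normc (csegint a b f) <= 2 * (M * (b - a)).
Proof.
move=> ab cf fM; rewrite (le_trans (normc_le_sum _))//= mulr_natl mulr2n lerD//.
- apply: segint_norm => // [t|t tab]; first exact: vcont_Re.
  by rewrite (le_trans (normc_Re_le _))// fM.
- apply: segint_norm => // [t|t tab]; first exact: vcont_Im.
  by rewrite (le_trans (normc_Im_le _))// fM.
Qed.

(** The imaginary part is the real formula applied to [- 'i * H]. Subtracting [H z], whose
    contribution vanishes over a period, keeps the quotient bounded near [z]. *)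
Lemma circle_formula H D z (rho : R) :
  (forall w, normc (w - z) < rho -> cder H w (D w)) ->
  (forall w, normc (w - z) < rho -> clim setT D w (D w)) ->
  forall r, 0 < r < rho ->
  csegint 0 (2 * pi) (fun t => (H (z + r%:C * expi t) - H z) / (r%:C * expi t))
  = (2 * pi)%:C * D z.
Proof.
move=> HD cD r rr.
have HD' w : normc (w - z) < rho -> cder (fun w => - 'i * H w) w (- 'i * D w).
  move=> wr; have -> : - 'i * D w = 0 * H w + - 'i * D w by ring.
  by apply: cderM; [exact: cder_cst|exact: HD].
have cD' w : normc (w - z) < rho -> clim setT (fun w => - 'i * D w) w (- 'i * D w).
  by move=> wr; apply: climM; [exact: clim_cst|exact: cD].
have E1 := circle_formula_Re HD cD rr; have E2 := circle_formula_Re HD' cD' rr.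
have ReNi (w : R[i]) : Re (- 'i * w) = Im w by rewrite Re_mul /= oppr0 mul0r sub0r mulN1r opprK.
rewrite /csegint E1; rewrite ReNi in E2.
have -> : segint 0 (2 * pi) (fun t => Im ((H (z + r%:C * expi t) - H z) / (r%:C * expi t))) =
   2 * pi * Im (D z).
  rewrite -E2; apply: eq_segint => t _; rewrite -ReNi; congr Re.
  by rewrite mulrA; congr (_ / _); ring.
by case: (D z) => u v; simpc.
Qed.

End HolomorphicDerivative.

(** * The derivative of a holomorphic function is holomorphic *)

Section HolomorphicRegularity.
Context {R : realType}.
Implicit Types (z w l : R[i]) (H D Q : R[i] -> R[i]).

Definition holo H D := forall z, Pminus z -> cder H z (D z).
Definition ccont D := forall z, Pminus z -> clim setT D z (D z).

Lemma Pminus_ball z w : normc (w - z) < - Im z -> Pminus w.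
Proof.
move=> wz; have := normc_Im_le (w - z); rewrite Im_add Im_opp /Pminus/= => A.
have := le_lt_trans (ler_norm _) (le_lt_trans A wz); lra.
Qed.

Lemma segment_linearization H D w k (e : R) :
  (forall s : R, 0 <= s <= 1 -> cder H (w + k * s%:C) (D (w + k * s%:C))) ->
  (forall s : R, 0 <= s <= 1 -> normc (D (w + k * s%:C) - D w) <= e) ->
  normc (H (w + k) - H w - D w * k) <= e * normc k.
Proof.
move=> HD De.
pose f (s : R) := H (w + k * s%:C) - D w * (k * s%:C).
have ff' s : 0 <= s <= 1 -> vder f s ((D (w + k * s%:C) - D w) * k).
  move=> s01.
  apply: (@vder_eq _ ((fun v => H v + (- D w * v + D w * w)) \o (fun s => w + k * s%:C)) _ _
    ((D (w + k * s%:C) + (0 * (w + k * s%:C) + - D w * 1 + 0)) * k)).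
  - by move=> t; rewrite /f /=; ring.
  - ring.
  apply: cder_vder; last exact: vder_affine.
  apply: cderD; first exact: HD.
  apply: cderD; last exact: cder_cst.
  by apply: cderM; [exact: cder_cst|exact: cder_id].
have := vder_increment_le_cst (M := e * normc k) ler01 ff'.
rewrite /f subr0 mulr1 !mulr1 !mulr0 addr0 subr0.
rewrite (_ : H (w + k) - D w * k - H w = H (w + k) - H w - D w * k); last by ring.
apply => s s01; rewrite normcM ler_wpM2r ?normc_ge0//; exact: De.
Qed.

(** Cauchy's formula written for [D]: the candidate for the second derivative of a primitive of
    [D]. *)
Definition circle_deriv D (r : R) z : R[i] :=
  ((2 * pi)%:C)^-1 * csegint 0 (2 * pi) (fun t => (D (z + r%:C * expi t) - D z) / (r%:C * expi t)).

Lemma vcont_circle_quotient D (r : R) z : 0 < r -> r < - Im z -> ccont D ->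
  forall t, vcont (fun t => (D (z + r%:C * expi t) - D z) / (r%:C * expi t)) t.
Proof.
move=> r0 rz cD t.
have n t' : normc (z + r%:C * expi t' - z) = r.
  by rewrite (addrC z) addrK normcM normc_real normc_expi mulr1 gtr0_norm.
have P : Pminus (z + r%:C * expi t) by apply: (Pminus_ball (z := z)); rewrite n.
have nz : z + r%:C * expi t - z != 0 by rewrite -normc_eq0 n gt_eqF.
have K : clim setT (fun w => (D w - D z) * (w - z)^-1) (z + r%:C * expi t)
    ((D (z + r%:C * expi t) - D z) * (z + r%:C * expi t - z)^-1).
  apply: climM; first by apply: climD; [exact: cD|exact: clim_cst].
  apply: climV nz _; apply: climD; last exact: clim_cst.
  exact: cder_cont (cder_id _).
have := clim_vcont K (vcont_circle z r t); rewrite /comp.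
have -> // : (fun x => (D (z + r%:C * expi x) - D z) * (z + r%:C * expi x - z)^-1) =
   (fun t => (D (z + r%:C * expi t) - D z) / (r%:C * expi t)).
by apply/funext => x; rewrite {2}(addrC z) addrK.
Qed.

Lemma two_pi_gt0 : 0 < 2 * pi :> R.
Proof. by rewrite mulr_gt0// pi_gt0. Qed.

Lemma circle_mean_norm (f : R -> R[i]) (M : R) : (forall t, vcont f t) ->
  (forall t, 0 <= t <= 2 * pi -> normc (f t) <= M) ->
  normc (((2 * pi)%:C)^-1 * csegint 0 (2 * pi) f) <= 2 * M.
Proof.
move=> cf fM; rewrite normcM normcV normc_real gtr0_norm ?two_pi_gt0//.
rewrite ler_pdivrMl ?two_pi_gt0//.
apply: le_trans (csegint_norm (ltW two_pi_gt0) cf fM) _.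
by rewrite subr0; lra.
Qed.

(** [D] is itself a circle mean of increments of [H]. The increment of [D] is thus a mean of
    increments of [H] over segments of direction [k], each of which is linear in [k] up to a small
    multiple of [normc k]. *)
Lemma circle_derivP H D (r : R) z : holo H D -> ccont D -> 0 < r -> r < - Im z ->
  cder D z (circle_deriv D r z).
Proof.
move=> HD cD r0 rz e e0.
have n z' t' : normc (z' + r%:C * expi t' - z') = r.
  by rewrite (addrC z') addrK normcM normc_real normc_expi mulr1 gtr0_norm.
(* Two linearization errors, divided by the radius and doubled by [circle_mean_norm], add up to
   [4 * e' / r = e]. *)
pose e' := e * r / 4; have e'0 : 0 < e' by rewrite !mulr_gt0.
have P t : Pminus (z + r%:C * expi t) by apply: (Pminus_ball (z := z)); rewrite n.
have Pz : Pminus z by apply: (Pminus_ball (z := z)); rewrite subrr normc0 (lt_trans r0).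
have [d1 d10 H1] := curve_uniform_cont (a := 0) (b := 2 * pi)
  (fun t _ => vcont_circle z r t) (fun t _ => cD _ (P t)) e'0.
have [d2 d20 H2] := cD z Pz e' e'0.
(* Half of the room below the real axis: the circle shifted by [k] stays in P_- and Cauchy's formula
   remains valid at [z + k]. *)
pose eta := (- Im z - r) / 2; have eta0 : 0 < eta by rewrite divr_gt0// subr_gt0.
exists (Num.min eta (Num.min d1 d2)) => [|k]; first by rewrite !lt_min eta0 d10.
rewrite !lt_min => /and3P[keta kd1 kd2].
have nks (s : R) : 0 <= s <= 1 -> normc (k * s%:C) <= normc k.
  by move=> /andP[s0 s1]; rewrite normcM normc_real ger0_norm// ler_piMr// normc_ge0.
have Ball : forall w (s : R), 0 <= s <= 1 -> normc (w - z) <= r -> Pminus (w + k * s%:C).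
  move=> w s s01 wr; apply: (Pminus_ball (z := z)).
  rewrite (_ : w + _ - z = (w - z) + k * s%:C); last by ring.
  rewrite (le_lt_trans (normcD_le _ _))// (le_lt_trans (lerD wr (nks s s01)))//.
  by move: keta; rewrite /eta; lra.
have E1 t : 0 <= t <= 2 * pi ->
    normc (H (z + r%:C * expi t + k) - H (z + r%:C * expi t) - D (z + r%:C * expi t) * k) <= e' * normc k.
  move=> tt; apply: segment_linearization => s s01; first by apply/HD/Ball; rewrite ?n.
  apply/ltW/H1 => //; rewrite addrC addKr; exact: le_lt_trans (nks s s01) kd1.
have E2 : normc (H (z + k) - H z - D z * k) <= e' * normc k.
  apply: segment_linearization => s s01; first by apply/HD/Ball => //; rewrite subrr normc0 ltW.
  apply/ltW/H2 => //; rewrite addrC addKr; exact: le_lt_trans (nks s s01) kd2.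
have Pk : Pminus (z + k).
  by have := Ball z 1; rewrite mulr1; apply; rewrite ?ler01 ?lexx// subrr normc0 ltW.
have rzk : r < - Im (z + k).
  rewrite Im_add; have := le_lt_trans (ler_norm _) (le_lt_trans (normc_Im_le k) keta).
  rewrite /eta; lra.
have formula z' : r < - Im z' -> D z' = ((2 * pi)%:C)^-1 *
    csegint 0 (2 * pi) (fun t => (H (z' + r%:C * expi t) - H z') / (r%:C * expi t)).
  move=> rz'; rewrite (@circle_formula _ H D z' (- Im z')) ?r0//.
  - by rewrite mulKf// -normc_eq0 normc_real normr_eq0 gt_eqF// two_pi_gt0.
  - by move=> w /Pminus_ball; exact: HD.
  - by move=> w /Pminus_ball; exact: cD.
have cH : ccont H by move=> w Pw; exact: cder_cont (HD w Pw).
have c1 := vcont_circle_quotient r0 rzk cH.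
have c2 := vcont_circle_quotient r0 rz cH.
have c3 := vcont_circle_quotient r0 rz cD.
have c3' t := vcontZ k (c3 t); have c12 t := vcontB (c1 t) (c2 t).
rewrite (formula z rz) (formula (z + k) rzk) /circle_deriv.
rewrite -mulrBr -csegintB// (mulrAC _ (csegint _ _ _) k) -(mulrA _ k) -(csegintZ _ _ k)//.
rewrite -mulrBr -csegintB//.
have -> : e * normc k = 2 * (2 * (e' * normc k) / r) by rewrite /e'; field; rewrite gt_eqF.
have k0 t : r%:C * expi t != 0.
  by rewrite mulf_neq0 ?expi_neq0// -normc_eq0 normc_real normr_eq0 gt_eqF.
apply: circle_mean_norm.
  by move=> t; exact: vcontB.
move=> t tt.
have -> : (H (z + k + r%:C * expi t) - H (z + k)) / (r%:C * expi t) -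
   (H (z + r%:C * expi t) - H z) / (r%:C * expi t) -
   k * ((D (z + r%:C * expi t) - D z) / (r%:C * expi t)) =
   ((H (z + r%:C * expi t + k) - H (z + r%:C * expi t) - D (z + r%:C * expi t) * k) -
   (H (z + k) - H z - D z * k)) / (r%:C * expi t).
  by rewrite (addrAC z k); ring.
rewrite normcM normcV normcM normc_real normc_expi mulr1 (gtr0_norm r0).
rewrite ler_pM2r ?invr_gt0// (le_trans (normcB_le _ _))// (le_trans (lerD (E1 t tt) E2))//.
by lra.
Qed.

Lemma holo_derivative H D : holo H D -> ccont D ->
  exists D2, holo D D2 /\ ccont D2.
Proof.
move=> HD cD; exists (fun z => circle_deriv D (- Im z / 2) z).
have half z : Pminus z -> 0 < - Im z / 2 /\ - Im z / 2 < - Im z.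
  by rewrite /Pminus/= => z0; split; lra.
split=> [z Pz|z Pz e e0].
  by have [? ?] := half z Pz; exact: circle_derivP HD cD _ _.
have [r0 rz] := half z Pz.
have [r rE] : exists r : R, r = - Im z / 2 by exists (- Im z / 2).
rewrite -rE in r0 rz *.
have n z' t' : normc (z' + r%:C * expi t' - z') = r.
  by rewrite (addrC z') addrK normcM normc_real normc_expi mulr1 gtr0_norm.
pose e' := e * r / 8; have e'0 : 0 < e' by rewrite divr_gt0 ?mulr_gt0.
have P t : Pminus (z + r%:C * expi t) by apply: (Pminus_ball (z := z)); rewrite n.
have [d1 d10 H1] := curve_uniform_cont (a := 0) (b := 2 * pi)
  (fun t _ => vcont_circle z r t) (fun t _ => cD _ (P t)) e'0.
have [d2 d20 H2] := cD z Pz e' e'0.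
exists (Num.min r (Num.min d1 d2)) => [|w]; first by rewrite !lt_min r0 d10.
rewrite !lt_min => /and3P[wr wd1 wd2] _.
have rw : r < - Im w.
  have := le_lt_trans (ler_norm _) (le_lt_trans (normc_Im_le (w - z)) wr).
  by rewrite Im_add Im_opp; lra.
have Pw : Pminus w by rewrite /Pminus/=; lra.
have [rw0 rww] := half w Pw.
(* The radius in the definition depends on the point. Uniqueness of the derivative replaces it at
   both points by the fixed [r], and circles of equal radius can be compared. *)
rewrite (cder_unique (circle_derivP HD cD rw0 rww) (circle_derivP HD cD r0 rw)).
have c1 := vcont_circle_quotient r0 rw cD.
have c2 := vcont_circle_quotient r0 rz cD.
rewrite /circle_deriv -mulrBr -csegintB//.
apply: (@le_lt_trans _ _ (2 * (2 * e' / r))); last first.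
  have -> : 2 * (2 * e' / r) = e / 2 by rewrite /e'; field; rewrite gt_eqF.
  by rewrite ltr_pdivrMr// ltr_pMr// ltr1n.
apply: circle_mean_norm.
  by move=> t; exact: vcontB.
move=> t tt.
have -> : (D (w + r%:C * expi t) - D w) / (r%:C * expi t) -
   (D (z + r%:C * expi t) - D z) / (r%:C * expi t) =
   ((D (w + r%:C * expi t) - D (z + r%:C * expi t)) - (D w - D z)) / (r%:C * expi t).
  by ring.
rewrite normcM normcV normcM normc_real normc_expi mulr1 (gtr0_norm r0).
rewrite ler_pM2r ?invr_gt0// (le_trans (normcB_le _ _))//.
have A : normc (D (w + r%:C * expi t) - D (z + r%:C * expi t)) < e'.
  by apply: H1 => //; rewrite (_ : _ - _ = w - z)//; ring.
have B := H2 w wd2 I.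
by lra.
Qed.

End HolomorphicRegularity.

(** * Restriction to horizontal lines *)

Section HorizontalLines.
Context {R : realType}.
Implicit Types (z w l : R[i]) (H D Q : R[i] -> R[i]).

Lemma vderM (f g : R -> R[i]) (x : R) (l m : R[i]) : vder f x l -> vder g x m ->
  vder (fun s => f s * g s) x (l * g x + f x * m).
Proof.
move=> /vder_is_derive[fR fI] /vder_is_derive[gR gI]; apply/vder_is_derive; split.
  have A := is_deriveB (is_deriveM fR gR) (is_deriveM fI gI).
  have -> : (fun s => Re (f s * g s)) = ((fun s => Re (f s)) * (fun s => Re (g s))
     - (fun s => Im (f s)) * (fun s => Im (g s))) by apply/funext => s; rewrite Re_mul.
  by apply: is_derive_eq; rewrite /GRing.scale/= Re_add !Re_mul; ring.
have A := is_deriveD (is_deriveM fR gI) (is_deriveM fI gR).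
have -> : (fun s => Im (f s * g s)) = ((fun s => Re (f s)) * (fun s => Im (g s))
   + (fun s => Im (f s)) * (fun s => Re (g s))) by apply/funext => s; rewrite Im_mul.
by apply: is_derive_eq; rewrite /GRing.scale/= Im_add !Im_mul; ring.
Qed.

Lemma vder_conj (f : R -> R[i]) (x : R) (l : R[i]) : vder f x l -> vder (fun s => (f s)^*) x l^*.
Proof.
move=> fl e e0; have [d d0 Hd] := fl e e0; exists d => // s /Hd.
rewrite -normc_conj; have -> // : (f (x + s) - f x - l * s%:C)^* = (f (x + s))^* - (f x)^* - l^* * s%:C.
by rewrite !rmorphB rmorphM; congr (_ - _ * _); exact: conjc_real.
Qed.

Lemma vderN (f : R -> R[i]) (x : R) (l : R[i]) : vder f x l -> vder (fun s => f (- s)) (- x) (- l).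
Proof.
move=> fl e e0; have [d d0 Hd] := fl e e0; exists d => // s sd.
have := Hd (- s); rewrite normrN => /(_ sd); rewrite opprD opprK raddfN/= mulrN.
by rewrite mulNr opprK.
Qed.

Lemma vder_shift (f : R -> R[i]) (c x : R) (l : R[i]) : vder f (c + x) l -> vder (fun s => f (c + s)) x l.
Proof. by move=> fl e e0; have [d d0 Hd] := fl e e0; exists d => // s /Hd; rewrite addrA. Qed.

Lemma vcont_horizontal (x y : R) : vcont (fun s : R => s +i* y) x.
Proof. exact: vder_vcont (cder_horizontal (H := id) (cder_id _)). Qed.

Lemma ccont_line H (x y : R) : ccont H -> y < 0 -> vcont (fun s => H (s +i* y)) x.
Proof. by move=> cH y0; apply: (clim_vcont _ (vcont_horizontal x y)); exact: cH. Qed.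

Lemma holo_ccont H D : holo H D -> ccont H.
Proof. by move=> HD z Pz; exact: cder_cont (HD z Pz). Qed.

Lemma vcont_normc (f : R -> R[i]) (t : R) : vcont f t -> {for t, continuous (fun s => normc (f s))}.
Proof.
move=> cf; apply/cvgrPdist_lt => e e0; have [d d0 Hd] := cf e e0.
apply/near_realP; exists d => // s /Hd; apply: le_lt_trans.
have := ler_normcB (f t) (f s); have := ler_normcB (f s) (f t); rewrite (normc_distC (f t)).
by rewrite ler_norml => A B; apply/andP; split; lra.
Qed.

Lemma ccont_sqr_line H (y : R) : ccont H -> y < 0 -> continuous (fun x => normc (H (x +i* y)) ^+ 2).
Proof.
move=> cH y0 x; rewrite (_ : (fun x => _) = (fun x => normc (H (x +i* y)) * normc (H (x +i* y)))).
  by apply: continuousM; exact/vcont_normc/ccont_line.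
by apply/funext => s; rewrite expr2.
Qed.

Lemma ccont_rectangle_bound H (y0 a b : R) : ccont H -> y0 < 0 -> a <= b ->
  exists2 d, 0 < d & exists M : R, forall y x, `|y - y0| < d -> a <= x <= b ->
    Pminus (x +i* y) /\ normc (H (x +i* y)) <= M.
Proof.
move=> cH y00 ab.
have [d d0 Hd] := curve_uniform_cont (a := a) (b := b)
  (fun t _ => vcont_horizontal t y0) (fun t _ => cH (t +i* y0) y00) ltr01.
have cg : continuous (fun x => normc (H (x +i* y0))).
  by move=> x; exact/vcont_normc/ccont_line.
have [c _ Hc] := EVT_max ab (continuous_subspaceT (A := [set` `[a, b]]) cg).
exists (Num.min d (- y0)); first by rewrite lt_min d0 oppr_gt0.
exists (normc (H (c +i* y0)) + 1) => y x; rewrite lt_min => /andP[yd yy0] xab.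
split; first by rewrite /Pminus/=; have := le_lt_trans (ler_norm _) yy0; lra.
have K : normc (H (x +i* y) - H (x +i* y0)) < 1.
  apply: Hd => //; rewrite (_ : _ - _ = 'i * (y - y0)%:C).
    by rewrite normcM normci mul1r normc_real.
  by rewrite (complex_split x y) (complex_split x y0) raddfB; ring.
have := Hc x; rewrite in_itv/= => /(_ xab); have := ler_normcB (H (x +i* y)) (H (x +i* y0)).
lra.
Qed.

End HorizontalLines.

(** * Equi-integrability of Hardy functions *)

Section HardyEquiintegrability.
Context {R : realType}.

Lemma continuous_addf (f g : R -> R) : continuous f -> continuous g -> continuous (fun x => f x + g x).
Proof. by move=> cf cg x; exact: (continuousD (cf x) (cg x)). Qed.

Lemma continuous_mulf (f g : R -> R) : continuous f -> continuous g -> continuous (fun x => f x * g x).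
Proof. by move=> cf cg x; exact: (continuousM (cf x) (cg x)). Qed.

Lemma continuous_mulcf (k : R) (f : R -> R) : continuous f -> continuous (fun x => k * f x).
Proof. by move=> cf; apply: continuous_mulf => //; exact: cst_continuous. Qed.

Implicit Types (m s x y L : R).
Variables (p p' : R[i] -> R[i]) (A2 : R).
Hypothesis (pp' : holo p p') (cp' : ccont p').
Hypothesis L2p : forall y a b : R, y < 0 -> a <= b ->
  segint a b (fun x => normc (p (x +i* y)) ^+ 2) <= A2.

Let cp : ccont p := holo_ccont pp'.
Let msq (y x : R) : R := normc (p (x +i* y)) ^+ 2.
(** It vanishes at [- L] and [L], which removes the boundary terms of an integration by parts, and
    its slope on the segment is at most [2 / L]. *)
Let cutoff (L x : R) : R := 1 - (x / L) ^+ 2.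
Let dcutoff (L x : R) : R := - (2 * x / L ^+ 2).
(** At [s = 0] the real part is the squared modulus of [p] at height [m]; when [s] is half the gap
    between two heights it is the cross term in the square of the difference of the two lines. *)
Let cross (m s x : R) : R[i] := p (x +i* (m + s)) * (p (x +i* (m - s)))^*.
Let dcross (m s x : R) : R[i] := p' (x +i* (m + s)) * (p (x +i* (m - s)))^*
  + p (x +i* (m + s)) * (p' (x +i* (m - s)))^*.

Lemma cutoff_derive L x : L != 0 -> is_derive x 1 (cutoff L) (dcutoff L x).
Proof.
rewrite /dcutoff.
move=> L0.
have -> : cutoff L = (fun=> 1) - (fun x => (L ^+ 2)^-1 * (x * x)).
  by apply/funext => s; rewrite /cutoff /GRing.add/= expr_div_n mulrC expr2.
have A : is_derive x 1 (fun s : R => s * s) (x *: 1 + x *: 1) by exact: is_deriveM.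
have B := is_deriveB (is_derive_cst (1 : R) x 1) (is_derive_mull (L ^+ 2)^-1 A).
by apply: is_derive_eq; rewrite /GRing.scale/=; field.
Qed.

Lemma cutoff_cont L : L != 0 -> continuous (cutoff L).
Proof. by move=> L0 x; exact: is_derive_cts (cutoff_derive x L0). Qed.

Lemma cutoff_itv L x : 0 < L -> - L <= x <= L -> 0 <= cutoff L x <= 1.
Proof.
move=> L0 xL; have : (x / L) ^+ 2 <= 1.
  rewrite -[X in X <= _]ger0_norm ?sqr_ge0// normrX expr_le1//.
  by rewrite normrM normfV ler_pdivrMr ?normr_gt0 ?gt_eqF// mul1r (gtr0_norm L0) ler_norml.
by rewrite /cutoff; have := sqr_ge0 (x / L); lra.
Qed.

Lemma heights (m s : R) : m < 0 -> `|s| < - m -> m + s < 0 /\ m - s < 0.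
Proof. by move=> m0; rewrite ltr_norml => /andP[? ?]; split; lra. Qed.

Lemma cross_derive_x m s x : m < 0 -> `|s| < - m -> vder (cross m s) x (dcross m s x).
Proof.
move=> m0 /(heights m0)[s1 s2].
by apply: vderM; [|apply: vder_conj]; apply: cder_horizontal; exact: pp'.
Qed.

Lemma cross_derive_s m s x : m < 0 -> `|s| < - m ->
  is_derive s 1 (fun s => Re (cross m s x)) (- Im (dcross m s x)).
Proof.
move=> m0 /(heights m0)[s1 s2].
have A : vder (fun s => p (x +i* (m + s))) s (p' (x +i* (m + s)) * 'i).
  by apply: (@vder_shift _ (fun y => p (x +i* y)) m); apply: cder_vertical; exact: pp'.
have B : vder (fun s => p (x +i* (m - s))) s (- (p' (x +i* (m - s)) * 'i)).
  have B1 : vder (fun s => p (x +i* (m + s))) (- s) (p' (x +i* (m - s)) * 'i).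
    by apply: (@vder_shift _ (fun y => p (x +i* y)) m); apply: cder_vertical; exact: pp'.
  by have := vderN B1; rewrite opprK.
have := vder_Re (vderM A (vder_conj B)).
have -> // : Re (p' (x +i* (m + s)) * 'i * (p (x +i* (m - s)))^* +
   p (x +i* (m + s)) * (- (p' (x +i* (m - s)) * 'i))^*) = - Im (dcross m s x).
rewrite /dcross; case: (p _) => a b; case: (p _) => a' b'; case: (p' _) => c d.
by case: (p' _) => c' d'; simpc => /=; ring.
Qed.

Lemma dcross_cont m s x : m < 0 -> `|s| < - m -> vcont (dcross m s) x.
Proof.
move=> m0 /(heights m0)[s1 s2].
by apply: vcontD; apply: vcontM; try apply: vcont_conj; exact: ccont_line.
Qed.

Definition cut_energy L y := segint (- L) L (fun x => cutoff L x * msq y x).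

Lemma cut_energy_cont L y : L != 0 -> y < 0 -> continuous (fun x => cutoff L x * msq y x).
Proof.
by move=> L0 y0 x; apply: continuousM; [exact: cutoff_cont|exact: ccont_sqr_line].
Qed.

Lemma Re_Im_cross_le m s x :
  `|Im (cross m s x)| <= (msq (m + s) x + msq (m - s) x) / 2.
Proof.
apply: le_trans (normc_Im_le _) _; rewrite normcM normc_conj /msq.
have := sqr_ge0 (normc (p (x +i* (m + s))) - normc (p (x +i* (m - s)))).
rewrite sqrrB; lra.
Qed.

Let J L m s : R := segint (- L) L (fun x => cutoff L x * Re (cross m s x)).

Lemma A2_ge0 : 0 <= A2.
Proof.
apply: le_trans (L2p (y := -1) (a := 0) (b := 0) _ (lexx _)); rewrite ?ltrN10//.
by apply: segint_ge0 => x _; exact: sqr_ge0.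
Qed.

Lemma cross_cont m s x : m < 0 -> `|s| < - m -> vcont (cross m s) x.
Proof. by move=> m0 sm; exact: vder_vcont (cross_derive_x x m0 sm). Qed.

(* By the Cauchy-Riemann equations the s-derivative of [Re cross] is minus the
   x-derivative of [Im cross], so that after an integration by parts only the
   derivative of the cutoff, of order [1 / L], survives. *)
Lemma J_derive L m s : 0 < L -> m < 0 -> `|s| < - m ->
  exists2 v, is_derive s 1 (J L m) v & `|v| <= 2 * A2 / L.
Proof.
move=> L0 m0 sm; have [s1 s2] := heights m0 sm.
have Ln0 : L != 0 by rewrite gt_eqF.
have LL : - L <= L by lra.
have cI s' : `|s'| < - m -> continuous (fun x => cutoff L x * - Im (dcross m s' x)).
  move=> s'm x; apply: continuousM; first exact: cutoff_cont.
  by apply: continuousN; apply: vcont_Im; exact: dcross_cont.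
exists (segint (- L) L (fun x => cutoff L x * - Im (dcross m s x))); last first.
  have cK : continuous (fun x => dcutoff L x * Im (cross m s x)).
    move=> x; apply: continuousM; last exact/vcont_Im/cross_cont.
    rewrite /dcutoff; have -> : (fun x : R => - (2 * x / L ^+ 2)) = (fun x => (- (2 / L ^+ 2)) * x).
      by apply/funext => t; ring.
    exact: is_derive_cts (is_derive_linear _ _).
  have cN : continuous (fun x => cutoff L x * Im (dcross m s x)).
    by move=> x; apply: continuousM; [exact: cutoff_cont|exact/vcont_Im/dcross_cont].
  have F x : - L <= x <= L -> is_derive x 1 (fun x => cutoff L x * Im (cross m s x))
      (dcutoff L x * Im (cross m s x) + cutoff L x * Im (dcross m s x)).
    move=> _; have A := is_deriveM (cutoff_derive x Ln0) (vder_Im (cross_derive_x x m0 sm)).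
    by apply: is_derive_eq; rewrite /GRing.scale/= addrC; congr (_ + _); rewrite mulrC.
  have cS : continuous (fun x => dcutoff L x * Im (cross m s x) + cutoff L x * Im (dcross m s x)).
    by move=> x; exact: (continuousD (cK x) (cN x)).
  have E := segint_FTC LL cS F; rewrite segintD// in E.
  have E1 : cutoff L L = 0 by rewrite /cutoff divff// expr1n subrr.
  have E2 : cutoff L (- L) = 0 by rewrite /cutoff mulNr divff// sqrrN expr1n subrr.
  rewrite E1 E2 !mul0r subrr in E.
  have -> : segint (- L) L (fun x => cutoff L x * - Im (dcross m s x)) =
      segint (- L) L (fun x => dcutoff L x * Im (cross m s x)).
    have -> : segint (- L) L (fun x => cutoff L x * - Im (dcross m s x)) =
       -1 * segint (- L) L (fun x => cutoff L x * Im (dcross m s x)).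
      by rewrite -segintZ//; apply: eq_segint => x _; ring.
    by lra.
  have cM : continuous (fun x => L^-1 * (msq (m + s) x + msq (m - s) x)).
    by apply/continuous_mulcf/continuous_addf; exact: ccont_sqr_line.
  have cM' : continuous (fun x => - L^-1 * (msq (m + s) x + msq (m - s) x)).
    by apply/continuous_mulcf/continuous_addf; exact: ccont_sqr_line.
  have pt x : - L <= x <= L ->
      `|dcutoff L x * Im (cross m s x)| <= L^-1 * (msq (m + s) x + msq (m - s) x).
    move=> xL; rewrite normrM /dcutoff normrN.
    have -> : L^-1 * (msq (m + s) x + msq (m - s) x) =
       (2 / L) * ((msq (m + s) x + msq (m - s) x) / 2) by field.
    apply: ler_pM => //; last exact: Re_Im_cross_le.
    rewrite !normrM normfV normrX (gtr0_norm L0) ger0_norm// expr2 invfM mulrA.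
    rewrite ler_pM2r ?invr_gt0// -mulrA ler_piMr// ler_pdivrMr// mul1r ler_norml.
    exact: xL.
  have B : segint (- L) L (fun x => L^-1 * (msq (m + s) x + msq (m - s) x)) <= 2 * A2 / L.
    rewrite segintZ; last first.
      by apply: continuous_addf; exact: ccont_sqr_line.
    rewrite segintD; [|exact: ccont_sqr_line|exact: ccont_sqr_line].
    rewrite mulrC ler_pM2r ?invr_gt0//.
    by have := L2p s1 LL; have := L2p s2 LL; rewrite /msq; lra.
  rewrite ler_norml; apply/andP; split.
    rewrite lerNl; apply: le_trans _ B.
    rewrite -[X in X <= _]mulN1r -segintZ//.
    apply: segint_le => //; first exact: continuous_mulcf.
    by move=> x /pt; rewrite ler_norml mulN1r lerNl => /andP[].
  apply: le_trans _ B; apply: segint_le => // x /pt.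
  by rewrite ler_norml => /andP[].
have [d1 d10 [M1 H1]] := ccont_rectangle_bound cp s1 LL.
have [d2 d20 [M2 H2]] := ccont_rectangle_bound cp s2 LL.
have [d3 d30 [M3 H3]] := ccont_rectangle_bound cp' s1 LL.
have [d4 d40 [M4 H4]] := ccont_rectangle_bound cp' s2 LL.
(* Both heights stay below the axis and inside the rectangles where [p] and [p'] are bounded, which
   dominates the derivative under the integral. *)
pose r := Num.min (- m - `|s|) (Num.min (Num.min d1 d2) (Num.min d3 d4)).
have rP s' : `|s' - s| < r -> [/\ `|s'| < - m, `|m + s' - (m + s)| < Num.min d1 d3
     & `|m - s' - (m - s)| < Num.min d2 d4].
  rewrite !lt_min => /andP[h0 /andP[/andP[h1 h2] /andP[h3 h4]]]; split.
  - by have := ler_distD s s' 0; rewrite !subr0; lra.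
  - by rewrite (_ : m + s' - (m + s) = s' - s) ?h1//; ring.
  - by rewrite (_ : m - s' - (m - s) = s - s') ?(distrC s) ?h2//; ring.
apply: (@segint_derive R (fun s x => cutoff L x * Re (cross m s x))
  (fun s x => cutoff L x * - Im (dcross m s x)) _ _ s r (M3 * M2 + M1 * M4)).
- by rewrite !lt_min subr_gt0 sm d10 d20 d30.
- move=> s' /rP[s'm _ _] x; apply: continuousM; first exact: cutoff_cont.
  exact/vcont_Re/cross_cont.
- move=> s' x /rP[s'm _ _] xL; apply: is_derive_mull; exact: cross_derive_s.
- move=> s' x /rP[s'm + +] xL; rewrite !lt_min => /andP[h1 h3] /andP[h2 h4].
  have [_ B1] := H1 _ _ h1 xL; have [_ B2] := H2 _ _ h2 xL.
  have [_ B3] := H3 _ _ h3 xL; have [_ B4] := H4 _ _ h4 xL.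
  have /andP[c0 c1] := cutoff_itv L0 xL.
  rewrite normrM normrN (ger0_norm c0) (le_trans (ler_piMl _ c1))//.
  rewrite (le_trans (normc_Im_le _))// (le_trans (normcD_le _ _))// !normcM !normc_conj.
  by rewrite lerD// ler_pM// normc_ge0.
Qed.

Lemma cut_energy_J L m : cut_energy L m = J L m 0.
Proof.
apply: eq_segint => x _; congr (_ * _); rewrite /cross addr0 subr0 /msq.
by case: (p _) => a b /=; rewrite sqr_sqrtr ?addr_ge0 ?sqr_ge0//; ring.
Qed.

Lemma J_increment L m s : 0 < L -> m < 0 -> 0 <= s < - m ->
  `|J L m s - J L m 0| <= 2 * A2 / L * s.
Proof.
move=> L0 m0 /andP[s0 sm].
(* The range condition sits inside the existential so that [choice] yields a derivative defined for
   every [x]. *)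
have H x : exists v, 0 <= x <= s -> is_derive x 1 (J L m) v /\ `|v| <= 2 * A2 / L.
  have [/andP[x0 xs]|?] := boolP (0 <= x <= s); last by exists 0.
  have [|v v1 v2] := @J_derive L m x L0 m0; last by exists v.
  by rewrite ger0_norm// (le_lt_trans xs).
have [v Hv] := choice H.
rewrite -[X in _ * X]subr0; apply: (@is_derive_increment_le R (J L m) v) => // x /Hv; by case.
Qed.

Let dist2 y1 y2 x : R := normc (p (x +i* y1) - p (x +i* y2)) ^+ 2.

Lemma dist2_cont y1 y2 : y1 < 0 -> y2 < 0 -> continuous (dist2 y1 y2).
Proof.
move=> y10 y20 x.
have c : vcont (fun x => p (x +i* y1) - p (x +i* y2)) x by apply: vcontB; exact: ccont_line.
rewrite /dist2 (_ : (fun x => _) = (fun x => normc (p (x +i* y1) - p (x +i* y2)) * normc (p (x +i* y1) - p (x +i* y2)))).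
  by apply: continuousM; exact: vcont_normc.
by apply/funext => s; rewrite expr2.
Qed.

(** The parallelogram identity in which the inner product of the two lines is replaced by the energy
    halfway, at the cost of twice [J_increment] for [s = (y1 - y2) / 2]. *)
Lemma cut_parallelogram L y1 y2 : 0 < L -> y2 <= y1 -> y1 < 0 ->
  segint (- L) L (fun x => cutoff L x * dist2 y1 y2 x) <=
  cut_energy L y1 + cut_energy L y2 - 2 * cut_energy L ((y1 + y2) / 2) + 2 * A2 / L * (y1 - y2).
Proof.
move=> L0 y21 y10; have y20 : y2 < 0 by exact: le_lt_trans y10.
have Ln0 : L != 0 by rewrite gt_eqF.
pose m := (y1 + y2) / 2; pose s := (y1 - y2) / 2.
have m0 : m < 0 by rewrite /m; lra.
have sm : 0 <= s < - m by rewrite /s /m; apply/andP; split; lra.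
have sm' : `|s| < - m by rewrite ger0_norm; case/andP: sm.
have ms1 : m + s = y1 by rewrite /m /s; lra.
have ms2 : m - s = y2 by rewrite /m /s; lra.
have := J_increment L0 m0 sm; rewrite -cut_energy_J => /ler_normlP[].
have c1 := cut_energy_cont Ln0 y10; have c2 := cut_energy_cont Ln0 y20.
have cJ : continuous (fun x => cutoff L x * Re (cross m s x)).
  by move=> x; apply: continuousM; [exact: cutoff_cont|exact/vcont_Re/cross_cont].
have cJ2 : continuous (fun x => 2 * (cutoff L x * Re (cross m s x))).
  exact: continuous_mulcf.
have cS : continuous (fun x => cutoff L x * msq y1 x + cutoff L x * msq y2 x).
  exact: continuous_addf.
have -> : segint (- L) L (fun x => cutoff L x * dist2 y1 y2 x) =
  cut_energy L y1 + cut_energy L y2 - 2 * J L m s.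
  rewrite -segintD// -segintZ// -segintB//; apply: eq_segint => x _.
  rewrite /dist2 /msq /cross ms1 ms2 !sqr_normcE.
  by case: (p _) => a b; case: (p _) => a' b' /=; ring.
move=> A B.
have -> : 2 * A2 / L * (y1 - y2) = 2 * (2 * A2 / L * s).
  by rewrite /s; field.
by rewrite -/m; lra.
Qed.

(** The cutoffs increase with [L], so the limit of large [L] can be taken as a supremum. *)
Lemma cut_integral_mono L L' (f : R -> R) : 0 < L <= L' -> continuous f -> (forall x, 0 <= f x) ->
  segint (- L) L (fun x => cutoff L x * f x) <= segint (- L') L' (fun x => cutoff L' x * f x).
Proof.
move=> /andP[L0 LL'] cf f0; have L'0 : 0 < L' by exact: lt_le_trans LL'.
have c1 : continuous (fun x => cutoff L x * f x).
  by apply: continuous_mulf => //; apply: cutoff_cont; rewrite gt_eqF.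
have c2 : continuous (fun x => cutoff L' x * f x).
  by apply: continuous_mulf => //; apply: cutoff_cont; rewrite gt_eqF.
apply: (@le_trans _ _ (segint (- L) L (fun x => cutoff L' x * f x))).
  apply: segint_le => // x xL; apply: ler_wpM2r => //.
  rewrite /cutoff lerD2l lerN2 !expr_div_n ler_wpM2l ?sqr_ge0//.
  rewrite lef_pV2 ?posrE ?exprn_gt0//.
  by apply: lerXn2r; rewrite ?nnegrE //; exact: ltW.
apply: segint_subset => //; first by rewrite lerN2.
by move=> x /(cutoff_itv L'0)/andP[? _]; rewrite mulr_ge0.
Qed.

Lemma cut_energy_le L y : 0 < L -> y < 0 -> cut_energy L y <= A2.
Proof.
move=> L0 y0; have LL : - L <= L by lra.
apply: le_trans (L2p y0 LL); apply: segint_le; last 1 first.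
- by move=> x /(cutoff_itv L0)/andP[c0 c1]; rewrite ler_piMl// sqr_ge0.
- by apply: cut_energy_cont; rewrite ?gt_eqF.
- exact: ccont_sqr_line.
Qed.

(** The squared L^2 norm of the whole line at height [y], as the supremum of the increasing cut
    energies. *)
Let N y : R := sup [set cut_energy L y | L in [set L : R | 0 < L]].

Lemma N_has_sup y : y < 0 -> has_sup [set cut_energy L y | L in [set L : R | 0 < L]].
Proof.
move=> y0; split; first by exists (cut_energy 1 y); exists 1 => /=.
by exists A2 => _ [L /= L0 <-]; exact: cut_energy_le.
Qed.

Lemma cut_energy_N L y : 0 < L -> y < 0 -> cut_energy L y <= N y.
Proof. by move=> L0 y0; apply: ub_le_sup; [case: (N_has_sup y0)|exists L]. Qed.

Lemma N_le y : y < 0 -> N y <= A2.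
Proof.
move=> y0; apply: ge_sup; first by case: (N_has_sup y0).
by move=> _ [L /= L0 <-]; exact: cut_energy_le.
Qed.

Lemma N_parallelogram L y1 y2 : 0 < L -> y2 <= y1 -> y1 < 0 ->
  segint (- L) L (fun x => cutoff L x * dist2 y1 y2 x) <= N y1 + N y2 - 2 * N ((y1 + y2) / 2).
Proof.
move=> L0 y21 y10; have y20 : y2 < 0 by exact: le_lt_trans y10.
have m0 : (y1 + y2) / 2 < 0 by lra.
apply/ler_addgt0Pr => e e0.
have e40 : 0 < e / 4 by rewrite divr_gt0.
have [_ [L1 /= L10 <-] H1] := sup_adherent e40 (N_has_sup m0).
rewrite -/(N _) in H1.
pose K := 2 * A2 * (y1 - y2).
have K0 : 0 <= K by rewrite !mulr_ge0 ?A2_ge0// subr_ge0.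
(* At least [L] for the left side, at least [L1] to be within [e / 4] of [N] halfway, and so large
   that the cutoff error is at most [e / 2]. *)
pose L2 := Num.max L (Num.max L1 (2 * K / e)).
have L20 : 0 < L2 by rewrite lt_max L0.
have := cut_parallelogram L20 y21 y10.
have : 2 * A2 / L2 * (y1 - y2) <= e / 2.
  rewrite mulrAC -/K ler_pdivrMr// mulrC.
  have : 2 * K / e <= L2 by rewrite !le_max lexx !orbT.
  by rewrite ler_pdivrMr//; lra.
have : cut_energy L1 ((y1 + y2) / 2) <= cut_energy L2 ((y1 + y2) / 2).
  apply: cut_integral_mono; rewrite ?L10 ?le_max ?lexx ?orbT//.
  - exact: ccont_sqr_line.
  - by move=> x; exact: sqr_ge0.
have : segint (- L) L (fun x => cutoff L x * dist2 y1 y2 x) <=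
       segint (- L2) L2 (fun x => cutoff L2 x * dist2 y1 y2 x).
  apply: cut_integral_mono; rewrite ?L0 ?le_max ?lexx ?orbT//.
  - exact: dist2_cont.
  - by move=> x; exact: sqr_ge0.
have := cut_energy_N L20 y10; have := cut_energy_N L20 y20.
by move: H1; lra.
Qed.

Lemma N_mid y1 y2 : y2 <= y1 -> y1 < 0 -> 2 * N ((y1 + y2) / 2) <= N y1 + N y2.
Proof.
move=> y21 y10; rewrite -subr_ge0.
apply: le_trans (N_parallelogram ltr01 y21 y10); apply: segint_ge0 => x xi.
have /andP[? _] := cutoff_itv ltr01 xi.
by rewrite mulr_ge0// sqr_ge0.
Qed.

(* [N] is midpoint convex and bounded on the left half line. *)
Lemma N_nondecreasing y1 y2 : y2 <= y1 -> y1 < 0 -> N y2 <= N y1.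
Proof.
rewrite le_eqVlt => /predU1P[->//|y21] y10; rewrite leNgt; apply/negP => H.
pose h := y1 - y2; have h0 : 0 < h by rewrite subr_gt0.
(* If [N] grew on going down from [y1] to [y2], convexity would make it grow at least as much on
   each further step of length [h], hence without bound. *)
pose y k := y1 - k%:R * h.
have yS k : y k.+1 = y k - h by rewrite /y -natr1; ring.
have y0 k : y k < 0.
  by rewrite /y (le_lt_trans _ y10)// gerBl mulr_ge0// ltW.
have step k : N y2 - N y1 <= N (y k.+1) - N (y k).
  elim: k => [|k IH].
    have -> : y 1%N = y2 by rewrite /y /h; ring.
    by have -> : y 0%N = y1 by rewrite /y mul0r subr0.
  have := @N_mid (y k) (y k.+2); rewrite (_ : (y k + y k.+2) / 2 = y k.+1); last first.
    by rewrite !yS; field.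
  have A : y k.+2 <= y k by rewrite !yS; lra.
  by move=> /(_ A (y0 k)); move: IH; move: (N _) (N _) (N _) (N _) (N _) => *; lra.
have lin k : N y1 + k%:R * (N y2 - N y1) <= N (y k).
  elim: k => [|k IH]; first by rewrite mul0r addr0 /y mul0r subr0.
  by rewrite -natr1 mulrDl mul1r; have := step k; lra.
have d0 : 0 < N y2 - N y1 by rewrite subr_gt0.
have [k] : exists k : nat, (A2 - N y1) / (N y2 - N y1) < k%:R.
  by exists (Num.truncn ((A2 - N y1) / (N y2 - N y1))).+1; exact: truncnS_gt.
rewrite ltr_pdivrMr//; have := lin k; have := N_le (y0 k); lra.
Qed.

(** Bounded and monotone, [N] is within [e / 2] of its supremum from some height on. The
    parallelogram inequality turns this into closeness of the lines in L^2, with no need to exhibit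
    their limit. *)
Lemma hardy_cauchy (e : R) : 0 < e -> exists2 y0 : R, y0 < 0 &
  forall y1 y2 L, y0 <= y2 -> y2 <= y1 -> y1 < 0 -> 0 < L ->
  segint (- L) L (fun x => cutoff L x * dist2 y1 y2 x) <= e.
Proof.
move=> e0; pose A := [set N y | y in [set y : R | y < 0]].
have supA : has_sup A.
  split; first by exists (N (-1)); exists (-1) => //=; rewrite ltrN10.
  by exists A2 => _ [y /= y0 <-]; exact: N_le.
have e20 : 0 < e / 2 by rewrite divr_gt0.
have [_ [y0 /= y00 <-] H0] := sup_adherent e20 supA.
exists y0 => // y1 y2 L y02 y21 y10 L0.
have y20 : y2 < 0 by exact: le_lt_trans y10.
have m0 : (y1 + y2) / 2 < 0 by lra.
have N1 : N y1 <= sup A by apply: ub_le_sup; [case: supA|exists y1].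
have N2 : N y2 <= sup A by apply: ub_le_sup; [case: supA|exists y2].
have N3 : N y0 <= N ((y1 + y2) / 2) by apply: N_nondecreasing => //; lra.
by have := N_parallelogram L0 y21 y10; lra.
Qed.

(** Every line close to the boundary is L^2-close to one fixed line inside, and on that line [p] is
    locally bounded. *)
Lemma hardy_equiintegrable (x0 e : R) : 0 < e -> exists2 d : R, 0 < d &
  forall y, - d < y < 0 -> segint (x0 - d) (x0 + d) (fun x => normc (p (x +i* y)) ^+ 2) <= e.
Proof.
move=> e0; have e80 : 0 < e / 8 by rewrite divr_gt0.
have [y0 y00 Hy] := hardy_cauchy e80.
have x01 : x0 - 1 <= x0 + 1 by lra.
have [r r0 [M HM]] := ccont_rectangle_bound cp y00 x01.
have M0 : 0 <= M.
  have x00 : x0 - 1 <= x0 <= x0 + 1 by apply/andP; split; lra.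
  have := HM y0 x0; rewrite subrr normr0 => /(_ r0 x00)[_].
  by apply: le_trans; exact: normc_ge0.
(* The three terms keep the segment where [M] bounds [p], keep the height above [y0], and give
   [4 * d * M ^+ 2 <= e / 2]. *)
pose d := Num.min 1 (Num.min (- y0) (e / (8 * (M ^+ 2 + 1)))).
have MM : 0 < 8 * (M ^+ 2 + 1) by rewrite mulr_gt0// ltr_wpDl// sqr_ge0.
have d0 : 0 < d by rewrite !lt_min ltr01 oppr_gt0 y00 divr_gt0.
have d1 : d <= 1 by rewrite ge_min lexx.
have dy0 : d <= - y0 by rewrite !ge_min lexx !orbT.
have dM : d * (8 * (M ^+ 2 + 1)) <= e by rewrite -ler_pdivlMr// !ge_min lexx !orbT.
exists d => // y /andP[yd y_0].
(* On the small segment [|x|] is at most [L / 2], so the cutoff is at least [1 / 2] there and can be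
   inserted. *)
pose L := 2 * (`|x0| + 1); have L0 : 0 < L by rewrite mulr_gt0// ltr_wpDl.
have Ln0 : L != 0 by rewrite gt_eqF.
have yy0 : y0 <= y by lra.
have := Hy y y0 L (lexx _) yy0 y_0 L0.
have cd := dist2_cont y_0 y00.
have cm := ccont_sqr_line cp y_0.
have cc := continuous_mulf (cutoff_cont Ln0) cd.
have cb : continuous (fun x => 4 * (cutoff L x * dist2 y y0 x) + 2 * M ^+ 2).
  by apply: continuous_addf; [exact: continuous_mulcf|exact: cst_continuous].
have xx : x0 - d <= x0 + d by lra.
have xa (x : R) : x0 - d <= x <= x0 + d -> `|x| <= `|x0| + 1.
  move=> xd; have : `|x - x0| <= 1.
    by move: xd; rewrite ler_norml => /andP[? ?]; apply/andP; split; lra.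
  by have := ler_normD (x - x0) x0; rewrite subrK; lra.
have pt x : x0 - d <= x <= x0 + d ->
    normc (p (x +i* y)) ^+ 2 <= 4 * (cutoff L x * dist2 y y0 x) + 2 * M ^+ 2.
  move=> xd; have c : 1 / 2 <= cutoff L x.
    have : (x / L) ^+ 2 <= (1 / 2) ^+ 2.
      rewrite -ler_sqrt ?sqr_ge0// !sqrtr_sqr normrM normfV (gtr0_norm L0) ler_pdivrMr//.
      have -> : `|1 / 2 : R| = 1 / 2 by rewrite ger0_norm.
      by have := xa x xd; rewrite /L; lra.
    by rewrite (_ : (1 / 2) ^+ 2 = 1 / 4 :> R) /cutoff; [lra|field].
  have xd1 : x0 - 1 <= x <= x0 + 1.
    by move: xd => /andP[? ?]; apply/andP; split; lra.
  have := HM y0 x; rewrite subrr normr0 => /(_ r0 xd1)[_ B].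
  have : normc (p (x +i* y)) ^+ 2 <= 2 * dist2 y y0 x + 2 * normc (p (x +i* y0)) ^+ 2.
    have := normcD_le (p (x +i* y) - p (x +i* y0)) (p (x +i* y0)); rewrite subrK.
    rewrite /dist2; move: (normc_ge0 (p (x +i* y))).
    move: (normc (p (x +i* y0))) (normc (p (x +i* y) - _)) (normc (p (x +i* y))) => c' b a a0 abc.
    have : a ^+ 2 <= (b + c') ^+ 2 by apply: lerXn2r; rewrite ?nnegrE //; exact: le_trans abc.
    by have := sqr_ge0 (b - c'); rewrite sqrrB sqrrD; lra.
  have : normc (p (x +i* y0)) ^+ 2 <= M ^+ 2 by rewrite lerXn2r ?nnegrE ?normc_ge0.
  have : 1 / 2 * dist2 y y0 x <= cutoff L x * dist2 y y0 x by rewrite ler_wpM2r// sqr_ge0.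
  lra.
have := segint_le cm cb pt; rewrite segintD; [|exact: continuous_mulcf|exact: cst_continuous].
rewrite segintZ// segint_cst//.
have : segint (x0 - d) (x0 + d) (fun x => cutoff L x * dist2 y y0 x) <=
    segint (- L) L (fun x => cutoff L x * dist2 y y0 x).
  have := ler_norm x0; have := ler_norm (- x0); rewrite normrN => h1 h2.
  have g1 : - L <= x0 - d by rewrite /L; lra.
  have g2 : x0 + d <= L by rewrite /L; lra.
  apply: segint_subset => //.
  by move=> x /(cutoff_itv L0)/andP[? _]; rewrite mulr_ge0// sqr_ge0.
rewrite (_ : 2 * M ^+ 2 * (x0 + d - (x0 - d)) = 4 * (d * M ^+ 2)); last by ring.
have : d * M ^+ 2 <= e / 8.
  have := sqr_ge0 M; nra.
lra.
Qed.

End HardyEquiintegrability.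

(** * Boundary limits at a fixed time *)

Section BoundaryLimits.
Context {R : realType}.
Implicit Types (x y a b d e : R) (H D : R[i] -> R[i]).

Lemma line_increment_le H D y a b (phi : R -> R) : holo H D -> y < 0 -> a <= b ->
  continuous phi -> (forall x, a <= x <= b -> normc (D (x +i* y)) <= phi x) ->
  normc (H (b +i* y) - H (a +i* y)) <= segint a b phi.
Proof.
move=> HD y0 ab cphi Dphi; have [Phi HPhi] := continuous_primitive (a - 1) cphi.
have HPhi' x : a <= x <= b -> is_derive x 1 Phi (phi x).
  by move=> /andP[ax _]; apply: HPhi; lra.
rewrite (segint_FTC ab cphi HPhi').
apply: (@vder_increment_le _ (fun x => H (x +i* y)) (fun x => D (x +i* y)) Phi phi) => // x _.
by apply: cder_horizontal; exact: HD.
Qed.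

(** A product neighbourhood: the abscissa ranges over the same interval at every height, which suits
    estimates along horizontal segments. *)
Definition in_halfsquare (x0 d : R) (z : R[i]) : Prop := `|Re z - x0| < d /\ - d < Im z < 0.

Lemma halfsquare_ball (x0 d : R) (z : R[i]) : Pminus z -> normc (z - x0%:C) < d -> in_halfsquare x0 d z.
Proof.
rewrite /Pminus/= => z0 zd; split.
  by apply: le_lt_trans zd; apply: le_trans (normc_Re_le _); rewrite Re_add Re_opp.
have := le_lt_trans (normc_Im_le _) zd; rewrite Im_add Im_opp/= subr0 ltr_norml => /andP[? _].
by apply/andP.
Qed.

Lemma ball_halfsquare (x0 d : R) (z : R[i]) : in_halfsquare x0 d z -> normc (z - x0%:C) < 2 * d /\ Pminus z.
Proof.
move=> [zx /andP[y1 y2]]; split => //; apply: le_lt_trans (normc_le_sum _) _.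
rewrite Re_add Im_add Re_opp Im_opp /= subr0 mulr_natl mulr2n ltrD//.
by rewrite ltr0_norm//; lra.
Qed.

Lemma clim_halfsquareP H (x0 : R) (l : R[i]) : clim Pminus H x0%:C l <->
  (forall e, 0 < e -> exists2 d, 0 < d & forall x y, in_halfsquare x0 d (x +i* y) ->
     normc (H (x +i* y) - l) < e).
Proof.
split=> HL e e0.
  have [d d0 Hd] := HL e e0; exists (d / 2); first by rewrite divr_gt0.
  move=> x y /ball_halfsquare[]; rewrite mulrC divfK// => ? ?; exact: Hd.
have [d d0 Hd] := HL e e0; exists d => // -[x y] wd Pw.
by apply: Hd; exact: halfsquare_ball.
Qed.

(* AM-GM: [2 |q| <= s |q|^2 + 1 / s] turns a uniform L^2 bound on horizontal
   lines into a modulus of continuity. *)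
Lemma horizontal_equicontinuity H D (Q : R[i] -> R[i]) (x0 d0 c B : R) : holo H D -> ccont Q ->
  0 < d0 -> 0 <= c ->
  (forall y a b, y < 0 -> a <= b -> segint a b (fun x => normc (Q (x +i* y)) ^+ 2) <= B) ->
  (forall x y, in_halfsquare x0 d0 (x +i* y) -> normc (D (x +i* y)) <= c * normc (Q (x +i* y))) ->
  forall e, 0 < e -> exists2 d, 0 < d & forall x1 x2 y,
    in_halfsquare x0 d (x1 +i* y) -> in_halfsquare x0 d (x2 +i* y) ->
    normc (H (x1 +i* y) - H (x2 +i* y)) < e.
Proof.
move=> HD cQ d00 c0 LB DQ e e0.
have B0 : 0 <= B.
  have [m0 mm] : (-1 < 0 :> R) /\ 0 <= 0 :> R by rewrite ltrN10.
  by apply: le_trans (LB (-1) 0 0 m0 mm); apply: segint_ge0 => x _; exact: sqr_ge0.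
(* The weight [s] brings the L^2 term below [e / 4] whatever the segment; only then is [d] chosen,
   to bring the [1 / s] term below [e / 2]. *)
pose s := e / (2 * (c + 1) * (B + 1)).
have s0 : 0 < s by rewrite divr_gt0// !mulr_gt0// ltr_wpDl.
pose d := Num.min d0 (e * s / (2 * (c + 1))).
have c10 : 0 < c + 1 by rewrite ltr_wpDl.
have d_0 : 0 < d by rewrite lt_min d00 divr_gt0// mulr_gt0.
exists d => // x1 x2 y; wlog x12 : x1 x2 / x2 <= x1.
  move=> W h1 h2; case: (leP x2 x1) => [|/ltW] x12; first exact: W.
  by rewrite normc_distC; exact: W.
move=> [/= h1 /andP[y1 y2]] [/= h2 _].
have cq : continuous (fun x => normc (Q (x +i* y)) ^+ 2) by exact: ccont_sqr_line.
pose phi x := c / 2 * (s * normc (Q (x +i* y)) ^+ 2 + s^-1).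
have csq : continuous (fun x => s * normc (Q (x +i* y)) ^+ 2 + s^-1).
  by apply: continuous_addf; [exact: continuous_mulcf|exact: cst_continuous].
have cphi : continuous phi by exact: continuous_mulcf.
have Dphi x : x2 <= x <= x1 -> normc (D (x +i* y)) <= phi x.
  move=> /andP[x2x xx1]; apply: le_trans (DQ x y _) _.
    split => /=; last by apply/andP; split => //; rewrite (le_lt_trans _ y1)// lerN2 ge_min lexx.
    have dd0 : d <= d0 by rewrite ge_min lexx.
    move: h1 h2; rewrite !ltr_norml => /andP[? ?] /andP[? ?]; apply/andP; split; lra.
  rewrite /phi -mulrA ler_wpM2l//; set q := normc _.
  have := sqr_ge0 (s * q - 1); rewrite sqrrB mulr1 expr1n => K.
  have : 0 <= s^-1 * ((s * q) ^+ 2 - (s * q) *+ 2 + 1) by rewrite mulr_ge0// invr_ge0 ltW.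
  rewrite (_ : s^-1 * _ = s * q ^+ 2 - q *+ 2 + s^-1); last by field; rewrite gt_eqF.
  by rewrite -mulr_natl; lra.
apply: le_lt_trans (line_increment_le HD y2 x12 cphi Dphi) _.
rewrite segintZ// segintD; [|exact: continuous_mulcf|exact: cst_continuous].
rewrite segintZ// segint_cst//.
have x12d : x1 - x2 <= 2 * d.
  by move: h1 h2; rewrite !ltr_norml => /andP[? ?] /andP[? ?]; lra.
have A1 : c / 2 * (s * segint x2 x1 (fun x => normc (Q (x +i* y)) ^+ 2)) <= e / 4.
  have := LB y x2 x1 y2 x12.
  move: (segint _ _ _) => I IB.
  have : c * s * I <= c * s * B by rewrite ler_wpM2l// mulr_ge0// ltW.
  have : c * s * B <= (c + 1) * s * (B + 1).
    have sB : s * B <= s * (B + 1) by rewrite ler_wpM2l ?lerDl// ltW.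
    have c1c : c <= c + 1 by rewrite lerDl.
    rewrite -(mulrA c s B) -(mulrA (c + 1) s (B + 1)); apply: ler_pM => //.
    by rewrite mulr_ge0// ltW.
  have -> : (c + 1) * s * (B + 1) = e / 2.
    by rewrite /s; field; rewrite !gt_eqF// ltr_wpDl.
  lra.
have A2 : c / 2 * (s^-1 * (x1 - x2)) <= e / 2.
  have : c * (s^-1 * (x1 - x2)) <= c * (s^-1 * (2 * d)).
    by rewrite ler_wpM2l// ler_pM2l// invr_gt0.
  have : c * (s^-1 * (2 * d)) <= (c + 1) * (s^-1 * (2 * d)).
    by rewrite ler_wpM2r ?lerDl// !mulr_ge0// ?invr_ge0 ltW.
  have : (c + 1) * (s^-1 * (2 * d)) <= (c + 1) * (s^-1 * (2 * (e * s / (2 * (c + 1))))).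
    have dX : d <= e * s / (2 * (c + 1)) by rewrite ge_min lexx orbT.
    apply: ler_wpM2l; first exact: ltW.
    apply: ler_wpM2l; first by rewrite invr_ge0 ltW.
    by rewrite ler_pM2l.
  have -> : (c + 1) * (s^-1 * (2 * (e * s / (2 * (c + 1))))) = e.
    by field; rewrite !gt_eqF.
  lra.
by rewrite mulrDr; lra.
Qed.

End BoundaryLimits.

(** * Cauchy criterion at a boundary point *)

Section CauchyCriterion.
Context {R : realType}.

Lemma Pminus_proper (z : R[i]) : clPminus z -> ProperFilter (within Pminus (nbhs (z : R[i]^o))).
Proof.
rewrite /clPminus/= => z0; apply: Build_ProperFilter_ex => P /near_normcP[d d0 Hd].
  exists (z - 'i * (d / 2)%:C); apply: Hd.
    rewrite addrC addKr normc_opp normcM normci mul1r normc_real gtr0_norm ?divr_gt0//.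
    by rewrite ltr_pdivrMr// ltr_pMr// ltr1n.
  rewrite /Pminus/= Im_add Im_opp Im_mul/= mul0r mul1r add0r.
  have : 0 < d / 2 by rewrite divr_gt0.
  by lra.
Qed.

Lemma real_limit_Pminus (u : R[i] -> R) (x0 : R) :
  (forall e, 0 < e -> exists2 d, 0 < d & exists c : R, forall w, Pminus w ->
     normc (w - x0%:C) < d -> `|u w - c| < e) ->
  exists m : R, forall e, 0 < e -> exists2 d, 0 < d & forall w, Pminus w ->
     normc (w - x0%:C) < d -> `|u w - m| < e.
Proof.
move=> Hu; pose G := within Pminus (nbhs (x0%:C : R[i]^o)).
have FG : ProperFilter G by apply: Pminus_proper; rewrite /clPminus/=.
have [m Hm] : exists m : R, u @ G --> m.
  suff C : cauchy (u @ G) by apply/cvg_ex; exact: cauchy_cvg C.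
  apply: cauchy_exP => e e0.
  have [d d0 [c Hc]] := Hu e e0; exists c; apply/near_normcP; exists d => // w wd Pw.
  by rewrite /ball/= distrC; exact: Hc.
exists m => e e0; move/cvgrPdist_lt: Hm => /(_ e e0)/near_normcP[d d0 Hd].
by exists d => // w Pw wd; rewrite distrC; exact: Hd.
Qed.

(** The reference value [c] may change with [e]: below it is an average of the function over a
    segment that shrinks with [e]. *)
Lemma clim_cauchy (H : R[i] -> R[i]) (x0 : R) :
  (forall e, 0 < e -> exists2 d, 0 < d & exists c : R[i], forall w, Pminus w ->
     normc (w - x0%:C) < d -> normc (H w - c) < e) ->
  exists m, clim Pminus H x0%:C m.
Proof.
move=> HH; have [|a Ha] := @real_limit_Pminus (fun w => Re (H w)) x0.
  move=> e /HH[d d0 [c Hc]]; exists d => //; exists (Re c) => w Pw wd.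
  by rewrite -Re_opp -Re_add; apply: le_lt_trans (normc_Re_le _) (Hc w Pw wd).
have [|b Hb] := @real_limit_Pminus (fun w => Im (H w)) x0.
  move=> e /HH[d d0 [c Hc]]; exists d => //; exists (Im c) => w Pw wd.
  by rewrite -Im_opp -Im_add; apply: le_lt_trans (normc_Im_le _) (Hc w Pw wd).
exists (a +i* b) => e e0; have e20 : 0 < e / 2 by rewrite divr_gt0.
have [d1 d10 H1] := Ha _ e20; have [d2 d20 H2] := Hb _ e20.
exists (Num.min d1 d2) => [|w]; first by rewrite lt_min d10.
rewrite lt_min => /andP[wd1 wd2] Pw; apply: le_lt_trans (normc_le_sum _) _.
by rewrite Re_add Im_add Re_opp Im_opp/= (splitr e) ltrD ?H1 ?H2.
Qed.

End CauchyCriterion.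

(** * The product f p near nonsingular and singular boundary points *)

Section BoundaryBehaviour.
Context {R : realType}.
Variables (F p dp f df : R[i] -> R[i]) (A2 B2 D2 : R).
Hypotheses (Fp : holo F p) (pdp : holo p dp) (cdp : ccont dp).
Hypotheses (fdf : holo f df) (cdf : ccont df).
Let w (z : R[i]) : R[i] := f z * p z.
Let dw (z : R[i]) : R[i] := df z * p z + f z * dp z.
Let q (z : R[i]) : R[i] := f z * dw z.
Hypothesis L2p : forall y a b : R, y < 0 -> a <= b ->
  segint a b (fun x => normc (p (x +i* y)) ^+ 2) <= A2.
Hypothesis L2q : forall y a b : R, y < 0 -> a <= b ->
  segint a b (fun x => normc (q (x +i* y)) ^+ 2) <= B2.
Hypothesis L2df : forall y a b : R, y < 0 -> a <= b ->
  segint a b (fun x => normc (df (x +i* y)) ^+ 2) <= D2.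

Lemma wdw : holo w dw.
Proof. by move=> z Pz; apply: cderM; [exact: fdf|exact: pdp]. Qed.

Lemma cq : ccont q.
Proof.
move=> z Pz; apply: climM; first exact: holo_ccont fdf z Pz.
apply: climD; apply: climM.
- exact: cdf.
- exact: holo_ccont pdp z Pz.
- exact: holo_ccont fdf z Pz.
- exact: cdp.
Qed.

(** Where [w] is near [w0] and [f] near [l], the derivative [p = w / f] of [F] is near [w0 / l], so
    the increment of [F] over the segment determines [w0]. The condition on [eta] keeps [normc f]
    above half of [normc l]. *)
Lemma increment_estimate (x0 d y e1 eta : R) (l w0 : R[i]) : 0 < d -> y < 0 ->
  l != 0 -> eta <= normc l / 2 ->
  (forall t, x0 - d <= t <= x0 + d -> normc (w (t +i* y) - w0) <= e1) ->
  (forall t, x0 - d <= t <= x0 + d -> normc (f (t +i* y) - l) <= eta) ->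
  normc (l * (F ((x0 + d) +i* y) - F ((x0 - d) +i* y)) - (2 * d)%:C * w0) <=
  2 * d * (2 * e1 + 2 * eta * normc w0 / normc l).
Proof.
move=> d0 y0 l0 etal we fe; have a0 : 0 < normc l by rewrite normc_gt0.
have ab : x0 - d <= x0 + d by lra.
pose k t := l * F (t +i* y) - w0 * t%:C.
have kd t : x0 - d <= t <= x0 + d -> vder k t (l * p (t +i* y) - w0 * 1).
  move=> _; have V1 := vderZ l (cder_horizontal (Fp (z := t +i* y) y0)).
  have V2 : vder (fun s => w0 * s%:C) t w0.
    by apply: (vder_eq _ _ (vder_affine 0 w0 t)) => // s; rewrite add0r.
  move: V1 V2 => /vder_is_derive[R1 I1] /vder_is_derive[R2 I2].
  apply/vder_is_derive; rewrite mulr1 /k; split.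
    under eq_fun do rewrite Re_add Re_opp; rewrite Re_add Re_opp.
    by apply: is_deriveB.
  under eq_fun do rewrite Im_add Im_opp; rewrite Im_add Im_opp.
  by apply: is_deriveB.
have bd t : x0 - d <= t <= x0 + d -> normc (l * p (t +i* y) - w0 * 1) <=
    2 * e1 + 2 * eta * normc w0 / normc l.
  move=> tt; have fl := fe t tt.
  have fa : normc l / 2 <= normc (f (t +i* y)).
    by have := ler_normcB l (l - f (t +i* y)); rewrite subKr normc_distC; lra.
  have f0 : f (t +i* y) != 0 by rewrite -normc_gt0; lra.
  have -> : l * p (t +i* y) - w0 * 1 =
    (l * (w (t +i* y) - w0) - w0 * (f (t +i* y) - l)) / f (t +i* y).
    by rewrite /w; field.
  rewrite normcM normcV ler_pdivrMr ?normc_gt0//.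
  apply: le_trans (normcB_le _ _) _; rewrite !normcM.
  have e10 : 0 <= e1 by apply: le_trans (we t tt); exact: normc_ge0.
  have eta0 : 0 <= eta by apply: le_trans fl; exact: normc_ge0.
  have X0 : 0 <= 2 * e1 + 2 * eta * normc w0 / normc l.
    by rewrite addr_ge0 ?mulr_ge0 ?invr_ge0 ?normc_ge0.
  apply: le_trans (ler_wpM2l X0 fa).
  have -> : (2 * e1 + 2 * eta * normc w0 / normc l) * (normc l / 2) = normc l * e1 + normc w0 * eta.
    by field; rewrite gt_eqF.
  by rewrite lerD// ler_wpM2l ?normc_ge0//; exact: we.
have := vder_increment_le_cst ab kd bd; rewrite /k.
rewrite (_ : x0 + d - (x0 - d) = 2 * d); last by ring.
rewrite [X in _ <= X]mulrC; apply: le_trans.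
rewrite le_eqVlt; apply/orP; left; apply/eqP; congr normc.
have -> : (2 * d)%:C = (x0 + d)%:C - (x0 - d)%:C :> R[i].
  by rewrite -raddfB; congr (_%:C); ring.
by ring.
Qed.

(** The error in [increment_estimate] contains the unknown value [w0]. A crude bound on [w] is
    therefore obtained first, and the limit afterwards by using the estimate again with that
    bound. *)
Lemma nonsingular_limit (x0 : R) (l : R[i]) : l != 0 -> clim Pminus f x0%:C l ->
  (forall x : R, clim Pminus F x%:C (F x%:C)) -> exists m, clim Pminus w x0%:C m.
Proof.
move=> l0 fl cF; have a0 : 0 < normc l by rewrite normc_gt0.
have fl' := (clim_halfsquareP f x0 l).1 fl.
have a20 : 0 < normc l / 2 by rewrite divr_gt0.
have [r0 r00 Hr0] := fl' _ a20.
have equi : forall e, 0 < e -> exists2 d, 0 < d & forall x1 x2 y,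
    in_halfsquare x0 d (x1 +i* y) -> in_halfsquare x0 d (x2 +i* y) ->
    normc (w (x1 +i* y) - w (x2 +i* y)) < e.
  apply: (horizontal_equicontinuity (d0 := r0) (c := 2 / normc l) wdw cq _ _ L2q) => //.
    by rewrite divr_ge0// normc_ge0.
  move=> x y h; have fa : normc l / 2 <= normc (f (x +i* y)).
    have := ler_normcB l (l - f (x +i* y)); rewrite subKr normc_distC.
    by have := Hr0 x y h; lra.
  rewrite /q normcM mulrA ler_peMl ?normc_ge0// mulrAC ler_pdivlMr// mul1r.
  by lra.
have hs d e1 x (y : R) : 0 < d -> d < e1 -> - e1 < y < 0 -> x0 - d <= x <= x0 + d ->
    in_halfsquare x0 e1 (x +i* y).
  move=> d0 de y0 /andP[x1 x2]; split => //=.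
  by rewrite ltr_norml; apply/andP; split; lra.
have incr d e : 0 < d -> 0 < e -> exists2 r, 0 < r & forall y, - r < y < 0 ->
   normc ((F ((x0 + d) +i* y) - F ((x0 - d) +i* y)) - (F (x0 + d)%:C - F (x0 - d)%:C)) < e.
  move=> d0 e0; have e20 : 0 < e / 2 by rewrite divr_gt0.
  have [r1 r10 H1] := cF (x0 + d) _ e20; have [r2 r20 H2] := cF (x0 - d) _ e20.
  exists (Num.min r1 r2) => [|y]; first by rewrite lt_min r10.
  move=> /andP[yr y0]; have yr' : - y < Num.min r1 r2 by rewrite ltrNl.
  move: yr'; rewrite lt_min => /andP[yr1 yr2].
  have ny x : normc (x +i* y - x%:C) = - y.
    by rewrite complex_split addrC addKr normcM normci mul1r normc_real ltr0_norm.
  have A1 := H1 ((x0 + d) +i* y); rewrite ny in A1; have {}A1 := A1 yr1 y0.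
  have A3 := H2 ((x0 - d) +i* y); rewrite ny in A3; have {}A3 := A3 yr2 y0.
  rewrite (_ : _ - _ = (F ((x0 + d) +i* y) - F (x0 + d)%:C) -
     (F ((x0 - d) +i* y) - F (x0 - d)%:C)); last by ring.
  by rewrite (le_lt_trans (normcB_le _ _))// (splitr e) ltrD.
(* With [f] within [normc l / 4] of [l] the unknown enters the error as half of its own modulus, and
   is absorbed on the left. *)
have [W [rW rW0 HW]] : exists W : R, exists2 r, 0 < r &
    forall x y, in_halfsquare x0 r (x +i* y) -> normc (w (x +i* y)) <= W.
  have [d1 d10 H1] := equi 1 ltr01.
  have a40 : 0 < normc l / 4 by rewrite divr_gt0.
  have [d2 d20 H2] := fl' _ a40.
  pose d := Num.min d1 d2 / 2.
  have dd0 : 0 < Num.min d1 d2 by rewrite lt_min d10.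
  have d0 : 0 < d by rewrite divr_gt0.
  have [dd1 dd2] : d < d1 /\ d < d2.
    have h1 : Num.min d1 d2 <= d1 by rewrite ge_min lexx.
    have h2 : Num.min d1 d2 <= d2 by rewrite ge_min lexx orbT.
    by rewrite /d; split; lra.
  have [r r_0 Hr] := incr d 1 d0 ltr01.
  pose K := normc l * (normc (F (x0 + d)%:C - F (x0 - d)%:C) + 1).
  exists (2 * (K / (2 * d) + 2)); exists (Num.min d r); first by rewrite lt_min d0.
  move=> x y [/= xd /andP[+ y0]]; rewrite ltrNl lt_min => /andP[yd yr].
  have xd' : x0 - d <= x <= x0 + d.
    by move: xd; rewrite lt_min ltr_norml => /andP[/andP[? ?] _]; apply/andP; split; lra.
  have yd1 : - d1 < y < 0 by apply/andP; split => //; lra.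
  have yd2 : - d2 < y < 0 by apply/andP; split => //; lra.
  have etal : normc l / 4 <= normc l / 2 by lra.
  have := increment_estimate (w0 := w (x +i* y)) d0 y0 l0 etal
    (fun t tt => ltW (H1 t x y (hs _ _ t y d0 dd1 yd1 tt) (hs _ _ x y d0 dd1 yd1 xd')))
    (fun t tt => ltW (H2 t y (hs _ _ t y d0 dd2 yd2 tt))).
  have yr2 : - r < y < 0 by apply/andP; split => //; lra.
  have {}Hr := Hr y yr2.
  set W0 := normc (w _); set De := F _ - F _ in Hr *.
  have -> : 2 * (normc l / 4) * W0 / normc l = W0 / 2 by field; rewrite gt_eqF.
  have : normc ((2 * d)%:C * w (x +i* y)) <= normc (l * De) + normc (l * De - (2 * d)%:C * w (x +i* y)).
    rewrite -[X in normc X <= _](subKr (l * De)); exact: normcB_le.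
  have lDe : normc (l * De) <= K.
    rewrite normcM ler_wpM2l ?normc_ge0//.
    have := ler_normcB De (F (x0 + d)%:C - F (x0 - d)%:C); lra.
  rewrite normcM normc_real gtr0_norm ?mulr_gt0// -/W0 => h1 h2.
  have h3 : 2 * d * W0 <= K + 2 * d * (2 + W0 / 2) by lra.
  have KX : 2 * d * (K / (2 * d)) = K by rewrite mulrC divfK// gt_eqF// mulr_gt0.
  have : 2 * d * W0 <= 2 * d * (K / (2 * d) + (2 + W0 / 2)) by rewrite mulrDr KX.
  rewrite ler_pM2l ?mulr_gt0//.
  by move: (K / (2 * d)) (W0) => X Y; lra.
apply: clim_cauchy => e e0.
pose W' := Num.max W 0.
have W'0 : 0 <= W' by rewrite le_max lexx orbT.
have e80 : 0 < e / 16 by rewrite divr_gt0.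
have [d1 d10 H1] := equi _ e80.
(* Now that [w] is bounded by [W'], the second error term is at most [e / 8]; the oscillation
   [e / 16] of [w] contributes another [e / 8]. *)
pose eta := Num.min (normc l / 2) (e * normc l / (16 * (W' + 1))).
have W1 : 0 < 16 * (W' + 1) by rewrite mulr_gt0// ltr_wpDl.
have eta0 : 0 < eta by rewrite lt_min a20 divr_gt0// mulr_gt0.
have [d2 d20 H2] := fl' _ eta0.
pose d := Num.min (Num.min d1 d2) rW / 2.
have dd0 : 0 < Num.min (Num.min d1 d2) rW by rewrite !lt_min d10 d20.
have d0 : 0 < d by rewrite divr_gt0.
have [dd1 dd2 dd3] : [/\ d < d1, d < d2 & d < rW].
  have h1 : Num.min (Num.min d1 d2) rW <= d1 by rewrite !ge_min lexx.
  have h2 : Num.min (Num.min d1 d2) rW <= d2 by rewrite !ge_min lexx !orbT.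
  have h3 : Num.min (Num.min d1 d2) rW <= rW by rewrite !ge_min lexx !orbT.
  by rewrite /d; split; lra.
have e1 : 0 < e * d / (2 * normc l) by rewrite divr_gt0// mulr_gt0.
have [r r_0 Hr] := incr d _ d0 e1.
exists (Num.min d r); first by rewrite lt_min d0.
pose De0 := F (x0 + d)%:C - F (x0 - d)%:C.
(* The mean of [w] predicted by the boundary increment of [F]; it does not depend on the height. *)
exists (l * De0 / (2 * d)%:C) => -[x y] Pz /(halfsquare_ball Pz)[/= xd /andP[+ y0]].
rewrite ltrNl lt_min => /andP[yd yr].
have xd' : x0 - d <= x <= x0 + d.
  by move: xd; rewrite lt_min ltr_norml => /andP[/andP[? ?] _]; apply/andP; split; lra.
have yd1 : - d1 < y < 0 by apply/andP; split => //; lra.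
have yd2 : - d2 < y < 0 by apply/andP; split => //; lra.
have yd3 : - rW < y < 0 by apply/andP; split => //; lra.
have etal : eta <= normc l / 2 by rewrite ge_min lexx.
have := increment_estimate (w0 := w (x +i* y)) d0 y0 l0 etal
  (fun t tt => ltW (H1 t x y (hs _ _ t y d0 dd1 yd1 tt) (hs _ _ x y d0 dd1 yd1 xd')))
  (fun t tt => ltW (H2 t y (hs _ _ t y d0 dd2 yd2 tt))).
have yr2 : - r < y < 0 by apply/andP; split => //; lra.
have {}Hr := Hr y yr2; rewrite -/De0 in Hr.
have W0W : normc (w (x +i* y)) <= W' by rewrite le_max HW//; exact: hs xd'.
set W0 := normc (w _) in W0W *; set De := F _ - F _ in Hr *.
have sm : 2 * (e / 16) + 2 * eta * W0 / normc l <= e / 4.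
  have h1 : eta <= e * normc l / (16 * (W' + 1)) by rewrite ge_min lexx orbT.
  have h2 : 2 * eta * W0 / normc l <= 2 * (e * normc l / (16 * (W' + 1))) * (W' + 1) / normc l.
    rewrite ler_pM2r ?invr_gt0//; apply: ler_pM.
    - by rewrite mulr_ge0// ltW.
    - exact: normc_ge0.
    - by rewrite ler_pM2l.
    - by rewrite (le_trans W0W)// lerDl.
  have : 2 * (e * normc l / (16 * (W' + 1))) * (W' + 1) / normc l = e / 8.
    by field; rewrite !gt_eqF// ltr_wpDl.
  lra.
have d2C : (2 * d)%:C != 0 :> R[i] by rewrite -normc_eq0 normc_real normr_eq0 gt_eqF// mulr_gt0.
move=> h; have {}h : normc (l * De - (2 * d)%:C * w (x +i* y)) <= 2 * d * (e / 4).
  by apply: le_trans h _; rewrite ler_pM2l ?mulr_gt0.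
have -> : w (x +i* y) - l * De0 / (2 * d)%:C =
   (l * (De - De0) - (l * De - (2 * d)%:C * w (x +i* y))) / (2 * d)%:C.
  by move: d2C (w _); move: (_%:C) => T T_neq0 w0; field.
rewrite normcM normcV normc_real gtr0_norm ?mulr_gt0// ltr_pdivrMr ?mulr_gt0//.
apply: le_lt_trans (normcB_le _ _) _; rewrite normcM.
have : normc l * normc (De - De0) <= normc l * (e * d / (2 * normc l)).
  by rewrite ler_wpM2l ?normc_ge0// ltW.
have -> : normc l * (e * d / (2 * normc l)) = e * d / 2 by field; rewrite gt_eqF.
have : 0 < e * d by rewrite mulr_gt0.
lra.
Qed.

Lemma L2_bound_ge0 (H : R[i] -> R[i]) (B : R) :
  (forall y a b : R, y < 0 -> a <= b -> segint a b (fun x => normc (H (x +i* y)) ^+ 2) <= B) -> 0 <= B.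
Proof.
move=> HB; have [m0 mm] : (-1 < 0 :> R) /\ 0 <= 0 :> R by rewrite ltrN10.
by apply: le_trans (HB (-1) 0 0 m0 mm); apply: segint_ge0 => x _; exact: sqr_ge0.
Qed.

Lemma square_equicontinuity (x0 e : R) : 0 < e -> exists2 d, 0 < d & forall x1 x2 y,
  in_halfsquare x0 d (x1 +i* y) -> in_halfsquare x0 d (x2 +i* y) ->
  normc (w (x1 +i* y) * w (x1 +i* y) - w (x2 +i* y) * w (x2 +i* y)) < e.
Proof.
move=> e0; have B0 : 0 <= B2 by exact: L2_bound_ge0 L2q.
(* The weight [s] is fixed by the bound on [q] alone; equi-integrability then provides a segment on
   which the energy of [p] is below [e * s / 4]. *)
have [s sE] : exists s : R, s = e / (4 * (B2 + 1)) by eexists.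
have s0 : 0 < s by rewrite sE divr_gt0// mulr_gt0// ltr_wpDl.
have es0 : 0 < e * s / 4 by rewrite divr_gt0// mulr_gt0.
have [d d0 Hd] := hardy_equiintegrable pdp cdp L2p x0 es0.
exists d => // x1 x2 y; wlog x12 : x1 x2 / x2 <= x1.
  move=> W h1 h2; case: (leP x2 x1) => [|/ltW] x12; first exact: W.
  by rewrite normc_distC; exact: W.
move=> [/= h1 /andP[y1 y2]] [/= h2 _].
have cp2 : continuous (fun x => normc (p (x +i* y)) ^+ 2) by exact: ccont_sqr_line (holo_ccont pdp) y2.
have cq2 : continuous (fun x => normc (q (x +i* y)) ^+ 2) by exact: ccont_sqr_line cq y2.
pose phi x := s^-1 * normc (p (x +i* y)) ^+ 2 + s * normc (q (x +i* y)) ^+ 2.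
have cphi : continuous phi by apply: continuous_addf; exact: continuous_mulcf.
have HG : holo (fun z => w z * w z) (fun z => dw z * w z + w z * dw z).
  by move=> z Pz; apply: cderM; exact: wdw.
have Dphi x : x2 <= x <= x1 -> normc (dw (x +i* y) * w (x +i* y) + w (x +i* y) * dw (x +i* y)) <= phi x.
  move=> _; have -> : dw (x +i* y) * w (x +i* y) + w (x +i* y) * dw (x +i* y) =
     2%:C * (p (x +i* y) * q (x +i* y)).
    by rewrite (_ : 2%:C = 1 + 1 :> R[i]) ?/w ?/q ?raddfD//; ring.
  rewrite (normcM 2%:C) (normcM (p _) (q _)) normc_real gtr0_norm// /phi.
  move: (normc (p _)) (normc (q _)) => a b.
  have := sqr_ge0 (a - s * b); rewrite sqrrB => K.
  have : 0 <= s^-1 * (a ^+ 2 - a * (s * b) *+ 2 + (s * b) ^+ 2) by rewrite mulr_ge0// invr_ge0 ltW.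
  rewrite (_ : s^-1 * _ = s^-1 * a ^+ 2 - (a * b) *+ 2 + s * b ^+ 2); last by field; rewrite gt_eqF.
  by rewrite -mulr_natl; lra.
apply: le_lt_trans (line_increment_le HG y2 x12 cphi Dphi) _.
rewrite segintD; [|exact: continuous_mulcf|exact: continuous_mulcf].
rewrite !segintZ//.
have yd : - d < y < 0 by rewrite y1.
have [xl xr] : x0 - d <= x2 /\ x1 <= x0 + d.
  by move: h1 h2; rewrite !ltr_norml => /andP[? ?] /andP[? ?]; split; lra.
have P : segint x2 x1 (fun x => normc (p (x +i* y)) ^+ 2) <= e * s / 4.
  apply: le_trans (Hd y yd); apply: segint_subset => // x _; exact: sqr_ge0.
have Q := L2q y2 x12.
have {}P : s^-1 * segint x2 x1 (fun x => normc (p (x +i* y)) ^+ 2) <= e / 4.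
  by rewrite mulrC ler_pdivrMr// mulrAC.
have {}Q : s * segint x2 x1 (fun x => normc (q (x +i* y)) ^+ 2) <= e / 4.
  apply: (@le_trans _ _ (s * (B2 + 1))); first by rewrite ler_pM2l// (le_trans Q)// lerDl.
  by rewrite le_eqVlt sE; apply/orP; left; apply/eqP; field; rewrite gt_eqF// ltr_wpDl.
lra.
Qed.

(** AM-GM with weight [sqrt (x - x0)] on the derivative of [f]. The Hölder exponent 1/2 makes the
    square of [f] grow at most linearly, the borderline case in which its reciprocal is not
    integrable. *)
Lemma holder_line (x0 x y : R) : y < 0 -> x0 < x ->
  normc (f (x +i* y)) <= normc (f (x0 +i* y)) + (D2 + 1) / 2 * Num.sqrt (x - x0).
Proof.
move=> y0 x0x; have [s sE] : exists s : R, s = Num.sqrt (x - x0) by eexists.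
have s0 : 0 < s by rewrite sE sqrtr_gt0 subr_gt0.
have ss : s ^+ 2 = x - x0 by rewrite sE sqr_sqrtr// subr_ge0 ltW.
have cf2 : continuous (fun x => normc (df (x +i* y)) ^+ 2) by exact: ccont_sqr_line cdf y0.
have csq : continuous (fun x => s * normc (df (x +i* y)) ^+ 2 + s^-1).
  by apply: continuous_addf; [exact: continuous_mulcf|exact: cst_continuous].
have Dphi t : x0 <= t <= x -> normc (df (t +i* y)) <= 2^-1 * (s * normc (df (t +i* y)) ^+ 2 + s^-1).
  move=> _; set a := normc _.
  have := sqr_ge0 (s * a - 1); rewrite sqrrB mulr1 expr1n => K.
  have : 0 <= s^-1 * ((s * a) ^+ 2 - (s * a) *+ 2 + 1) by rewrite mulr_ge0// invr_ge0 ltW.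
  rewrite (_ : s^-1 * _ = s * a ^+ 2 - a *+ 2 + s^-1); last by field; rewrite gt_eqF.
  by rewrite -mulr_natl; lra.
have cphi : continuous (fun t => 2^-1 * (s * normc (df (t +i* y)) ^+ 2 + s^-1)).
  exact: continuous_mulcf.
have := line_increment_le fdf y0 (ltW x0x) cphi Dphi.
rewrite segintZ// segintD; [|exact: continuous_mulcf|exact: cst_continuous].
rewrite segintZ// (segint_cst _ (ltW x0x)) -sE -ss.
have := L2df y0 (ltW x0x); move: (segint _ _ _) => I ID.
rewrite (_ : s^-1 * s ^+ 2 = s); last by field; rewrite gt_eqF.
have : s * I <= s * D2 by rewrite ler_pM2l.
have := ler_normcB (f (x +i* y)) (f (x0 +i* y)).
by lra.
Qed.

(* [|p|^2 = |w^2| / |f|^2] and [|f|^2 = O(x - x0)] up to an error that vanishes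
   at the boundary: by the logarithmic divergence of [1 / (x - x0)], a uniform
   L^2 bound on p forces w^2 to be small somewhere near x0. *)
Lemma small_somewhere (x0 d c : R) : 0 < d -> 0 < c -> clim Pminus f x0%:C 0 ->
  exists2 r, 0 < r & forall y, - r < y < 0 -> exists2 x, x0 < x < x0 + d &
    normc (w (x +i* y) * w (x +i* y)) < c.
Proof.
move=> d0 c0 f0; pose K : R := (D2 + 1) / 2.
have D0 : 0 <= D2 by exact: L2_bound_ge0 L2df.
have K0 : 0 < K by rewrite divr_gt0// ltr_wpDl.
pose k2 : R := 2 * K ^+ 2; have k20 : 0 < k2 by rewrite mulr_gt0// exprn_gt0.
(* Chosen with [kap = k2 * h / E] below: the logarithm of [k2 * h / kap] is [ln E], and
   [c / k2 * ln E = A2 + 1] exceeds the bound [A2] on the energy of [p]. *)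
pose E := expR (k2 * (A2 + 1) / c); have E0 : 0 < E by exact: expR_gt0.
pose h := d / 2; have h0 : 0 < h by rewrite divr_gt0.
pose kap : R := k2 * h / E; have kap0 : 0 < kap by rewrite divr_gt0// mulr_gt0.
have sk : 0 < Num.sqrt (kap / 2) by rewrite sqrtr_gt0 divr_gt0.
have [r r0 Hr] := (clim_halfsquareP f x0 0).1 f0 _ sk.
exists r => // y /andP[yr y0].
have fx0 : normc (f (x0 +i* y)) ^+ 2 <= kap / 2.
  have := Hr x0 y; rewrite subr0 => H; have /ltW {}H : normc (f (x0 +i* y)) < Num.sqrt (kap / 2).
    by apply: H; split => /=; [rewrite subrr normr0|rewrite yr].
  have kap2 : 0 <= kap / 2 by rewrite divr_ge0// ltW.
  rewrite -(sqr_sqrtr kap2).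
  by apply: lerXn2r; rewrite ?nnegrE ?normc_ge0 ?sqrtr_ge0.
have f2 x : x0 <= x -> normc (f (x +i* y)) ^+ 2 <= kap + k2 * (x - x0).
  rewrite le_eqVlt => /predU1P[x0x|xx].
    by rewrite -x0x subrr mulr0 addr0 (le_trans fx0)//; move: kap0; lra.
  have := holder_line y0 xx; rewrite -/K => H.
  have S : Num.sqrt (x - x0) ^+ 2 = x - x0 by rewrite sqr_sqrtr// subr_ge0 ltW.
  move: (Num.sqrt (x - x0)) (sqrtr_ge0 (x - x0)) H S => s s0 H S.
  have : normc (f (x +i* y)) ^+ 2 <= (normc (f (x0 +i* y)) + K * s) ^+ 2.
    by apply: lerXn2r; rewrite ?nnegrE ?normc_ge0// addr_ge0 ?normc_ge0// mulr_ge0// ltW.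
  have := sqr_ge0 (normc (f (x0 +i* y)) - K * s).
  rewrite sqrrB sqrrD exprMn S /k2; move: fx0; lra.
apply: contrapT => H.
have big x : x0 < x < x0 + d -> c <= normc (w (x +i* y) * w (x +i* y)).
  by move=> xx; rewrite leNgt; apply/negP => wc; apply: H; exists x.
have cp2 : continuous (fun x => normc (p (x +i* y)) ^+ 2) by exact: ccont_sqr_line (holo_ccont pdp) y0.
have [P HP] := continuous_primitive (x0 - 1) cp2.
have den x : x0 <= x -> 0 < kap + k2 * (x - x0).
  by move=> xx; rewrite ltr_wpDr// mulr_ge0 ?subr_ge0// ltW.
(* Primitive of [c] over the bound [f2] on the square of [f]: if [w ^ 2] were nowhere below [c] in
   modulus, the energy of [p] would grow at least as fast as [Phi]. *)
pose Phi x := c / k2 * ln (kap + k2 * (x - x0)).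
have HPhi x : x0 <= x -> is_derive x 1 Phi (c / (kap + k2 * (x - x0))).
  move=> xx; have D1 : is_derive x 1 (fun x => kap + k2 * (x - x0)) (0 + k2 * (1 - 0)).
    apply: is_deriveD; apply: is_derive_mull; exact: is_deriveB.
  have D3 := @is_derive1_comp R (@ln R) (fun x => kap + k2 * (x - x0)) x _ _ (is_derive1_ln (den x xx)) D1.
  have := is_derive_mull (c / k2) D3; rewrite /comp.
  rewrite (_ : c / k2 * _ = c / (kap + k2 * (x - x0)))// /GRing.scale/=.
  by field; rewrite !gt_eqF ?den.
have xh : x0 <= x0 + h by rewrite lerDl ltW.
have mono : P x0 - Phi x0 <= P (x0 + h) - Phi (x0 + h).
  have HD x : x0 <= x <= x0 + h -> is_derive x 1 (fun x => P x - Phi x)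
      (normc (p (x +i* y)) ^+ 2 - c / (kap + k2 * (x - x0))).
    move=> /andP[x1 _]; apply: is_deriveB; last exact: HPhi.
    by apply: HP; lra.
  apply: (is_derive_nondecreasing (u := fun x => P x - Phi x)
     (v := fun x => normc (p (x +i* y)) ^+ 2 - c / (kap + k2 * (x - x0))) xh).
  - by move=> x /andP[/ltW x1 /ltW x2]; apply: HD; rewrite x1.
  - move=> x /andP[x1 x2]; rewrite subr_ge0 ler_pdivrMr; last by apply: den; exact: ltW.
    have xd : x0 < x < x0 + d by rewrite x1 (lt_trans x2)// ltrD2l /h; lra.
    apply: le_trans (big x xd) _.
    have -> : normc (w (x +i* y) * w (x +i* y)) = normc (p (x +i* y)) ^+ 2 * normc (f (x +i* y)) ^+ 2.
      by rewrite /w !normcM; ring.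
    by apply: ler_wpM2l; [exact: sqr_ge0|apply: f2; exact: ltW].
  - exact: is_derive_within HD.
have PE : segint x0 (x0 + h) (fun x => normc (p (x +i* y)) ^+ 2) = P (x0 + h) - P x0.
  by apply: segint_FTC => // x /andP[x1 _]; apply: HP; lra.
have := L2p y0 xh; rewrite PE => PA.
have lnE : ln (kap + k2 * h) - ln kap >= k2 * (A2 + 1) / c.
  have den_h : 0 < kap + k2 * h by have := den _ xh; rewrite (addrC x0) addrK.
  have E1 : k2 * (A2 + 1) / c = ln E by rewrite /E expRK.
  have E2 : ln (kap + k2 * h) - ln kap = ln ((kap + k2 * h) / kap) by rewrite ln_div ?posrE.
  have dq : 0 < (kap + k2 * h) / kap by rewrite divr_gt0.
  rewrite E1 E2 ler_ln ?posrE//.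
  by rewrite ler_pdivlMr// {1}/kap mulrC divfK ?gt_eqF// lerDr ltW.
have : Phi (x0 + h) - Phi x0 >= A2 + 1.
  rewrite /Phi subrr mulr0 addr0 (addrC x0) addrK -mulrBr.
  have := ler_wpM2l (ltW (divr_gt0 c0 k20)) lnE.
  by rewrite (_ : c / k2 * (k2 * (A2 + 1) / c) = A2 + 1)//; field; rewrite !gt_eqF.
move: mono PA; lra.
Qed.

(** The smallness and the equicontinuity of the square hold on the same line at the same height, so
    one small value controls the whole segment. *)
Lemma singular_limit (x0 : R) : clim Pminus f x0%:C 0 -> clim Pminus w x0%:C 0.
Proof.
move=> f0; apply/clim_halfsquareP => e e0.
have e20 : 0 < e ^+ 2 / 2 by rewrite divr_gt0// exprn_gt0.
have [d d0 Hd] := square_equicontinuity x0 e20.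
have [r r0 Hr] := small_somewhere d0 e20 f0.
exists (Num.min d r) => [|x y [/= xd /andP[yd y0]]]; first by rewrite lt_min d0.
have [xd' yd' yr'] : [/\ `|x - x0| < d, - d < y & - r < y].
  move: xd yd; rewrite ltrNl !lt_min => /andP[? _] /andP[? ?]; split => //; lra.
have yr2 : - r < y < 0 by rewrite yr'.
have [x1 /andP[x1l x1r] wx1] := Hr y yr2.
have h1 : in_halfsquare x0 d (x +i* y) by split => //=; rewrite yd'.
have h2 : in_halfsquare x0 d (x1 +i* y).
  by split => /=; [rewrite ltr_norml; apply/andP; split; lra|rewrite yd'].
have := Hd x x1 y h1 h2.
have := ler_normcB (w (x +i* y) * w (x +i* y)) (w (x1 +i* y) * w (x1 +i* y)).
rewrite subr0 => A B; have : normc (w (x +i* y) * w (x +i* y)) < e ^+ 2 by lra.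
by rewrite normcM -expr2 ltr_sqr ?nnegrE ?normc_ge0// ltW.
Qed.

End BoundaryBehaviour.

(** * Consequences of the energy bound *)

Section Extension.
Context {R : realType}.
Implicit Types (g H D : R[i] -> R[i]) (z l : R[i]).

Lemma Pminus_cl z : Pminus z -> clPminus z.
Proof. by rewrite /Pminus /clPminus/=; exact: ltW. Qed.

Lemma clPminus_real (x : R) : clPminus x%:C.
Proof. by rewrite /clPminus/=. Qed.

Lemma clim_open D z l : Pminus z -> clim Pminus D z l -> clim setT D z l.
Proof.
move=> Pz Dl e e0; have [d d0 Hd] := Dl e e0.
exists (Num.min d (- Im z)) => [|w]; first by rewrite lt_min d0 oppr_gt0.
by rewrite lt_min => /andP[wd wz] _; apply: Hd => //; exact: Pminus_ball wz.
Qed.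

Lemma ext_limit g z l : clPminus z -> clim Pminus g z l -> ext g z = l.
Proof.
move=> Pz /climP gl; have PF := Pminus_proper Pz.
by rewrite /ext; apply: (cvg_lim _ gl); exact: norm_hausdorff.
Qed.

Lemma ext_interior g z : Pminus z -> clim setT g z (g z) -> ext g z = g z.
Proof.
move=> Pz gz; apply: ext_limit; first exact: Pminus_cl.
by apply: clim_sub gz => w.
Qed.

Lemma ext_cont g : (forall z, clPminus z -> exists l, clim Pminus g z l) ->
  forall z, clPminus z -> clim clPminus (ext g) z (ext g z).
Proof.
move=> gl z Pz e e0; have [l Hl] := gl z Pz; rewrite (ext_limit Pz Hl).
have e20 : 0 < e / 2 by rewrite divr_gt0.
have [d d0 Hd] := Hl _ e20; exists d => // v vd Pv.
have [m Hm] := gl v Pv; rewrite (ext_limit Pv Hm).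
have [d' d'0 Hd'] := Hm _ e20.
have PF := Pminus_proper Pv.
have vd0 : 0 < d - normc (v - z) by rewrite subr_gt0.
(* [v] may lie on the boundary, so the comparison passes through a point of P_- close to [v], where
   [g] itself can be used. *)
have [w [Pw wv wd']] : exists w, [/\ Pminus w, normc (w - v) < d - normc (v - z) & normc (w - v) < d'].
  have N : \forall w \near within Pminus (nbhs (v : R[i]^o)),
      [/\ Pminus w, normc (w - v) < d - normc (v - z) & normc (w - v) < d'].
    apply/near_normcP; exists (Num.min (d - normc (v - z)) d'); first by rewrite lt_min vd0.
    by move=> w; rewrite lt_min => /andP[].
  exact: (@filter_ex _ _ PF _ N).
have wz : normc (w - z) < d.
  by rewrite (le_lt_trans (normc_dist_triangle _ v _))// -ltrBrDr.
rewrite (le_lt_trans (normc_dist_triangle _ (g w) _))// (splitr e) ltrD//.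
  by rewrite normc_distC; exact: Hd'.
exact: Hd.
Qed.

Lemma extends_continuously_limits g :
  (forall z, Pminus z -> clim setT g z (g z)) ->
  (forall x : R, exists l, clim Pminus g x%:C l) -> extends_continuously g.
Proof.
move=> gc gl; exists (ext g); split; last by move=> z Pz; exact/ext_interior/gc.
have gl' z : clPminus z -> exists l, clim Pminus g z l.
  rewrite /clPminus/= le_eqVlt => /predU1P[z0|z0].
    have -> : z = (Re z)%:C by case: z z0 => a b /= ->.
    exact: gl.
  by exists (g z); apply: clim_sub (gc z z0) => w.
apply/subspace_continuousP => z Pz; apply/climP.
exact: (ext_cont gl').
Qed.

End Extension.

(** * Complex derivatives extracted from the regularity hypotheses *)

Section Regularity.
Context {R : realType}.
Implicit Types (g H D : R[i] -> R[i]) (z l : R[i]) (T : R).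

Lemma half_contP T (A : set R[i]) (f : R[i] -> R -> R[i]) : half_cont T A f ->
  forall z t, A z -> timeI T t -> forall e, 0 < e -> exists2 d, 0 < d &
    forall w s, A w -> timeI T s -> normc (w - z) < d -> `|s - t| < d ->
    normc (f w s - f z t) < e.
Proof.
move=> /subspace_continuousP fc z t Az Tt e e0.
have H := fc (z, t) (conj Az Tt).
have FF := @within_filter _ (A `*` timeI T) _ (nbhs_filter ((z, t) : R[i]^o * R)).
have /= := (cvg_normcP FF _ _).1 H e e0; rewrite /within/=.
case=> -[P Q] /= [/nbhs_normcP[d1 d10 H1] /near_realP[d2 d20 H2]] PQ.
exists (Num.min d1 d2) => [|w s Aw Ts]; first by rewrite lt_min d10.
rewrite !lt_min => /andP[w1 _] /andP[_ s2].
by apply: (PQ (w, s)); split => //=; [exact: H1|exact: H2].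
Qed.

Lemma half_cont_clim T (A : set R[i]) (f : R[i] -> R -> R[i]) t z :
  half_cont T A f -> timeI T t -> A z -> clim A (f^~ t) z (f z t).
Proof.
move=> fc Tt Az e e0; have [d d0 Hd] := half_contP fc Az Tt e0.
by exists d => // w wd Aw; apply: Hd => //; rewrite subrr normr0.
Qed.

Lemma derive1_is_derive (u : R -> R) (x l : R) : is_derive x 1 u l -> derive1 u x = l.
Proof. by move=> ?; rewrite derive1E derive_val. Qed.

(** At an interior point the restricted difference quotient has the ordinary limit; properness of
    the restricted filter is what makes [lim] return it. *)
Lemma derive_in_is_derive (A : set R) (u : R -> R) (x l : R) :
  (\forall s \near (0 : R), A (x + s)) -> is_derive x 1 u l ->
  derivable_in A u x /\ derive_in A u x = l.
Proof.
move=> nA ul; have L : s^-1 * (u (x + s) - u x) @[s --> within [set s | A (x + s)] 0^'] --> l.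
  have d1 : derivable u x 1 by exact: ex_derive.
  have D1 : 'D_1 u x = l by rewrite derive_val.
  have : s^-1 *: (u (s *: 1 + x) - u x) @[s --> 0^'] --> l.
    by rewrite -D1; exact: d1.
  move=> H; apply: cvg_within_filter.
  have -> // : (fun s => s^-1 * (u (x + s) - u x)) = (fun s => s^-1 *: (u (s *: 1 + x) - u x)).
  by apply/funext => s; rewrite /GRing.scale/= mulr1 (addrC s).
have PF : ProperFilter (within [set s | A (x + s)] 0^').
  apply: Build_ProperFilter_ex => P; rewrite /within/= => /near_realP[d d0 Hd].
  move: nA => /near_realP[d' d'0 Hd'].
  have m0 : 0 < Num.min d d' / 2 by rewrite divr_gt0// lt_min d0.
  have md : Num.min d d' / 2 < Num.min d d' by rewrite ltr_pdivrMr// ltr_pMr ?ltr1n// lt_min d0.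
  exists (Num.min d d' / 2); move: md; rewrite lt_min => /andP[md md'].
  apply: Hd; rewrite ?subr0 ?gtr0_norm ?gt_eqF//=.
  by apply: Hd'; rewrite subr0 gtr0_norm.
split; first by apply/cvg_ex; exists l.
by rewrite /derive_in; apply: (cvg_lim _ L); exact: norm_hausdorff.
Qed.

Lemma cder_dx g z l : cder g z l -> dx g z = l.
Proof.
case: z => x y gl; have := cder_horizontal gl => /vder_is_derive[R1 I1].
rewrite /dx /cderive/= (derive1_is_derive R1) (derive1_is_derive I1).
by case: l {gl R1 I1}.
Qed.

Lemma cder_dy g z l : Pminus z -> cder g z l -> dy g z = l * 'i.
Proof.
case: z => x y; rewrite /Pminus/= => y0 gl; have := cder_vertical gl => /vder_is_derive[R1 I1].
have nA : \forall s \near (0 : R), [set y | y <= 0] (y + s).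
  apply/near_realP; exists (- y); rewrite ?oppr_gt0// => s; rewrite subr0 ltr_norml => /andP[_ ?] /=.
  by lra.
rewrite /dy /cderive_in/= (derive_in_is_derive nA R1).2 (derive_in_is_derive nA I1).2.
by case: (l * 'i).
Qed.

Lemma cder_dz g z l : Pminus z -> cder g z l -> dz g z = l.
Proof.
move=> Pz gl; rewrite /dz /dminus (cder_dx gl) (cder_dy Pz gl).
have ii : 'i * 'i = -1 :> R[i] by rewrite -expr2 sqr_i.
by rewrite mulrCA ii mulrN1 opprK -mulr2n -[l *+ 2]mulr_natl mulKf// pnatr_eq0.
Qed.

Lemma holomorphic_cder g z : holomorphic g -> Pminus z -> cder g z (dz g z).
Proof.
move=> gh Pz; have gd := gh z Pz.
have /cder_derivable gl := conj gd (erefl ('D_1 (g : R[i]^o -> R[i]^o) z)).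
by rewrite (cder_dz Pz gl).
Qed.

(** Continuity of the complex derivative, which [holo_derivative] takes as a hypothesis: the assumed
    C^1 regularity stands in for Goursat's theorem. *)
Lemma half_C1_ccont T f t : half_Cn T Pminus 1 f -> timeI T t -> ccont (dz (f^~ t)).
Proof.
move=> [_ [_ [Hx _] [Hy _] _]] Tt z Pz; apply: (clim_open Pz).
apply: climM; first exact: clim_cst.
apply: climD; first exact: (half_cont_clim Hx Tt Pz).
apply/climN/climM; first exact: clim_cst.
exact: (half_cont_clim Hy Tt Pz).
Qed.

End Regularity.

(** * From finite energy to L^2 bounds on segments *)

Section EnergyBounds.
Context {R : realType}.
Implicit Types (g : R[i] -> R[i]).

Lemma sqr_L2normE (u : R -> R[i]) :
  (L2norm u ^+ 2 = \int[lebesgue_measure]_x (normc (u x) ^+ 2)%:E)%E.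
Proof.
have -> : (L2norm u ^+ 2 = L2norm u `^ 2)%E.
  rewrite /L2norm; move: (Lnorm_ge0 lebesgue_measure 2%:E (fun x => (normc (u x))%:E)).
  case: (Lnorm _ _ _) => [r| |] // r0.
    by rewrite poweR_EFin powR_mulrn// EFin_expe.
  by rewrite poweRyr ?pnatr_eq0.
rewrite /L2norm poweR_Lnorm ?pnatr_eq0//; apply: eq_integral => x _.
by rewrite /= ger0_norm ?normc_ge0// powR_mulrn ?normc_ge0.
Qed.

Lemma L2norm_segint (u : R -> R[i]) (M a b : R) : (L2norm u ^+ 2 <= M%:E)%E -> a <= b ->
  continuous (fun x => normc (u x) ^+ 2) -> segint a b (fun x => normc (u x) ^+ 2) <= M.
Proof.
rewrite sqr_L2normE => uM ab cu; rewrite -lee_fin /segint /Rintegral fineK; last first.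
  exact/integrable_fin_num/segint_integrable.
apply: le_trans uM; apply: ge0_subset_integral => //.
- by apply/measurable_EFinP; exact: continuous_measurable_fun.
- by move=> x _; rewrite lee_fin sqr_ge0.
Qed.

Lemma sup_heights_bound (N : (R -> R[i]) -> \bar R) g : (forall u, (0 <= N u)%E) ->
  (sup_heights N g < +oo)%E -> exists M : R, forall y, y < 0 -> (N (fun x => g (x +i* y)) <= M%:E)%E.
Proof.
move=> N0 gN; have sg : (0 <= sup_heights N g)%E.
  apply: le_trans (N0 (fun x => g (x +i* (-1)))) _; apply: ereal_sup_ubound.
  by exists (-1) => //=; rewrite ltrN10.
exists (fine (sup_heights N g)) => y y0; rewrite fineK ?ge0_fin_numE//.
by apply: ereal_sup_ubound; exists y.
Qed.

End EnergyBounds.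

Section EnergyFinite.
Context {R : realType}.

Lemma adde_ge0_lty (x y : \bar R) : (0 <= x)%E -> (0 <= y)%E -> (x + y < +oo)%E ->
  (x < +oo)%E /\ (y < +oo)%E.
Proof. by case: x => [x| |]; case: y => [y| |] //= _ _; rewrite !ltry. Qed.

Lemma sqre_ge0 (x : \bar R) : (0 <= x)%E -> (0 <= x ^+ 2)%E.
Proof. by move=> x0; rewrite expe2 mule_ge0. Qed.

Lemma sup_heights_ge0 (N : (R -> R[i]) -> \bar R) (g : R[i] -> R[i]) :
  (forall u, (0 <= N u)%E) -> (0 <= sup_heights N g)%E.
Proof.
move=> N0; apply: le_trans (N0 (fun x => g (x +i* (-1)))) _; apply: ereal_sup_ubound.
by exists (-1) => //=; rewrite ltrN10.
Qed.

Lemma energy_L2_bounds (F Psi : R[i] -> R[i]) : (energy F Psi < +oo)%E ->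
  let q := invd Psi in let w z := q z * dz F z in
  exists M1 M2 M3 : R, forall y, y < 0 ->
  [/\ (L2norm (fun x => dz F (x +i* y)) ^+ 2 <= M1%:E)%E,
      (L2norm (fun x => (q (x +i* y) * dz w (x +i* y))%R) ^+ 2 <= M2%:E)%E &
      (L2norm (fun x => dz q (x +i* y)) ^+ 2 <= M3%:E)%E].
Proof.
move=> en q w.
have L2 u : (0 <= L2norm (R := R) u ^+ 2)%E by exact/sqre_ge0/Lnorm_ge0.
have Li u : (0 <= Linfnorm (R := R) u ^+ 2)%E by exact/sqre_ge0/Lnorm_ge0.
have Hh u : (0 <= Hhalfnorm (R := R) u ^+ 2)%E.
  by apply/sqre_ge0/le_ereal_inf_tmp => _ [v _ <-]; exact: Lnorm_ge0.
move: en; rewrite /energy -/q.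
have S N g := @sup_heights_ge0 N g.
(* The sum associates to the left, so its terms come off from the last one; the sixth, third and
   first are kept. *)
move=> /adde_ge0_lty[|| + _]; [|exact: S|]; first by rewrite !adde_ge0 ?S.
move=> /adde_ge0_lty[|| + E6]; [|exact: S|]; first by rewrite !adde_ge0 ?S.
move=> /adde_ge0_lty[|| + _]; [|exact: S|]; first by rewrite !adde_ge0 ?S.
move=> /adde_ge0_lty[|| + _]; [|exact: S|]; first by rewrite !adde_ge0 ?S.
move=> /adde_ge0_lty[|| + E3]; [|exact: S|]; first by rewrite !adde_ge0 ?S.
move=> /adde_ge0_lty[|| E1 _]; [exact: S|exact: S|].
have [M1 H1] := sup_heights_bound L2 E1.
have [M2 H2] := sup_heights_bound L2 E3.
have [M3 H3] := sup_heights_bound L2 E6.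
by exists M1, M2, M3 => y y0; split; [exact: H1|exact: H2|exact: H3].
Qed.

End EnergyFinite.

(** * Boundary values of [DF] and [DFbar] at a fixed time *)

Section FixedTime.
Context {R : realType}.
Variables (T : R) (U : wave R) (t : R).
Hypotheses (Tt : timeI T t) (WW : water_wave T U) (WR : wave_regularity T U).

Lemma Psiz_neq0 z : Pminus z -> Psiz U z t != 0.
Proof. by move=> Pz; apply/eqP; exact: (ww_conf WW Tt).2. Qed.

Lemma Fz_cder z : Pminus z -> cder ((wF U)^~ t) z (Fz U z t).
Proof. by move=> Pz; exact: (holomorphic_cder (ww_holo WW Tt) Pz). Qed.

Lemma Psiz_cder z : Pminus z -> cder ((wPsi U)^~ t) z (Psiz U z t).
Proof. by move=> Pz; exact: (holomorphic_cder (ww_conf WW Tt).1 Pz). Qed.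

Lemma Fz_cont : ccont ((Fz U)^~ t).
Proof. exact: half_C1_ccont (wr_F_C1 WR) Tt. Qed.

Lemma Psiz_cont : ccont ((Psiz U)^~ t).
Proof. exact: half_C1_ccont (wr_Psi_C1 WR) Tt. Qed.

Lemma iPsiz_cont : ccont ((iPsiz U)^~ t).
Proof. by move=> z Pz; apply: climV; [exact: Psiz_neq0|exact: Psiz_cont]. Qed.

Lemma extT_iPsiz z : Pminus z -> extT (iPsiz U) z t = iPsiz U z t.
Proof. by move=> Pz; apply: ext_interior => //; exact: iPsiz_cont. Qed.

Lemma iPsiz_limit (x : R) : clim Pminus ((iPsiz U)^~ t) x%:C (extT (iPsiz U) x%:C t).
Proof.
have := half_cont_clim (wr_iPsiz_cont WR) Tt (clPminus_real x).
move=> /(clim_sub (@Pminus_cl R)); apply: clim_eq => w; exact: extT_iPsiz.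
Qed.

Lemma F_limit (x : R) : clim Pminus ((wF U)^~ t) x%:C (wF U x%:C t).
Proof.
have := half_cont_clim (wr_F_cont WR) Tt (clPminus_real x).
exact: clim_sub (@Pminus_cl R).
Qed.

Lemma DF_cont : ccont ((DF U)^~ t).
Proof. by move=> z Pz; apply: climM; [exact: iPsiz_cont|exact: Fz_cont]. Qed.

Lemma DFbar_cont : ccont ((DFbar U)^~ t).
Proof. by move=> z Pz; apply: climM; [exact: iPsiz_cont|apply: clim_conj; exact: Fz_cont]. Qed.

Lemma normc_DFbar z : normc (DFbar U z t) = normc (DF U z t).
Proof. by rewrite /DFbar /DF normcM normc_conj -normcM. Qed.

(** [DFbar] is not holomorphic, so its limits are deduced: at singular points from having the same
    modulus as [DF], at nonsingular points from a limit of [Fz] itself, obtained on dividing the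
    limit of [DF] by the nonzero value of 1/Psi_z'. *)
Lemma DF_boundary (x : R) :
  (extT (iPsiz U) x%:C t = 0 -> clim Pminus ((DF U)^~ t) x%:C 0) /\
  (extT (iPsiz U) x%:C t <> 0 -> exists m, clim Pminus ((Fz U)^~ t) x%:C m).
Proof.
have [dp [pdp cdp]] := holo_derivative Fz_cder Fz_cont.
have [dPz [PzdPz cdPz]] := holo_derivative Psiz_cder Psiz_cont.
pose f := (iPsiz U)^~ t; pose p := (Fz U)^~ t.
pose df z := - dPz z / Psiz U z t ^+ 2.
have fdf : holo f df.
  by move=> z Pz; apply: cderV; [exact: Psiz_neq0|exact: PzdPz].
have cdf : ccont df.
  move=> z Pz; apply: climM; first by apply: climN; exact: cdPz.
  apply: climV; first by rewrite expf_neq0// Psiz_neq0.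
  by rewrite expr2; apply: climM; exact: Psiz_cont.
have [M1 [M2 [M3 HM]]] := energy_L2_bounds (wr_energy WR Tt).
have L2p (y a b : R) : y < 0 -> a <= b -> segint a b (fun x => normc (p (x +i* y)) ^+ 2) <= M1.
  move=> y0 ab; have [B1 _ _] := HM y y0; apply: (L2norm_segint B1 ab).
  exact: ccont_sqr_line Fz_cont y0.
have L2df (y a b : R) : y < 0 -> a <= b -> segint a b (fun x => normc (df (x +i* y)) ^+ 2) <= M3.
  move=> y0 ab; have [_ _ B3] := HM y y0.
  apply: L2norm_segint ab (ccont_sqr_line cdf y0); apply: le_trans B3.
  rewrite le_eqVlt; apply/orP; left; apply/eqP; congr (_ ^+ 2)%E; congr L2norm.
  by apply/funext => s; rewrite (@cder_dz _ (invd ((wPsi U)^~ t)) _ (df (s +i* y)))//; exact: fdf.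
have L2q (y a b : R) : y < 0 -> a <= b -> segint a b (fun x => normc (f (x +i* y) *
    (df (x +i* y) * p (x +i* y) + f (x +i* y) * dp (x +i* y))) ^+ 2) <= M2.
  move=> y0 ab; have [_ B2 _] := HM y y0.
  apply: L2norm_segint ab (ccont_sqr_line (cq pdp cdp fdf cdf) y0); apply: le_trans B2.
  rewrite le_eqVlt; apply/orP; left; apply/eqP; congr (_ ^+ 2)%E; congr L2norm.
  apply/funext => s; congr (_ * _); apply/esym/cder_dz => //.
  by apply: cderM; [exact: fdf|exact: pdp].
split=> fx.
  have f0 : clim Pminus f x%:C 0 by rewrite -fx; exact: iPsiz_limit.
  exact: (singular_limit pdp cdp fdf cdf L2p L2q L2df f0).
have f0 : extT (iPsiz U) x%:C t != 0 by apply/eqP.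
have [m Hm] := nonsingular_limit Fz_cder pdp cdp fdf cdf L2q f0 (iPsiz_limit x) F_limit.
exists (m / extT (iPsiz U) x%:C t).
have := climM Hm (climV f0 (iPsiz_limit x)).
apply: clim_eq => z Pz; rewrite /f /iPsiz mulrAC mulfV ?mul1r//.
by rewrite invr_neq0// Psiz_neq0.
Qed.

Lemma DF_limits (x : R) : exists l, clim Pminus ((DF U)^~ t) x%:C l.
Proof.
have [H0 H1] := DF_boundary x; have [fx|/eqP/H1[m Hm]] := eqVneq (extT (iPsiz U) x%:C t) 0.
  by exists 0; exact: H0.
by eexists; apply: climM Hm; exact: iPsiz_limit.
Qed.

Lemma DFbar_singular_limit (x : R) : singular U t x -> clim Pminus ((DFbar U)^~ t) x%:C 0.
Proof.
move=> fx; apply: (clim_norm0 (g := (DF U)^~ t)); last exact: (DF_boundary x).1.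
by move=> w _; rewrite normc_DFbar.
Qed.

Lemma DFbar_nonsingular_limit (x : R) (m : R[i]) : clim Pminus ((Fz U)^~ t) x%:C m ->
  clim Pminus ((DFbar U)^~ t) x%:C (extT (iPsiz U) x%:C t * m^*).
Proof. by move=> Hm; apply: climM; [exact: iPsiz_limit|exact: clim_conj]. Qed.

Lemma DFbar_limits (x : R) : exists l, clim Pminus ((DFbar U)^~ t) x%:C l.
Proof.
have [_ H1] := DF_boundary x; have [fx|/eqP/H1[m Hm]] := eqVneq (extT (iPsiz U) x%:C t) 0.
  by exists 0; exact: DFbar_singular_limit.
by eexists; exact: DFbar_nonsingular_limit Hm.
Qed.

Lemma extT_DFbar_singular (x : R) : singular U t x -> extT (DFbar U) x%:C t = 0.
Proof. by move=> fx; apply: ext_limit; [exact: clPminus_real|exact: DFbar_singular_limit]. Qed.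

Lemma extT_DFbar_cont (x : R) : forall e : R, 0 < e -> exists2 d, 0 < d &
  forall x', `|x' - x| < d -> normc (extT (DFbar U) x'%:C t - extT (DFbar U) x%:C t) < e.
Proof.
have gl' z : clPminus z -> exists l, clim Pminus ((DFbar U)^~ t) z l.
  rewrite /clPminus/= le_eqVlt => /predU1P[z0|z0].
    have -> : z = (Re z)%:C by case: z z0 => a b /= ->.
    exact: DFbar_limits.
  by exists (DFbar U z t); apply: clim_sub (DFbar_cont z0) => w.
move=> e e0; have [d d0 Hd] := ext_cont gl' (clPminus_real x) e0.
exists d => // x' x'd; apply: Hd; last exact: clPminus_real.
by rewrite -raddfB normc_real.
Qed.

Lemma part1 : [/\ extends_continuously ((DF U)^~ t), extends_continuously ((DFbar U)^~ t)
  & forall a : R, singular U t a -> extT (DF U) a%:C t = 0 /\ extT (DFbar U) a%:C t = 0].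
Proof.
split; [apply: extends_continuously_limits DF_cont DF_limits
       |apply: extends_continuously_limits DFbar_cont DFbar_limits|].
move=> a Sa; split; last exact: extT_DFbar_singular.
by apply: ext_limit; [exact: clPminus_real|exact: (DF_boundary a).1].
Qed.

End FixedTime.

(** * Estimates through the approximations *)

Section UniformConvergence.
Context {R : realType}.

Lemma cvg_compacts_normc (X : topologicalType) (A : set (X * R)) (f_ : nat -> X -> R -> R[i])
    (f : X -> R -> R[i]) (K : set (X * R)) :
  @cvg_compacts R X R[i]^o A f_ f -> compact K -> K `<=` A ->
  forall e : R, 0 < e -> exists N, forall n, (N <= n)%N ->
    forall p, K p -> normc (f_ n p.1 p.2 - f p.1 p.2) < e.
Proof.
move=> /fam_cvgP/(_ K) fK cK KA e e0.
have {fK} := fK (conj cK KA).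
move=> /(_ [set h | forall p, K p -> normc (h p - f p.1 p.2) < e]).
have B : nbhs ((fun p => f p.1 p.2) : {uniform` K -> R[i]^o})
    [set h | forall p, K p -> normc (h p - f p.1 p.2) < e].
  apply/uniform_nbhs; exists [set xy | ball (xy.1 : R[i]^o) e%:C xy.2]; split.
    by rewrite -entourage_ballE; exists e%:C; rewrite /= ?ltcR.
  move=> h /= Hh p Kp; have := Hh p Kp.
  by rewrite /ball/= normc_modulusE ltcR normc_distC.
by move=> /(_ B)[N _ HN]; exists N => n Nn; exact: HN.
Qed.

Lemma half_cvg_segment (T : R) (f_ : nat -> R[i] -> R -> R[i]) (f : R[i] -> R -> R[i]) (a b t : R) :
  half_cvg T clPminus f_ f -> timeI T t ->
  forall e : R, 0 < e -> exists N, forall n, (N <= n)%N ->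
    forall x : R, a <= x <= b -> normc (f_ n x%:C t - f x%:C t) < e.
Proof.
move=> ff Tt e e0.
have cK : compact ((((fun x : R => (x%:C : R[i]^o)) @` [set` `[a, b]]) `*` [set t]) : set (R[i]^o * R)).
  apply: compact_setX; last exact: compact_set1.
  apply: continuous_compact; last exact: segment_compact.
  apply: continuous_subspaceT => x; apply/cvg_normcP => d d0; apply/near_realP; exists d => // s sx.
  by rewrite -raddfB normc_real.
have [|N HN] := cvg_compacts_normc ff cK _ e0.
  by move=> [z s]/= [[x _ <-] ->]; split => //; exact: clPminus_real.
exists N => n Nn x xab; apply: (HN n Nn (x%:C, t)); split => //=.
by exists x => //=; rewrite in_itv.
Qed.

Lemma line_cvg_point (T : R) (f_ : nat -> R -> R -> R[i]) (f : R -> R -> R[i]) (a t : R) :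
  line_cvg T f_ f -> timeI T t ->
  forall e : R, 0 < e -> exists N, forall n, (N <= n)%N -> normc (f_ n a t - f a t) < e.
Proof.
move=> ff Tt e e0; have cK := @compact_set1 (R * R)%type (a, t).
have [|N HN] := cvg_compacts_normc ff cK _ e0; first by move=> _ ->.
by exists N => n Nn; exact: (HN n Nn (a, t)).
Qed.

End UniformConvergence.

Section CurveDerivatives.
Context {R : realType}.
Implicit Types (f : R -> R[i]) (x : R) (l : R[i]).

Lemma cderivable_vder f x : cderivable f x -> vder f x (cderive f x).
Proof.
move=> [d1 d2]; apply/vder_is_derive; rewrite /cderive/= !derive1E.
by split; [exact/derivableP/d1|exact/derivableP/d2].
Qed.

Lemma vder_cderive f x l : vder f x l -> cderive f x = l.
Proof.
move=> /vder_is_derive[d1 d2]; rewrite /cderive (derive1_is_derive d1) (derive1_is_derive d2).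
by case: l {d1 d2}.
Qed.

Lemma vder_comp_real f (g : R -> R) x l (m : R) : vder f (g x) l -> is_derive x 1 g m ->
  vder (fun s => f (g s)) x (l * m%:C).
Proof.
move=> /vder_is_derive[d1 d2] gm; apply/vder_is_derive; split.
  have := @is_derive1_comp R (fun s => Re (f s)) g x _ _ d1 gm.
  by rewrite Re_mul /= mulr0 subr0.
have := @is_derive1_comp R (fun s => Im (f s)) g x _ _ d2 gm.
by rewrite Im_mul /= mulr0 add0r.
Qed.

Lemma derivable_in_is_derive (A : set R) (u : R -> R) x :
  (\forall s \near (0 : R), A (x + s)) -> derivable_in A u x -> is_derive x 1 u (derive_in A u x).
Proof.
move=> nA /cvg_ex[l ul].
have L : s^-1 * (u (x + s) - u x) @[s --> 0^'] --> l.
  apply: cvg_trans ul; apply: (cvg_fmap2 _).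
  move=> P /= PW; move: nA => /near_realP[d' d'0 Hd'].
  have /near_realP[d d0 Hd] := PW.
  apply/near_realP; exists (Num.min d d') => [|s]; first by rewrite lt_min d0.
  by rewrite lt_min => /andP[sd sd'] s0; apply: Hd => //=; apply: Hd'.
have D : is_derive x 1 u l.
  have L' : s^-1 *: (u (s *: 1 + x) - u x) @[s --> 0^'] --> l.
    have -> // : (fun s => s^-1 *: (u (s *: 1 + x) - u x)) = (fun s => s^-1 * (u (x + s) - u x)).
    by apply/funext => s; rewrite /GRing.scale/= mulr1 (addrC s).
  by apply: DeriveDef; [apply/cvg_ex; exists l|exact: cvg_lim L'].
by rewrite (derive_in_is_derive nA D).2.
Qed.

Lemma cderivable_in_vder (A : set R) f x : (\forall s \near (0 : R), A (x + s)) ->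
  cderivable_in A f x -> vder f x (cderive_in A f x).
Proof.
by move=> nA [d1 d2]; apply/vder_is_derive; split; exact: derivable_in_is_derive.
Qed.

End CurveDerivatives.

(** * Bounds on a single smooth approximation *)

Section Approximation.
Context {R : realType}.
Variables (T : R) (U V : wave R) (e0 M M' c1 c2 : R) (g : R -> R -> R) (t : R).
Implicit Types (s a b : R).
Hypotheses (T_gt0 : 0 < T) (Tt : timeI T t).
Hypotheses (ap : Defs.approximation T U e0 V g) (ub : uniform_bounds T V g M M' c1 c2).
Hypotheses (c1_gt0 : 0 < c1) (c2_gt0 : 0 < c2).

Lemma time0 : timeI T 0.
Proof. by rewrite /timeI/= in_itv/= lexx ltW. Qed.

Lemma bZ_vder s a : timeI T s -> vder (fun x => bZ V x s) a (bZa V a s).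
Proof.
move=> Ts; have [_ [H _ _ _]] := ap_Psi_smooth ap 1.
have [cd _ _] := H a%:C s (clPminus_real a) Ts.
by have := cderivable_vder cd.
Qed.

(** At a boundary point [dz] contains a one-sided derivative in y'. The Cauchy-Riemann equation
    holds inside and passes to the boundary because both partial derivatives are continuous
    there. *)
Lemma boundary_CR (a s : R) : timeI T s -> Psiz V a%:C s = bZa V a s.
Proof.
move=> Ts; have [_ [_ [Hx _] [Hy _] _]] := ap_Psi_smooth ap 1.
have hP := (ww_conf (ap_sol ap) Ts).1.
have Lx := clim_sub (@Pminus_cl R) (half_cont_clim Hx Ts (clPminus_real a)).
have Ly := clim_sub (@Pminus_cl R) (half_cont_clim Hy Ts (clPminus_real a)).
have Lx' : clim Pminus (fun w => dy ((wPsi V)^~ s) w) a%:C (dx ((wPsi V)^~ s) a%:C * 'i).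
  apply: clim_eq (climM Lx (clim_cst _ _ 'i)) => w Pw.
  have cw := holomorphic_cder hP Pw.
  by rewrite (cder_dx cw) (cder_dy Pw cw).
have E : dy ((wPsi V)^~ s) a%:C = dx ((wPsi V)^~ s) a%:C * 'i.
  by rewrite -(ext_limit (clPminus_real a) Ly) (ext_limit (clPminus_real a) Lx').
rewrite /Psiz /dz /dminus E.
have ii : 'i * 'i = -1 :> R[i] by rewrite -expr2 sqr_i.
have -> : bZa V a s = dx ((wPsi V)^~ s) a%:C by [].
move: (dx _ _) => l.
by rewrite mulrCA ii mulrN1 opprK -mulr2n -[l *+ 2]mulr_natl mulKf// pnatr_eq0.
Qed.

Lemma flow_derive s a : timeI T s -> exists ga : R, is_derive a 1 (g^~ s) ga /\ da (toC g) a s = ga%:C.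
Proof.
move=> Ts; have [_ [H _ _]] := ap_flow_smooth ap 1.
have [cd _] := H a s Ts.
exists (derive1 (g^~ s) a); split; first by rewrite derive1E; apply: derivableP; exact: cd.1.
by rewrite /da /cderive/= /toC/= derive1_cst.
Qed.

Lemma da_bz s a : timeI T s -> da (bz V g) a s = bZa V (g a s) s * da (toC g) a s.
Proof.
move=> Ts; have [ga [gd ->]] := flow_derive a Ts.
exact/vder_cderive/(vder_comp_real (bZ_vder (g a s) Ts) gd).
Qed.

Lemma bzt_vder s a : timeI T s -> vder (fun x => bzt T V g x s) a (da (bzt T V g) a s).
Proof.
move=> Ts; have [_ [H _ _ _]] := ap_F_smooth ap 1.
have [cd _ _] := H (g a s)%:C s (clPminus_real _) Ts.
have [ga [gd _]] := flow_derive a Ts.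
have V1 := vder_comp_real (vder_conj (cderivable_vder cd)) gd.
have E : (fun x => bzt T V g x s) = (fun x => (wF V (g x s)%:C s)^*).
  by apply/funext => x; rewrite (ap_zt ap)//.
by rewrite /da E (vder_cderive V1).
Qed.

Lemma da_bz0 a : da (bz V g) a 0 = bZa V a 0.
Proof.
have E : (bz V g)^~ 0 = (bZ V)^~ 0.
  by apply/funext => x; rewrite /bz /comp_sp (ap_flow0 ap).
by rewrite /bZa /da E.
Qed.

Lemma iPsiz_bZa a s : timeI T s -> iPsiz V a%:C s = (bZa V a s)^-1.
Proof. by move=> Ts; rewrite /iPsiz boundary_CR. Qed.

Lemma bZa_gt0 a s : timeI T s -> 0 < normc (bZa V a s).
Proof. by move=> Ts; rewrite normc_gt0; apply/eqP; exact: ap_Za_neq0 ap _ _ Ts. Qed.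

(** By the chain rule the derivative of [z] in the label is that of [Z] at the flow point times that
    of the flow. The first stays comparable to its initial value and the last to 1, hence so does
    the remaining factor. *)
Lemma iPsiz_flow_bounds a :
  c1 * normc (iPsiz V (g a t)%:C t) <= c2 * normc (iPsiz V a%:C 0) /\
  c1 * normc (iPsiz V a%:C 0) <= c2 * normc (iPsiz V (g a t)%:C t).
Proof.
rewrite (iPsiz_bZa a time0) (iPsiz_bZa (g a t) Tt).
rewrite !normcV.
have /andP[] := ub_za ub a Tt; rewrite da_bz0 da_bz// normcM.
have /andP[h1 h2] := ub_ha ub a Tt.
have p0 := bZa_gt0 a time0; have pt := bZa_gt0 (g a t) Tt.
move: (normc (bZa V a 0)) (normc (bZa V (g a t) t)) (normc _) p0 pt h1 h2 => A B G p0 pt h1 h2 h3 h4.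
rewrite !(ler_pdivrMr, ler_pdivlMr)//; split.
  rewrite mulrAC ler_pdivlMr//; apply: le_trans h3 _; rewrite mulrC.
  by rewrite ler_wpM2r// ltW.
rewrite mulrAC ler_pdivlMr// mulrC; apply: le_trans h4.
by rewrite ler_wpM2l// ltW.
Qed.

(** The derivative of [bzt] in the label is at most [c2] times the initial one of [bz], whose
    modulus is the reciprocal of 1/Psi_z' at time 0; [K] bounds that reciprocal. *)
Lemma bzt_lipschitz (a b K : R) : a <= b ->
  (forall x, a <= x <= b -> 1 <= K * normc (iPsiz V x%:C 0)) ->
  normc (bzt T V g b t - bzt T V g a t) <= c2 * K * (b - a).
Proof.
move=> ab HK; apply: (vder_increment_le_cst (f := fun x => bzt T V g x t) (f' := fun x => da (bzt T V g) x t)) => //.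
  by move=> x _; exact: bzt_vder.
move=> x xab; apply: le_trans (ub_zta0 ub x Tt) _; rewrite da_bz0.
rewrite ler_pM2l//; have := HK x xab; rewrite (iPsiz_bZa x time0) normcV.
by rewrite ler_pdivlMr ?mul1r//; exact: bZa_gt0 time0.
Qed.

End Approximation.

Section LineContinuity.
Context {R : realType}.

Lemma line_contP (T : R) (f : R -> R -> R[i]) : line_cont T f ->
  forall a t, timeI T t -> forall e : R, 0 < e -> exists2 d, 0 < d &
    forall b s, timeI T s -> `|b - a| < d -> `|s - t| < d -> normc (f b s - f a t) < e.
Proof.
move=> /subspace_continuousP fc a t Tt e e0.
have H := fc (a, t) (conj Logic.I Tt).
have FF := @within_filter _ (setT `*` timeI T) _ (nbhs_filter ((a, t) : R * R)).
have /= := (cvg_normcP FF _ _).1 H e e0; rewrite /within/=.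
case=> -[P Q] /= [/near_realP[d1 d10 H1] /near_realP[d2 d20 H2]] PQ.
exists (Num.min d1 d2) => [|b s Ts]; first by rewrite lt_min d10.
rewrite !lt_min => /andP[w1 _] /andP[_ s2].
by apply: (PQ (b, s)); split => //=; [exact: H1|exact: H2].
Qed.

End LineContinuity.

(** * Passage to the limit in the uniform bounds *)

Section WuLimits.
Context {R : realType}.
Variables (T : R) (C : R -> R) (C' : R -> R -> R) (c1 c2 : R -> R) (U : wave R).
Variables (V : R -> wave R) (g : R -> R -> R -> R) (eps : nat -> R).
Variables (h : R -> R -> R) (z : R -> R -> R[i]).
Hypotheses (T_gt0 : 0 < T) (wuU : wu_solution T C C' c1 c2 U V g eps h z).
Implicit Types (a b s t x : R).

Let C1 : R := c1 (fine (energy_at U 0)).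
Let C2 : R := c2 (fine (energy_at U 0)).
Let LM := wu_limit wuU.
Let WW := wu_sol wuU.
Let WR := wu_reg wuU.

Lemma C1_gt0 : 0 < C1. Proof. exact: (wu_c_gt0 wuU).1. Qed.
Lemma C2_gt0 : 0 < C2. Proof. exact: (wu_c_gt0 wuU).2. Qed.

Definition bdry_f x t : R[i] := extT (iPsiz U) x%:C t.

Lemma h_increment a b t : timeI T t -> a <= b -> C1 * (b - a) <= h b t - h a t <= C2 * (b - a).
Proof.
move=> Tt; rewrite le_eqVlt => /predU1P[->|ab]; first by rewrite !subrr !mulr0 lexx.
have ba : b <> a by apply/eqP; rewrite gt_eqF.
have := lm_h_bilip LM Tt ba.
have ba0 : 0 < b - a by rewrite subr_gt0.
by rewrite ler_pdivlMr// ler_pdivrMr.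
Qed.

Lemma h_lipschitz a b t : timeI T t -> `|h b t - h a t| <= C2 * `|b - a|.
Proof.
move=> Tt; wlog ab : a b / a <= b.
  by move=> W; case: (leP a b) => [|/ltW] ab; [|rewrite distrC (distrC b)]; exact: W.
have /andP[h1 h2] := h_increment Tt ab.
have ba0 : 0 <= b - a by rewrite subr_ge0.
rewrite !ger0_norm//; apply: le_trans h1; rewrite mulr_ge0// ltW//; exact: C1_gt0.
Qed.

Lemma hinv_h b t : timeI T t -> hinv h (h b t) t = b.
Proof.
move=> Tt; have [g' [hg gh _ _]] := lm_h_homeo LM Tt.
rewrite /hinv; case: xgetP => [y _ /= hy|/(_ b)]; first by rewrite -(hg y) hy hg.
by move=> /= H; case: H.
Qed.

Lemma z_Psi b t : timeI T t -> z b t = wPsi U (h b t)%:C t.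
Proof. by move=> Tt; rewrite -(lm_Z LM _ Tt) /comp_sp hinv_h. Qed.

Lemma zt_F b t : timeI T t -> dt T z b t = (wF U (h b t)%:C t)^*.
Proof. by move=> Tt; rewrite -(lm_Zt LM _ Tt) conjcK /comp_sp hinv_h. Qed.

Lemma bdry_f_cont x t e : timeI T t -> 0 < e -> exists2 d, 0 < d &
  forall x', `|x' - x| < d -> normc (bdry_f x' t - bdry_f x t) < e.
Proof.
move=> Tt e0; have [d d0 Hd] := half_cont_clim (wr_iPsiz_cont WR) Tt (clPminus_real x) e0.
exists d => // x' x'd; apply: Hd; last exact: clPminus_real.
by rewrite -raddfB normc_real.
Qed.

Lemma approx n : Defs.approximation T U (eps n) (V (eps n)) (g (eps n)).
Proof. exact/(wu_approx wuU)/(wu_eps wuU). Qed.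

(** The evaluation point moves with [n]: uniform convergence on a segment around [h a t] handles the
    function, and continuity of the limit handles the point. *)
Lemma iPsiz_flow_cvg a t e : timeI T t -> 0 < e -> exists N, forall n, (N <= n)%N ->
  normc (iPsiz (V (eps n)) (g (eps n) a t)%:C t - bdry_f (h a t) t) < e.
Proof.
move=> Tt e0; have e20 : 0 < e / 2 by rewrite divr_gt0.
have [d d0 Hd] := bdry_f_cont (h a t) Tt e20.
have [N1 H1] := half_cvg_segment (h a t - 1) (h a t + 1) (cv_iPsiz (wu_cvg wuU)) Tt e20.
have d1 : 0 < Num.min d 1 by rewrite lt_min d0 ltr01.
have [N2 H2] := line_cvg_point a (cv_h (wu_cvg wuU)) Tt d1.
exists (maxn N1 N2) => n; rewrite geq_max => /andP[n1 n2].
have : normc ((g (eps n) a t)%:C - (h a t)%:C) < Num.min d 1 by exact: H2 n n2.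
rewrite -raddfB normc_real lt_min => /andP[gd g1].
rewrite (le_lt_trans (normc_dist_triangle _ (bdry_f (g (eps n) a t) t) _))// (splitr e) ltrD//.
  by apply: H1 => //; move: g1; rewrite ltr_norml => /andP[? ?]; apply/andP; split; lra.
exact: Hd.
Qed.

(** Both inequalities matter: the first carries singular points to singular points, the second keeps
    nonsingular ones away from 0 uniformly in time. *)
Lemma bdry_f_flow a t : timeI T t ->
  C1 * normc (bdry_f (h a t) t) <= C2 * normc (bdry_f a 0) /\
  C1 * normc (bdry_f a 0) <= C2 * normc (bdry_f (h a t) t).
Proof.
move=> Tt; have T0 := time0 T_gt0.
have C10 := C1_gt0; have C20 := C2_gt0.
have aux (e : R) (x y P Q : R[i]) : normc (x - P) < e -> normc (y - Q) < e ->
    C1 * normc x <= C2 * normc y -> C1 * normc P <= C2 * normc Q + (C1 + C2) * e.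
  move=> xP yQ xy; have := ler_normcB P x; have := ler_normcB y Q.
  rewrite (normc_distC P) => h1 h2.
  have PX : C1 * normc P <= C1 * (normc x + e) by rewrite ler_pM2l//; lra.
  have YQ : C2 * normc y <= C2 * (normc Q + e) by rewrite ler_pM2l//; lra.
  by lra.
have K (e : R) : 0 < e -> C1 * normc (bdry_f (h a t) t) <= C2 * normc (bdry_f a 0) + (C1 + C2) * e /\
  C1 * normc (bdry_f a 0) <= C2 * normc (bdry_f (h a t) t) + (C1 + C2) * e.
  move=> e0; have [N1 H1] := iPsiz_flow_cvg a Tt e0; have [N2 H2] := iPsiz_flow_cvg a T0 e0.
  have := H1 _ (leq_maxl N1 N2); have := H2 _ (leq_maxr N1 N2).
  rewrite (lm_h0 LM) (ap_flow0 (approx _)) => A0 At.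
  have [B1 B2] := iPsiz_flow_bounds T_gt0 Tt (approx (maxn N1 N2))
    (wu_bounds wuU (wu_eps wuU (maxn N1 N2))) a.
  by split; [exact: aux At A0 B1|exact: aux A0 At B2].
have C120 : 0 < C1 + C2 by rewrite addr_gt0.
have E (e : R) : (C1 + C2) * (e / (C1 + C2)) = e by rewrite mulrC divfK// gt_eqF.
split; apply/ler_addgt0Pr => e e0; have [h1 h2] := K _ (divr_gt0 e0 C120).
  by rewrite E in h1.
by rewrite E in h2.
Qed.

Lemma singular_flow a t : timeI T t -> singular U 0 a -> singular U t (h a t).
Proof.
move=> Tt Sa; have [H _] := bdry_f_flow a Tt; move: H; rewrite {2}/bdry_f Sa normc0 mulr0 => H.
apply/eqP; rewrite -/(bdry_f _ _) -normc_eq0 eq_le normc_ge0 andbT.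
by move: H; rewrite pmulr_rle0// C1_gt0.
Qed.

Lemma zt_lipschitz a : bdry_f a 0 != 0 -> exists2 r, 0 < r & forall b t, timeI T t -> `|b - a| < r ->
  normc (dt T z b t - dt T z a t) <= C2 * (2 / normc (bdry_f a 0)) * `|b - a|.
Proof.
move=> fa; have m0 : 0 < normc (bdry_f a 0) by rewrite normc_gt0.
have [m mE] : exists m : R, m = normc (bdry_f a 0) by eexists.
rewrite -mE in m0 *; have m40 : 0 < m / 4 by rewrite divr_gt0.
have T0 := time0 T_gt0.
have [r r0 Hr] := bdry_f_cont a T0 m40.
exists (Num.min r 1) => [|b t Tt]; first by rewrite lt_min r0 ltr01.
rewrite lt_min => /andP[br b1].
(* Continuity in space and convergence of the approximations cost [m / 4] each, so their 1/Psi_z' is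
   at least [m / 2] between [a] and [b]. *)
have [N1 H1] := half_cvg_segment (a - 1) (a + 1) (cv_iPsiz (wu_cvg wuU)) T0 m40.
apply/ler_addgt0Pr => e e0; have e20 : 0 < e / 2 by rewrite divr_gt0.
have [N2 H2] := line_cvg_point a (cv_zt (wu_cvg wuU)) Tt e20.
have [N3 H3] := line_cvg_point b (cv_zt (wu_cvg wuU)) Tt e20.
pose n := maxn N1 (maxn N2 N3).
have n1 : (N1 <= n)%N by rewrite leq_maxl.
have n2 : (N2 <= n)%N by rewrite /n maxnCA leq_maxl.
have n3 : (N3 <= n)%N by rewrite /n maxnA leq_maxr.
have {}H2 := H2 n n2; have {}H3 := H3 n n3.
have aux (P Q S : R[i]) : m = normc P -> normc (Q - P) < m / 4 -> normc (S - Q) < m / 4 ->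
    m / 2 <= normc S.
  move=> mP QP SQ; have h1 := ler_normcB P Q; have h2 := ler_normcB Q S.
  by rewrite (normc_distC P) in h1; rewrite (normc_distC Q) in h2; lra.
have low x : `|x - a| <= `|b - a| -> 1 <= 2 / m * normc (iPsiz (V (eps n)) x%:C 0).
  move=> xa; have xr : `|x - a| < r by exact: le_lt_trans br.
  have x1 : `|x - a| < 1 by exact: le_lt_trans b1.
  have x1' : a - 1 <= x <= a + 1 by move: x1; rewrite ltr_norml => /andP[? ?]; apply/andP; split; lra.
  have A1 := Hr x xr; have A2 := H1 n n1 x x1'.
  have h3 : m / 2 <= normc (iPsiz (V (eps n)) x%:C 0) by exact: aux mE A1 A2.
  have : 2 / m * (m / 2) <= 2 / m * normc (iPsiz (V (eps n)) x%:C 0).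
    by rewrite ler_wpM2l// divr_ge0// ltW.
  by rewrite (_ : 2 / m * (m / 2) = 1)//; field; rewrite gt_eqF.
have L : normc (bzt T (V (eps n)) (g (eps n)) b t - bzt T (V (eps n)) (g (eps n)) a t) <=
    C2 * (2 / m) * `|b - a|.
  have LL := bzt_lipschitz T_gt0 Tt (approx n) (wu_bounds wuU (wu_eps wuU n)) C2_gt0.
  case: (leP a b) => [ab|/ltW ab].
    have E : `|b - a| = b - a by rewrite ger0_norm// subr_ge0.
    rewrite E; apply: LL => // x /andP[ax xb]; apply: low.
    by rewrite E ger0_norm ?subr_ge0// lerD2r.
  have E : `|b - a| = a - b by rewrite distrC ger0_norm// subr_ge0.
  rewrite E normc_distC; apply: LL => // x /andP[ax xb]; apply: low.
  by rewrite E distrC ger0_norm ?subr_ge0// lerD2l lerN2.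
have aux2 (P Q S W : R[i]) (k : R) : normc (P - S) < e / 2 -> normc (Q - W) < e / 2 ->
    normc (Q - P) <= k -> normc (W - S) <= k + e.
  move=> PS QW QP; rewrite (_ : W - S = (Q - P) + ((P - S) - (Q - W))); last by ring.
  by have := normcD_le (Q - P) ((P - S) - (Q - W)); have := normcB_le (P - S) (Q - W); lra.
exact: aux2 H2 H3 L.
Qed.

(** One radius for all times, by compactness of [0,T]; the chord estimate has to hold on a
    neighbourhood that does not shrink with [s]. *)
Lemma bdry_f_uniform a (m : R) : 0 < m -> exists2 d, 0 < d & forall s, timeI T s -> forall v,
  clPminus v -> normc (v - (h a s)%:C) < d -> normc (extT (iPsiz U) v s - bdry_f (h a s) s) < m.
Proof.
move=> m0.
have aux (x y w : R[i]) : normc (x - y) < m / 2 -> normc (w - y) < m / 2 -> normc (x - w) < m.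
  by move=> xy; rewrite normc_distC => yw; rewrite (le_lt_trans (normc_dist_triangle x y w))// (splitr m) ltrD.
have aux1 (x y w : R[i]) (r : R) : normc (x - y) < r / 2 -> normc (y - w) < r / 2 -> normc (x - w) < r.
  by move=> xy yw; rewrite (le_lt_trans (normc_dist_triangle x y w))// (splitr r) ltrD.
have [|s0|d d0 Hd] := @segment_uniform R 0 T (fun d s => forall v, clPminus v ->
    normc (v - (h a s)%:C) < d -> normc (extT (iPsiz U) v s - bdry_f (h a s) s) < m).
- by move=> t d d' /andP[_ d'd] H v Pv vd; apply: H => //; exact: lt_le_trans d'd.
- move=> Ts0; have {}Ts0 : timeI T s0 by rewrite /timeI/= in_itv.
  have m20 : 0 < m / 2 by rewrite divr_gt0.
  have [r r0 Hr] := half_contP (wr_iPsiz_cont WR) (clPminus_real (h a s0)) Ts0 m20.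
  have r20 : 0 < r / 2 by rewrite divr_gt0.
  have [d d0 Hd] := line_contP (lm_h_cont LM) a Ts0 r20.
  exists (Num.min (Num.min d (r / 2)) (r / 2)); first by rewrite !lt_min d0 r20.
  move=> s Ts; rewrite !lt_min => /andP[/andP[sd sr] _] v Pv.
  rewrite !lt_min => /andP[_ vr].
  have {}Ts : timeI T s by rewrite /timeI/= in_itv.
  have hs : normc ((h a s)%:C - (h a s0)%:C) < r / 2 by apply: Hd => //; rewrite subrr normr0.
  have sr' : `|s - s0| < r by rewrite (lt_trans sr)// ltr_pdivrMr// ltr_pMr// ltr1n.
  have A1 : normc (extT (iPsiz U) v s - bdry_f (h a s0) s0) < m / 2.
    by apply: Hr => //; exact: aux1 vr hs.
  have A2 : normc (bdry_f (h a s) s - bdry_f (h a s0) s0) < m / 2.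
    apply: Hr => //; first exact: clPminus_real.
    by rewrite (lt_trans hs)// ltr_pdivrMr// ltr_pMr// ltr1n.
  exact: aux A1 A2.
- by exists d => // s; rewrite /timeI/= in_itv/= => Ts; exact: Hd.
Qed.

End WuLimits.

(** * Chords of the interface *)

Section BoundaryDerivative.
Context {R : realType}.
Implicit Types (x y a b d e : R) (H D : R[i] -> R[i]) (l : R[i]).

Lemma vderD (f g : R -> R[i]) (x : R) l (m : R[i]) : vder f x l -> vder g x m ->
  vder (fun s => f s + g s) x (l + m).
Proof.
move=> fl gm e e0; have e20 : 0 < e / 2 by rewrite divr_gt0.
have [d d0 Hd] := fl _ e20; have [d' d'0 Hd'] := gm _ e20.
exists (Num.min d d') => [|s]; first by rewrite lt_min d0.
rewrite lt_min => /andP[/Hd A /Hd' B].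
rewrite (_ : _ - _ = (f (x + s) - f x - l * s%:C) + (g (x + s) - g x - m * s%:C)); last by ring.
by rewrite (le_trans (normcD_le _ _))// [e]splitr mulrDl lerD.
Qed.

Lemma vder_near (f g : R -> R[i]) (x d : R) l : 0 < d -> (forall s, `|s - x| < d -> f s = g s) ->
  vder f x l -> vder g x l.
Proof.
move=> d0 fg fl e e0; have [d' d'0 Hd] := fl e e0.
exists (Num.min d d') => [|s]; first by rewrite lt_min d0.
rewrite lt_min => /andP[sd /Hd]; rewrite !fg ?subrr ?normr0//.
by rewrite addrC addKr.
Qed.

(** The mean value inequality is applied on a line slightly below the axis, which is then let up to
    the axis by continuity of [H]; [D] is evaluated only inside P_-. *)
Lemma boundary_increment H D l a b (r k : R) : holo H D -> a <= b -> 0 < r ->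
  clim Pminus H a%:C (H a%:C) -> clim Pminus H b%:C (H b%:C) ->
  (forall x y, a <= x <= b -> - r < y < 0 -> normc (D (x +i* y) - l) <= k) ->
  normc (H b%:C - H a%:C - l * (b - a)%:C) <= k * (b - a).
Proof.
move=> HD ab r0 Ha Hb Dl; apply/ler_addgt0Pr => e e0.
have e20 : 0 < e / 2 by rewrite divr_gt0.
have [d1 d10 H1] := Ha _ e20; have [d2 d20 H2] := Hb _ e20.
pose y := - (Num.min r (Num.min d1 d2) / 2).
have m0 : 0 < Num.min r (Num.min d1 d2) by rewrite !lt_min r0 d10.
have [y0 yr yd1 yd2] : [/\ y < 0, - r < y, - y < d1 & - y < d2].
  have : Num.min r (Num.min d1 d2) / 2 < Num.min r (Num.min d1 d2) by lra.
  by rewrite /y opprK !lt_min ltrN2 oppr_lt0 divr_gt0// => /and3P[-> -> ->].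
have near_y x : normc ((x +i* y) - x%:C) = - y.
  by rewrite complex_split addrC addKr normcM normci mul1r normc_real ltr0_norm.
have L : normc ((H (b +i* y) - l * b%:C) - (H (a +i* y) - l * a%:C)) <= k * (b - a).
  apply: (@vder_increment_le_cst _ (fun x => H (x +i* y) - l * x%:C) (fun x => D (x +i* y) - l)) => //.
    move=> x _; have V1 := cder_horizontal (HD (x +i* y) y0).
    have V2 := vder_affine 0 (- l) x.
    by apply: (vder_eq _ _ (vderD V1 V2)) => // w; rewrite add0r mulNr.
  by move=> x xab; apply: Dl; rewrite // y0 yr.
have A1 := H1 (a +i* y); rewrite near_y in A1; have {}A1 := A1 yd1 y0.
have A2 := H2 (b +i* y); rewrite near_y in A2; have {}A2 := A2 yd2 y0.
have aux (p q p' q' u v : R[i]) (m : R) : normc ((q' - v) - (p' - u)) <= m -> normc (p' - p) < e / 2 ->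
    normc (q' - q) < e / 2 -> normc (q - p - (v - u)) <= m + e.
  move=> M P Q; rewrite (_ : _ - _ = ((q' - v) - (p' - u)) + ((p' - p) - (q' - q))); last by ring.
  have := normcD_le ((q' - v) - (p' - u)) ((p' - p) - (q' - q)).
  have := normcB_le (p' - p) (q' - q); lra.
by rewrite rmorphB/= mulrBr; exact: aux L A1 A2.
Qed.

Lemma boundary_increment_sym H D l a b (r k : R) : holo H D -> 0 < r ->
  (forall x : R, clim Pminus H x%:C (H x%:C)) ->
  (forall x y, `|x - a| <= `|b - a| -> - r < y < 0 -> normc (D (x +i* y) - l) <= k) ->
  normc (H b%:C - H a%:C - l * (b - a)%:C) <= k * `|b - a|.
Proof.
move=> HD r0 cH Dl; case: (leP a b) => [ab|/ltW ba].
  rewrite ger0_norm ?subr_ge0//; apply: (boundary_increment HD ab r0) => // x y /andP[ax xb].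
  by apply: Dl; rewrite !ger0_norm ?subr_ge0// lerD2r.
rewrite distrC ger0_norm ?subr_ge0//.
rewrite (_ : _ - _ = - (H a%:C - H b%:C - l * (a - b)%:C)); last by rewrite !rmorphB/=; ring.
rewrite normc_opp; apply: (boundary_increment HD ba r0) => // x y /andP[bx xa].
by apply: Dl; rewrite distrC (distrC b) !ger0_norm ?subr_ge0// lerD2l lerN2.
Qed.

(** Turns the limit of the complex derivative at a boundary point into a derivative along the
    boundary, which gives a meaning to the tangent of the limit interface. *)
Lemma vder_boundary H D l x0 : holo H D -> (forall x : R, clim Pminus H x%:C (H x%:C)) ->
  clim Pminus D x0%:C l -> vder (fun x => H x%:C) x0 l.
Proof.
move=> HD cH Dl e e0; have [d d0 Hd] := Dl _ e0.
have d20 : 0 < d / 2 by rewrite divr_gt0.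
exists (d / 2) => // s sd.
have := @boundary_increment_sym H D l x0 (x0 + s) (d / 2) e HD d20 cH.
rewrite [x0 + s - x0]addrC addKr; apply => x y xs /andP[yd y0].
apply/ltW/Hd => //; rewrite complex_split.
rewrite (_ : _ - _ = (x - x0)%:C + 'i * y%:C); last by rewrite rmorphB/=; ring.
rewrite (le_lt_trans (normcD_le _ _))// normcM normci mul1r !normc_real (ltr0_norm y0).
have xd : `|x - x0| < d / 2 by exact: le_lt_trans sd.
by rewrite (splitr d) ltrD// ltrNl.
Qed.

End BoundaryDerivative.

(** * Sequences of complex numbers *)

Section Sequences.
Context {R : realType}.
Implicit Types (x y : R) (u : nat -> R) (f : R -> R[i]) (l : R[i]) (q p : nat -> R[i]).

Definition cseq q l : Prop := (q n : R[i]^o) @[n --> \oo] --> (l : R[i]^o).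

Lemma cseqP q l : cseq q l <-> forall e : R, 0 < e -> \forall n \near \oo, normc (q n - l) < e.
Proof. exact: cvg_normcP. Qed.

Lemma cseqM q p l m : cseq q l -> cseq p m -> cseq (fun n => q n * p n) (l * m).
Proof. by move=> ql pm; exact: (@cvgM R[i] nat \oo _ q p l m ql pm). Qed.

Lemma cseqV q l : l != 0 -> cseq q l -> cseq (fun n => (q n)^-1) l^-1.
Proof. by move=> l0 ql; exact: (@cvgV R[i] nat \oo _ q l l0 ql). Qed.

Lemma cseq_eq q p l : q =1 p -> cseq q l -> cseq p l.
Proof. by move=> /funext ->. Qed.

Lemma cseq_unique q l m : cseq q l -> cseq q m -> l = m.
Proof.
move=> /cseqP ql /cseqP qm; apply/eqP; rewrite -subr_eq0 -normc_eq0 eq_le normc_ge0 andbT.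
apply/ler_addgt0Pr => e e0; rewrite add0r; have e20 : 0 < e / 2 by rewrite divr_gt0.
have [n [n1 n2]] := @filter_ex _ \oo _ _ (filterI (ql _ e20) (qm _ e20)).
rewrite (le_trans (normc_dist_triangle l (q n) m))// (splitr e) lerD ?(ltW n2)//.
by rewrite normc_distC ltW.
Qed.

Lemma cseq_conj q l : cseq q l -> cseq (fun n => (q n)^*) l^*.
Proof.
move=> /cseqP ql; apply/cseqP => e e0; apply: filterS (ql e e0) => n.
by rewrite -raddfB/= normc_conj.
Qed.

Lemma cseq_normc q l : cseq q l -> cseq (fun n => (normc (q n))%:C) (normc l)%:C.
Proof.
move=> /cseqP ql; apply/cseqP => e e0; apply: filterS (ql e e0) => n qn.
rewrite -raddfB normc_real; apply: le_lt_trans qn.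
have := ler_normcB (q n) l; have := ler_normcB l (q n); rewrite (normc_distC l) ler_norml => A B.
by apply/andP; split; lra.
Qed.

Lemma cseq_Re q l : cseq q l -> Re (q n) @[n --> \oo] --> Re l.
Proof.
move=> /cseqP ql; apply/cvgrPdist_lt => e e0; apply: filterS (ql e e0) => n.
by apply: le_lt_trans; rewrite distrC -raddfB normc_Re_le.
Qed.

Lemma cseq_Im q l : cseq q l -> Im (q n) @[n --> \oo] --> Im l.
Proof.
move=> /cseqP ql; apply/cvgrPdist_lt => e e0; apply: filterS (ql e e0) => n.
by apply: le_lt_trans; rewrite distrC -raddfB normc_Im_le.
Qed.

Lemma cseq_expi u x : u @ \oo --> x -> cseq (fun n => expi (u n)) (expi x).
Proof.
move=> ux; apply/cseqP => e e0; have [d d0 Hd] := vder_vcont (vder_expi x) e0.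
have /cvgrPdist_lt/(_ d d0) := ux; apply: filterS => n; rewrite distrC; exact: Hd.
Qed.

Lemma cseq_normc_le q l (M : R) : cseq q l -> (forall n, normc (q n) <= M) -> normc l <= M.
Proof.
move=> /cseqP ql qM; apply/ler_addgt0Pr => e e0.
have [n n1] := @filter_ex _ \oo _ _ (ql _ e0).
by have := ler_normcB l (q n); have := qM n; rewrite normc_distC in n1; lra.
Qed.

Lemma cseq_normalize q l : l != 0 -> cseq q l ->
  cseq (fun n => q n / (normc (q n))%:C) (l / (normc l)%:C).
Proof.
move=> l0 ql; have n0 : (normc l)%:C != 0 by rewrite -normc_eq0 normc_real normr_eq0 normc_eq0.
exact: (cseqM ql (cseqV n0 (cseq_normc ql))).
Qed.

Lemma vder_quotient_cseq f x l u : vder f x l -> u @ \oo --> x -> (forall n, u n != x) ->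
  cseq (fun n => (f (u n) - f x) / (u n - x)%:C) l.
Proof.
move=> fl ux unx; apply/cseqP => e e0.
have e20 : 0 < e / 2 by rewrite divr_gt0.
have [d d0 Hd] := fl _ e20.
have /cvgrPdist_lt /(_ _ d0) := ux; apply: filterS => n; rewrite distrC => und.
have := Hd _ und; rewrite subrKC => H.
have nz : u n - x != 0 by rewrite subr_eq0.
have nz0 : 0 < `|u n - x| by rewrite normr_gt0.
have nzC : (u n - x)%:C != 0 by rewrite -normc_eq0 normc_real gt_eqF.
rewrite (_ : _ - l = (f (u n) - f x - l * (u n - x)%:C) / (u n - x)%:C); last first.
  by rewrite [RHS]mulrBl mulfK.
rewrite normcM normcV normc_real ltr_pdivrMr// (le_lt_trans H)// ltr_pM2r//.
by rewrite ltr_pdivrMr// ltr_pMr// ltr1n.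
Qed.

End Sequences.

(** * The phase of a curve that avoids the origin *)

Section PhaseEquation.
Context {R : realType}.
Implicit Types (D dD : R -> R[i]) (a b s t T : R).

Lemma expiD s t : expi (s + t) = expi s * expi t :> R[i].
Proof. by apply/eqP; rewrite eq_complex Re_mul Im_mul/= cosD sinD mulrC (addrC (sin s * _)) (mulrC (sin s)) !eqxx. Qed.

Lemma expi0 : expi 0 = 1 :> R[i].
Proof. by rewrite /expi cos0 sin0. Qed.

(** Differentiability is asked only inside the segment: in the application the time derivatives at 0
    and T are one-sided. *)
Lemma vder_constant D a b : a <= b -> (forall s, a <= s <= b -> vcont D s) ->
  (forall s, a < s < b -> vder D s 0) -> D a = D b.
Proof.
move=> ab cD D0; pose I : set R := [set s | a <= s <= b].
have mono (u : R -> R) : {in I, continuous u} -> (forall x, a < x < b -> is_derive x 1 u 0) -> u a <= u b.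
  move=> cu u0; apply: (@is_derive_nondecreasing _ u (fun=> 0)) => //.
  by apply: continuous_in_subspaceT => x; rewrite inE/= in_itv/= => xab; apply: cu; rewrite inE.
have const (u : R -> R) : {in I, continuous u} -> (forall x, a < x < b -> is_derive x 1 u 0) -> u a = u b.
  move=> cu u0; apply/eqP; rewrite eq_le mono//= -lerN2; apply: (mono (- u)).
    by move=> x xI; apply: continuousN; exact: cu.
  by move=> x xab; have := u0 x xab => ?; rewrite -oppr0; exact: is_deriveN.
apply/eqP; rewrite eq_complex; apply/andP; split; apply/eqP.
  apply: (const (fun s => Re (D s))) => x; first by rewrite inE => /cD; exact: vcont_Re.
  by move=> /D0; exact: vder_Re.
apply: (const (fun s => Im (D s))) => x; first by rewrite inE => /cD; exact: vcont_Im.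
by move=> /D0; exact: vder_Im.
Qed.

(* [D] solves [D' = lambda D] with [lambda = dD/D]; the modulus of [D] absorbs
   [Re lambda]. *)
Lemma phase_increment D dD T t : 0 <= t <= T -> (forall s, vcont D s) -> (forall s, vcont dD s) ->
  (forall s, D s != 0) -> (forall s, 0 < s < T -> vder D s (dD s)) ->
  D t / (normc (D t))%:C =
  D 0 / (normc (D 0))%:C * expi (segint 0 t (fun s => Im (dD s / D s))).
Proof.
move=> /andP[t0 tT] cD cD' D0 DD'.
have cDV s : vcont (fun s => (D s)^-1) s.
  exact: (@clim_vcont _ (fun w => w^-1) D s (climV (D0 s) (fun e e0 => ex_intro2 _ _ e e0 (fun w wd _ => wd)))).
have cl s : vcont (fun s => dD s / D s) s by apply: vcontM.
have [P HP] := continuous_primitive (-1) (fun s => vcont_Re (cl s)).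
have [Th HTh] := continuous_primitive (-1) (fun s => vcont_Im (cl s)).
(* Integrating factor [exp (- int lambda)], split into phase and modulus. The primitives start at -1
   so that time 0 is an interior point. *)
pose G s := expi (- Th s) * (expR (- P s))%:C.
have VG s : -1 < s -> vder G s (- (dD s / D s) * G s).
  move=> s1.
  have nTh : is_derive s 1 (fun s => - Th s) (- Im (dD s / D s)) by have ? := HTh s s1; exact: is_deriveN.
  have nP : is_derive s 1 (fun s => - P s) (- Re (dD s / D s)) by have ? := HP s s1; exact: is_deriveN.
  have V1 := @vder_comp_real R expi (fun s => - Th s) s _ _ (vder_expi (- Th s)) nTh.
  have V2 : vder (fun s => (expR (- P s))%:C) s (expR (- P s) * - Re (dD s / D s))%:C.
    apply/vder_is_derive; split => /=; last exact: is_derive_cst.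
    exact: (@is_derive1_comp R expR (fun s => - P s) s _ _ (is_derive_expR _) nP).
  apply: (vder_eq _ _ (vderM V1 V2)) => //.
  rewrite /G; move: (dD s / D s) => [x y] /=; rewrite complex_split.
  by rewrite rmorphM !rmorphN/=; ring.
have cst : G 0 * D 0 = G t * D t.
  apply: (@vder_constant (fun s => G s * D s)) => // s /andP[s0 st].
    by apply: vcontM => //; apply: vder_vcont (VG s _); lra.
  have VGs : vder G s (- (dD s / D s) * G s) by apply: VG; lra.
  have VDs : vder D s (dD s) by apply: DD'; lra.
  apply: (vder_eq _ _ (vderM VGs VDs)) => //.
  by rewrite mulNr mulNr mulrAC divfK// addrC mulrC subrr.
pose E : R[i] := expi (Th t) * (expR (P t))%:C.
have EG : E * G t = 1.
  by rewrite /E /G mulrACA -expiD -rmorphM -expRD !subrr expi0 expR0 mulr1.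
have r0 : 0 < expR (P t) * expR (- P 0) by rewrite mulr_gt0 ?expR_gt0.
have Dt : D t = (expR (P t) * expR (- P 0))%:C * (expi (Th t - Th 0) * D 0).
  by rewrite -[LHS]mul1r -EG -mulrA -cst /E /G expiD rmorphM/=; ring.
have I : segint 0 t (fun s => Im (dD s / D s)) = Th t - Th 0.
  apply: segint_FTC => //; first by move=> s; exact: vcont_Im.
  by move=> s /andP[s0 _]; apply: HTh; lra.
have n0 : (normc (D 0))%:C != 0 by rewrite -normc_eq0 normc_real normr_eq0 normc_eq0.
have n1 : (expR (P t) * expR (- P 0))%:C != 0 by rewrite -normc_eq0 normc_real normr_eq0 gt_eqF.
rewrite I Dt !normcM normc_real normc_expi mul1r (gtr0_norm r0) [X in _ / X]rmorphM.
have alg (r e d n : R[i]) : r != 0 -> n != 0 -> r * (e * d) / (r * n) = d / n * e.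
  by move=> r1 m0; field; apply/andP.
exact: alg n1 n0.
Qed.

End PhaseEquation.

Section DominatedConvergence.
Context {R : realType}.
Implicit Types (f : R -> R) (a b M : R).

Lemma segint_dominated (f_ : nat -> R -> R) f a b M : (forall n, measurable_fun `[a, b] (f_ n)) ->
  (forall n x, a <= x <= b -> `|f_ n x| <= M) ->
  (forall x, a <= x <= b -> f_ n x @[n --> \oo] --> f x) ->
  lebesgue_measure.-integrable `[a, b] (EFin \o f) /\
  segint a b (f_ n) @[n --> \oo] --> segint a b f.
Proof.
move=> mf fM ff.
have mD : measurable (`[a, b] : set R) by exact: measurable_itv.
have mf' n : measurable_fun `[a, b] (EFin \o f_ n) by exact/measurable_EFinP.
have cvgE : {ae lebesgue_measure, forall x, `[a, b]%classic x ->
    (EFin \o f_ n) x @[n --> \oo] --> (EFin \o f) x}.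
  apply: aeW => x; rewrite /= in_itv/= => xab; apply: cvg_EFin; first exact: nearW.
  exact: ff.
have mfl : measurable_fun `[a, b] (EFin \o f).
  apply: (emeasurable_fun_cvg (fun n => EFin \o f_ n)) => // x; rewrite /= in_itv/= => xab.
  by apply: cvg_EFin; [exact: nearW|exact: ff].
have iM : lebesgue_measure.-integrable `[a, b] (EFin \o cst M).
  by apply: segint_integrable; exact: cst_continuous.
have dom : {ae lebesgue_measure, forall x n, `[a, b]%classic x ->
    (`|(EFin \o f_ n) x| <= (EFin \o cst M) x)%E}.
  by apply: aeW => x n; rewrite /= in_itv/= lee_fin; exact: fM.
have [If _ L] := @dominated_convergence _ _ R lebesgue_measure _ mD (fun n => EFin \o f_ n) (EFin \o f) (EFin \o cst M) mf' mfl cvgE iM dom.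
split=> //; rewrite /segint /Rintegral; apply: fine_cvg.
by rewrite fineK//; exact: integrable_fin_num.
Qed.

End DominatedConvergence.

Section Clamp.
Context {R : realType}.
Implicit Types (s t T : R).

(** Freezing time outside [0,T] makes the curves continuous on the whole line, as [phase_increment]
    requires. *)
Definition clamp T s : R := Num.max 0 (Num.min s T).

Lemma clamp_time T s : 0 < T -> timeI T (clamp T s).
Proof.
move=> T0; rewrite /timeI/= in_itv/= /clamp le_max lexx/=.
by rewrite ge_max (ltW T0) ge_min lexx orbT.
Qed.

Lemma clamp_id T s : timeI T s -> clamp T s = s.
Proof.
by rewrite /timeI/= in_itv/= => /andP[s0 sT]; rewrite /clamp (min_idPl sT) (max_idPr s0).
Qed.

Lemma clamp_lipschitz T s t : 0 < T -> `|clamp T s - clamp T t| <= `|s - t|.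
Proof.
move=> T0; have W (x y : R) : x <= y -> `|clamp T y - clamp T x| <= y - x.
  move=> xy; rewrite /clamp ler_norml.
  have M (u : R) : u <= 0 /\ Num.max 0 u = 0 \/ 0 <= u /\ Num.max 0 u = u.
    by case: (leP 0 u) => [|/ltW]; [right|left].
  have m (u : R) : u <= T /\ Num.min u T = u \/ T <= u /\ Num.min u T = T.
    by case: (leP u T) => [|/ltW]; [left|right].
  by case: (M (Num.min x T)) => -[+ ->]; case: (M (Num.min y T)) => -[+ ->];
    case: (m x) => -[? ->]; case: (m y) => -[? ->] ? ?; apply/andP; split; lra.
by case: (leP t s) => [|/ltW] st; [rewrite (ger0_norm (x := s - t)) ?subr_ge0 ?W|
  rewrite distrC (distrC s) (ger0_norm (x := t - s)) ?subr_ge0 ?W].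
Qed.

Lemma line_cont_clamp T (f : R -> R -> R[i]) a s : 0 < T -> line_cont T f ->
  vcont (fun s => f a (clamp T s)) s.
Proof.
move=> T0 cf e e0; have [d d0 Hd] := line_contP cf a (clamp_time s T0) e0.
exists d => // s' s'd; apply: Hd; rewrite ?subrr ?normr0//; first exact: clamp_time.
exact: le_lt_trans (clamp_lipschitz _ _ T0) s'd.
Qed.

End Clamp.

Section ReciprocalEstimates.
Context {R : realType}.
Implicit Types (f g P : R[i]) (m d : R).

(** The hypotheses give [normc g >= 3 / 4 * normc f], so the relative error is at most 1/3. *)
Lemma reciprocal_close f g m : 0 < m -> m <= normc f -> normc (g - f) < m / 4 ->
  normc (g^-1 - f^-1) <= 2^-1 * normc f^-1.
Proof.
move=> m0 mf gf; have f0 : 0 < normc f by lra.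
have g0 : 3 / 4 * normc f <= normc g by have := ler_normcB f g; rewrite normc_distC; lra.
have gp : 0 < normc g by lra.
have fn : f != 0 by rewrite -normc_gt0.
have gn : g != 0 by rewrite -normc_gt0.
rewrite (_ : g^-1 - f^-1 = (f - g) / g * f^-1); last by field; rewrite fn.
rewrite !normcM ler_wpM2r ?normc_ge0// normcV ler_pdivrMr// normc_distC.
by lra.
Qed.

Lemma chord_lower_bound P f d m : 0 < d -> f != 0 -> normc f <= m ->
  normc (P - f^-1 * d%:C) <= 2^-1 * normc f^-1 * d -> d / (2 * m) <= normc P.
Proof.
move=> d0 f0 fm H; have fp : 0 < normc f by rewrite normc_gt0.
have m0 : 0 < m by lra.
have := ler_normcB (f^-1 * d%:C) P; rewrite normc_distC.
rewrite normcM normc_real gtr0_norm// => H2.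
have H3 : m^-1 * d <= normc f^-1 * d by rewrite ler_wpM2r ?(ltW d0)// normcV lef_pV2.
have -> : d / (2 * m) = 2^-1 * (m^-1 * d) by field; rewrite gt_eqF.
by lra.
Qed.

End ReciprocalEstimates.

(** * Evolution of the tangent *)

Section Tangent.
Context {R : realType}.
Variables (T : R) (C : R -> R) (C' : R -> R -> R) (c1 c2 : R -> R) (U : wave R).
Variables (V : R -> wave R) (g : R -> R -> R -> R) (eps : nat -> R).
Variables (h : R -> R -> R) (z : R -> R -> R[i]).
Hypotheses (T_gt0 : 0 < T) (wuU : wu_solution T C C' c1 c2 U V g eps h z).
Implicit Types (a b s t x : R).

Let C1 : R := c1 (fine (energy_at U 0)).
Let C2 : R := c2 (fine (energy_at U 0)).
Let LM := wu_limit wuU.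
Let WW := wu_sol wuU.
Let WR := wu_reg wuU.
Let C1_gt0 : 0 < C1 := C1_gt0 wuU.
Let C2_gt0 : 0 < C2 := C2_gt0 wuU.

Lemma Psiz_limit x s : timeI T s -> bdry_f U x s != 0 -> clim Pminus (Psiz U ^~ s) x%:C (bdry_f U x s)^-1.
Proof.
move=> Ts f0; apply: clim_eq (climV f0 (iPsiz_limit Ts WW WR x)) => w Pw.
by rewrite /iPsiz invrK.
Qed.

Lemma Psi_limit x s : timeI T s -> clim Pminus (wPsi U ^~ s) x%:C (wPsi U x%:C s).
Proof.
move=> Ts; have := half_cont_clim (wr_Psi_cont WR) Ts (clPminus_real x).
exact: clim_sub (@Pminus_cl R).
Qed.

Lemma Psi_bdry_vder x s : timeI T s -> bdry_f U x s != 0 ->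
  vder (fun y => wPsi U y%:C s) x (bdry_f U x s)^-1.
Proof.
move=> Ts f0; apply: (@vder_boundary R (wPsi U ^~ s) (Psiz U ^~ s)) (Psiz_limit Ts f0).
- by move=> w Pw; exact: Psiz_cder Ts WW _ Pw.
- by move=> y; exact: Psi_limit.
Qed.

Lemma tangentE a s : timeI T s -> bdry_f U (h a s) s != 0 ->
  tangent h z (h a s) s = (bdry_f U (h a s) s)^-1 / (normc (bdry_f U (h a s) s)^-1)%:C.
Proof.
move=> Ts f0; rewrite /tangent.
suff -> : da (comp_sp z (hinv h)) (h a s) s = (bdry_f U (h a s) s)^-1 by [].
apply: vder_cderive; apply: vder_eq (Psi_bdry_vder Ts f0) => // y.
by rewrite (lm_Z LM).
Qed.

Section NonsingularPoint.
Variable a : R.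
Hypothesis fa0 : bdry_f U a 0 != 0.
Let m : R := normc (bdry_f U a 0).

Lemma bdry_f_flow_bounds s : timeI T s ->
  C1 / C2 * m <= normc (bdry_f U (h a s) s) <= C2 / C1 * m.
Proof.
have aux (p q : R) : C1 * p <= C2 * q -> C1 * q <= C2 * p -> C1 / C2 * q <= p <= C2 / C1 * q.
  move=> H1 H2; apply/andP; split; first by rewrite mulrAC ler_pdivrMr// mulrC [leRHS]mulrC mulrC.
  by rewrite mulrAC ler_pdivlMr// mulrC.
by move=> Ts; have [H1 H2] := bdry_f_flow T_gt0 wuU a Ts; exact: aux H1 H2.
Qed.

Lemma bdry_f_flow_neq0 s : timeI T s -> bdry_f U (h a s) s != 0.
Proof.
move=> Ts; rewrite -normc_gt0; have /andP[+ _] := bdry_f_flow_bounds Ts; apply: lt_le_trans.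
by rewrite !mulr_gt0 ?invr_gt0// normc_gt0.
Qed.

(** Near [h a s] the derivative Psi_z' stays within half of its modulus from the value at that
    point, so a chord cannot collapse. With [zt_lipschitz] this bounds the rate of a chord uniformly
    in time and in its length. *)
Lemma chord_bound : exists2 r, 0 < r & exists2 k, 0 < k & forall b s, timeI T s -> a < b < a + r ->
  k * (b - a) <= normc (z b s - z a s).
Proof.
have m0 : 0 < m by rewrite normc_gt0.
have m1 : 0 < C1 / C2 * m by rewrite !mulr_gt0 ?invr_gt0.
have m2 : 0 < C2 / C1 * m by rewrite !mulr_gt0 ?invr_gt0.
have m14 : 0 < C1 / C2 * m / 4 by rewrite divr_gt0.
have [d d0 Hd] := bdry_f_uniform wuU a m14.
have d20 : 0 < d / 2 by rewrite divr_gt0.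
(* The flow stretches by at most [C2], which keeps the image of the chord within [d / 2]. *)
exists (d / 2 / C2); first by rewrite divr_gt0.
(* [C1] is the least stretching by the flow; the denominator comes from [chord_lower_bound] with the
   largest value of 1/Psi_z' along the trajectory. *)
exists (C1 / (2 * (C2 / C1 * m))); first by rewrite divr_gt0// mulr_gt0.
move=> b s Ts /andP[ab br].
have /andP[h1 h2] := h_increment wuU Ts (ltW ab).
have hp : 0 < h b s - h a s by apply: lt_le_trans h1; rewrite mulr_gt0// subr_gt0.
have hd : h b s - h a s < d / 2.
  by apply: le_lt_trans h2 _; rewrite mulrC -ltr_pdivlMr// ltrBlDl.
have f0 := bdry_f_flow_neq0 Ts; have /andP[f1 f2] := bdry_f_flow_bounds Ts.
rewrite (z_Psi wuU b Ts) (z_Psi wuU a Ts).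
have key : normc (wPsi U (h b s)%:C s - wPsi U (h a s)%:C s - (bdry_f U (h a s) s)^-1 * (h b s - h a s)%:C)
    <= 2^-1 * normc (bdry_f U (h a s) s)^-1 * (h b s - h a s).
  apply: (@boundary_increment R (wPsi U ^~ s) (Psiz U ^~ s) _ _ _ (d / 2)) => //.
  - by move=> w Pw; exact: Psiz_cder Ts WW _ Pw.
  - by rewrite -subr_ge0 ltW.
  - exact: Psi_limit.
  - exact: Psi_limit.
  - move=> x y /andP[xa xb] /andP[yd y0].
    have Pw : Pminus (x +i* y) by [].
    have E : Psiz U (x +i* y) s = (iPsiz U (x +i* y) s)^-1 by rewrite /iPsiz invrK.
    rewrite E; apply: reciprocal_close m1 f1 _.
    rewrite -(extT_iPsiz Ts WW WR Pw); apply: Hd => //; first exact: Pminus_cl.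
    rewrite complex_split (_ : _ - _ = (x - h a s)%:C + 'i * y%:C); last by rewrite rmorphB/=; ring.
    rewrite (le_lt_trans (normcD_le _ _))// normcM normci mul1r !normc_real (ltr0_norm y0).
    by rewrite ger0_norm ?subr_ge0//; lra.
apply: le_trans (chord_lower_bound hp f0 f2 key).
rewrite mulrAC ler_wpM2r// invr_ge0 mulr_ge0// ltW//.
Qed.

Lemma h_cvg (u : nat -> R) s : timeI T s -> u @ \oo --> a -> h (u n) s @[n --> \oo] --> h a s.
Proof.
move=> Ts /cvgrPdist_lt ua; apply/cvgrPdist_lt => e e0.
apply: filterS (ua (e / C2) (divr_gt0 e0 C2_gt0)) => n; rewrite distrC => un.
rewrite distrC; apply: le_lt_trans (h_lipschitz wuU _ _ Ts) _.
by rewrite mulrC -ltr_pdivlMr.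
Qed.

Lemma h_gt b s : timeI T s -> a < b -> 0 < h b s - h a s.
Proof.
move=> Ts ab; have /andP[h1 _] := h_increment wuU Ts (ltW ab).
by apply: lt_le_trans h1; rewrite mulr_gt0// subr_gt0.
Qed.

Lemma F_bdry_vder s : timeI T s -> exists2 l, vder (fun y => wF U y%:C s) (h a s) l &
  extT (DFbar U) (h a s)%:C s = bdry_f U (h a s) s * l^*.
Proof.
move=> Ts; have f0 := bdry_f_flow_neq0 Ts.
have [l Hl] : exists l, clim Pminus (Fz U ^~ s) (h a s)%:C l by apply: (DF_boundary Ts WW WR (h a s)).2; exact/eqP.
exists l.
  apply: (@vder_boundary R (wF U ^~ s) (Fz U ^~ s)) Hl.
  - by move=> w Pw; exact: Fz_cder Ts WW _ Pw.
  - by move=> y; exact: (F_limit Ts WR y).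
apply: ext_limit; first exact: clPminus_real.
exact: (DFbar_nonsingular_limit Ts WW WR Hl).
Qed.

Section Chords.
Variable b : nat -> R.
Hypotheses (ab : forall n, a < b n) (ba : b @ \oo --> a).

Lemma Psi_chord_cvg s : timeI T s ->
  cseq (fun n => (z (b n) s - z a s) / (h (b n) s - h a s)%:C) (bdry_f U (h a s) s)^-1.
Proof.
move=> Ts; have f0 := bdry_f_flow_neq0 Ts.
have N n : h (b n) s != h a s by rewrite -subr_eq0 gt_eqF ?h_gt.
apply: cseq_eq (vder_quotient_cseq (Psi_bdry_vder Ts f0) (h_cvg Ts ba) N) => n.
by rewrite (z_Psi wuU (b n) Ts) (z_Psi wuU a Ts).
Qed.

(** Chords are taken to the right of [a], so the increment of [h] is a positive factor that
    disappears on normalizing. *)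
Lemma tangent_chord_cvg s : timeI T s ->
  cseq (fun n => (z (b n) s - z a s) / (normc (z (b n) s - z a s))%:C) (tangent h z (h a s) s).
Proof.
move=> Ts; have f0 := bdry_f_flow_neq0 Ts; rewrite (tangentE Ts f0).
have fV : (bdry_f U (h a s) s)^-1 != 0 by rewrite invr_eq0.
have aux (p : R[i]) (d : R) : 0 < d -> (p / d%:C) / (normc (p / d%:C))%:C = p / (normc p)%:C.
  move=> d0; have dC : d%:C != 0 by rewrite -normc_eq0 normc_real normr_eq0 gt_eqF.
  have [->|p0] := eqVneq p 0; first by rewrite !mul0r.
  have nC : (normc p)%:C != 0 by rewrite -normc_eq0 normc_real normr_eq0 normc_eq0.
  rewrite normcM normcV normc_real (gtr0_norm d0) rmorphM fmorphV/=.
  by field; apply/andP.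
by apply: cseq_eq (cseq_normalize fV (Psi_chord_cvg Ts)) => n; exact/aux/h_gt.
Qed.

Definition log_rate n s : R[i] := (dt T z (b n) s - dt T z a s) / (z (b n) s - z a s).

(** Since [z_t] is the conjugate of F, the rate is the conjugate difference quotient of F divided by
    that of Psi; the increments of [h] cancel. *)
Lemma log_rate_cvg s : timeI T s -> cseq (log_rate ^~ s) (extT (DFbar U) (h a s)%:C s).
Proof.
move=> Ts; have f0 := bdry_f_flow_neq0 Ts; have [l vl ->] := F_bdry_vder Ts.
have fV : (bdry_f U (h a s) s)^-1 != 0 by rewrite invr_eq0.
have N n : h (b n) s != h a s by rewrite -subr_eq0 gt_eqF ?h_gt.
have cF := cseq_conj (vder_quotient_cseq vl (h_cvg Ts ba) N).
have cP := cseqV fV (Psi_chord_cvg Ts).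
have aux (x y : R[i]) : x * y^-1^-1 = y * x by rewrite invrK mulrC.
rewrite -aux; apply: cseq_eq (cseqM cF cP) => n.
have alg (p q w : R[i]) (d : R) : d != 0 ->
      conjc ((p - q) / d%:C) * (w / d%:C)^-1 = (conjc p - conjc q) / w.
  move=> d0; have dC : d%:C != 0 by rewrite -normc_eq0 normc_real normr_eq0.
  have -> : conjc ((p - q) / d%:C) = (conjc p - conjc q) / d%:C.
    by rewrite -fmorphV; case: p => p1 p2; case: q => q1 q2; simpc; congr (_ +i* _); ring.
  by rewrite invf_div mulrA divfK.
rewrite /log_rate (zt_F wuU (b n) Ts) (zt_F wuU a Ts); apply: alg.
by rewrite gt_eqF ?h_gt.
Qed.

End Chords.

Lemma approach_seq r : 0 < r -> exists2 b : nat -> R, (forall n, a < b n < a + r) & b @ \oo --> a.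
Proof.
move=> r0; exists (fun n => a + r / 2 * harmonic n) => [n|].
  have h0 : 0 < harmonic n :> R by rewrite /harmonic/= invr_gt0.
  have h1 : harmonic n <= 1 :> R by rewrite /harmonic/= invf_le1// ler1n.
  have r20 : 0 < r / 2 by rewrite divr_gt0.
  apply/andP; split; first by rewrite ltrDl mulr_gt0.
  rewrite ltrD2l; apply: le_lt_trans (_ : r / 2 < r); first by rewrite ler_piMr// ltW.
  by rewrite ltr_pdivrMr// ltr_pMr// ltr1n.
rewrite -[X in _ --> X]addr0 -(mulr0 (r / 2)).
by apply: cvgD; [exact: cvg_cst|apply: cvgMr; exact: cvg_harmonic].
Qed.

(** The factor 1/Psi_z' is of order [m] and the derivative of F of order [1 / m], so [m] cancels and
    the bound survives as [a] approaches a singular point. *)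
Lemma DFbar_flow_bound s : timeI T s ->
  normc (extT (DFbar U) (h a s)%:C s) <= 2 * (C2 / C1) ^+ 2.
Proof.
move=> Ts; have [l vl ->] := F_bdry_vder Ts.
have m0 : 0 < m by rewrite normc_gt0.
have K0 : 0 < C2 * (2 / m) by rewrite mulr_gt0// divr_gt0.
have [r r0 Hr] := zt_lipschitz T_gt0 wuU fa0.
have [b ab ba] := approach_seq r0.
have ab' n : a < b n by have /andP[] := ab n.
have N n : h (b n) s != h a s by rewrite -subr_eq0 gt_eqF ?h_gt.
have lK : normc l <= C2 * (2 / m) / C1.
  apply: (cseq_normc_le (vder_quotient_cseq vl (h_cvg Ts ba) N)) => n.
  have ht : 0 < h (b n) s - h a s by exact: h_gt.
  have b0 : 0 < b n - a by rewrite subr_gt0.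
  have zl : normc (dt T z (b n) s - dt T z a s) <= C2 * (2 / m) * (b n - a).
    have := Hr (b n) s Ts; rewrite (gtr0_norm b0); apply.
    by have /andP[_] := ab n; rewrite ltrBlDl.
  have E : normc (wF U (h (b n) s)%:C s - wF U (h a s)%:C s) = normc (dt T z (b n) s - dt T z a s).
    by rewrite (zt_F wuU (b n) Ts) (zt_F wuU a Ts) -rmorphB/= normc_conj.
  rewrite normcM normcV normc_real (gtr0_norm ht) ler_pdivrMr// E (le_trans zl)//.
  rewrite -[leRHS]mulrA; apply: ler_wpM2l; first exact: (ltW K0).
  rewrite mulrC ler_pdivlMr// mulrC.
  by have /andP[] := h_increment wuU Ts (ltW (ab' n)).
have /andP[_ f2] := bdry_f_flow_bounds Ts.
have aux (p q : R[i]) : normc p <= C2 / C1 * m -> normc q <= C2 * (2 / m) / C1 ->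
    normc (p * conjc q) <= 2 * (C2 / C1) ^+ 2.
  move=> Hp Hq; rewrite normcM normc_conj.
  rewrite (_ : 2 * (C2 / C1) ^+ 2 = C2 / C1 * m * (C2 * (2 / m) / C1)).
    by rewrite ler_pM ?normc_ge0.
  by field; rewrite !gt_eqF.
exact: aux.
Qed.

Lemma z_vder b s : 0 < s < T -> vder (z b) s (dt T z b s).
Proof.
move=> /andP[s0 sT]; apply: (cderivable_in_vder (A := timeI T)).
  apply/near_realP; exists (Num.min s (T - s)); first by rewrite lt_min s0 subr_gt0.
  move=> k; rewrite subr0 lt_min !ltr_norml /timeI/= in_itv/= => /andP[/andP[? ?] /andP[? ?]].
  by apply/andP; split; lra.
by apply: (lm_z_t LM); rewrite /timeI/= in_itv/= !ltW.
Qed.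

(** Integrability in time is part of the conclusion: [phi] is measurable and bounded as the limit of
    the continuous, uniformly bounded rates of the chords. *)
Lemma tangent_flow t : timeI T t ->
  let phi s := extT (DFbar U) (h a s)%:C s in
  cintegrable `[0, t] phi /\
  tangent h z (h a t) t = tangent h z a 0 * expi (Im (cintegral `[0, t] phi)).
Proof.
move=> Tt phi; have [t0 tT] : 0 <= t /\ t <= T by move: Tt; rewrite /timeI/= in_itv/= => /andP[].
have m0 : 0 < m by rewrite normc_gt0.
have K0 : 0 < C2 * (2 / m) by rewrite mulr_gt0// divr_gt0.
have [r r0 Hr] := zt_lipschitz T_gt0 wuU fa0.
have [r' r'0 [k k0 Hk]] := chord_bound.
have rr0 : 0 < Num.min r r' by rewrite lt_min r0.
have [b ab ba] := approach_seq rr0.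
have ab' n : a < b n by have /andP[] := ab n.
have bL n s : timeI T s -> normc (dt T z (b n) s - dt T z a s) <= C2 * (2 / m) * (b n - a).
  move=> Ts; have b0 : 0 < b n - a by rewrite subr_gt0.
  have := Hr (b n) s Ts; rewrite (gtr0_norm b0); apply.
  by have /andP[_] := ab n; rewrite -ltrBlDl lt_min => /andP[].
have bK n s : timeI T s -> k * (b n - a) <= normc (z (b n) s - z a s).
  move=> Ts; apply: Hk => //; rewrite ab'/=.
  by have /andP[_] := ab n; rewrite -!ltrBlDl lt_min => /andP[].
have bn0 n s : timeI T s -> z (b n) s - z a s != 0.
  move=> Ts; rewrite -normc_gt0; apply: lt_le_trans (bK n s Ts).
  by rewrite mulr_gt0// subr_gt0.
have rate n s : timeI T s -> normc (log_rate b n s) <= C2 * (2 / m) / k.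
  move=> Ts; have nz : 0 < normc (z (b n) s - z a s) by rewrite normc_gt0 bn0.
  rewrite /log_rate normcM normcV ler_pdivrMr// (le_trans (bL n s Ts))//.
  rewrite -[leRHS]mulrA; apply: ler_wpM2l; first exact: (ltW K0).
  rewrite mulrC ler_pdivlMr// mulrC; exact: bK.
(* The chord with time frozen outside [0,T], where nothing is known of [z]. *)
pose D n s := z (b n) (clamp T s) - z a (clamp T s).
pose dD n s := dt T z (b n) (clamp T s) - dt T z a (clamp T s).
have ct s : timeI T (clamp T s) by exact: clamp_time.
have cD n s : vcont (D n) s by apply: vcontB; exact: line_cont_clamp T_gt0 (lm_z_cont LM).
have cdD n s : vcont (dD n) s by apply: vcontB; exact: line_cont_clamp T_gt0 (lm_zt_cont LM).
have D0 n s : D n s != 0 by exact: bn0.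
have DdD n s : 0 < s < T -> vder (D n) s (dD n s).
  move=> sT; have Ts : timeI T s by rewrite /timeI/= in_itv/=; case/andP: sT => ? ?; rewrite !ltW.
  have V1 := vderD (z_vder (b n) sT) (vderZ (-1) (z_vder a sT)).
  rewrite /dD (clamp_id Ts) (_ : _ - _ = dt T z (b n) s + -1 * dt T z a s); last by rewrite mulN1r.
  have [s0 sT'] := andP sT.
  apply: (@vder_near _ _ _ _ (Num.min s (T - s))) V1; first by rewrite lt_min s0 subr_gt0.
  move=> x; rewrite lt_min !ltr_norml => /andP[/andP[? ?] /andP[? ?]].
  have Tx : timeI T x by rewrite /timeI/= in_itv/=; apply/andP; split; lra.
  by rewrite /D (clamp_id Tx) mulN1r.
have c0 : clamp T 0 = 0 by apply: clamp_id; exact: time0.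
have inT s : 0 <= s <= t -> timeI T s.
  by move=> /andP[s0 st]; rewrite /timeI/= in_itv/= s0/=; exact: le_trans tT.
have rateE n s : timeI T s -> dD n s / D n s = log_rate b n s.
  by move=> Ts; rewrite /dD /D /log_rate (clamp_id Ts).
have cl n s : vcont (fun s => dD n s / D n s) s.
  apply: vcontM => //.
  exact: (@clim_vcont _ (fun w => w^-1) (D n) s (climV (D0 n s) (fun e e0 => ex_intro2 _ _ e e0 (fun w wd _ => wd)))).
have t0T : 0 <= t <= T by rewrite t0.
have phase n := phase_increment t0T (cD n) (cdD n) (D0 n) (DdD n).
have lim s : 0 <= s <= t -> cseq (fun n => dD n s / D n s) (phi s).
  move=> st; apply: cseq_eq (log_rate_cvg ab' ba (inT s st)) => n.
  by rewrite rateE//; exact: inT.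
have bnd n s : 0 <= s <= t -> normc (dD n s / D n s) <= C2 * (2 / m) / k.
  by move=> st; rewrite rateE ?rate//; exact: inT.
have [IRe _] := @segint_dominated R (fun n s => Re (dD n s / D n s)) (fun s => Re (phi s)) 0 t (C2 * (2 / m) / k)
  (fun n => measurable_funTS (continuous_measurable_fun (fun s => vcont_Re (cl n s))))
  (fun n s st => le_trans (normc_Re_le _) (bnd n s st)) (fun s st => cseq_Re (lim s st)).
have [IIm LIm] := @segint_dominated R (fun n s => Im (dD n s / D n s)) (fun s => Im (phi s)) 0 t (C2 * (2 / m) / k)
  (fun n => measurable_funTS (continuous_measurable_fun (fun s => vcont_Im (cl n s))))
  (fun n s st => le_trans (normc_Im_le _) (bnd n s st)) (fun s st => cseq_Im (lim s st)).
split; first by split.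
have L1 := tangent_chord_cvg ab' ba Tt.
have L2 := tangent_chord_cvg ab' ba (time0 T_gt0); rewrite (lm_h0 LM) in L2.
apply: cseq_unique L1 _; apply: cseq_eq (cseqM L2 (cseq_expi LIm)) => n.
by have := phase n; rewrite /D (clamp_id Tt) c0 => ->.
Qed.

End NonsingularPoint.

Lemma nonsingular_neq0 a : nonsingular U 0 a -> bdry_f U a 0 != 0.
Proof. by move=> fa; apply/eqP. Qed.

(** The ratio is [expi] of the integrated rate. At each time the rate at [h (u n) s] tends to its
    value at [h a s], which is 0 since the flow preserves singular points, and the bound does not
    depend on [n]. *)
Lemma tangent_ratio_cvg a (u : nat -> R) t : timeI T t -> singular U 0 a ->
  (forall n, nonsingular U 0 (u n)) -> u @ \oo --> a ->
  cseq (fun n => tangent h z (h (u n) t) t / tangent h z (u n) 0) 1.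
Proof.
move=> Tt Sa NSu ua; have [t0 tT] : 0 <= t /\ t <= T by move: Tt; rewrite /timeI/= in_itv/= => /andP[].
have inT s : 0 <= s <= t -> timeI T s.
  by move=> /andP[s0 st]; rewrite /timeI/= in_itv/= s0/=; exact: le_trans tT.
have T0 := time0 T_gt0.
pose phi n s := extT (DFbar U) (h (u n) s)%:C s.
have tf n := tangent_flow (nonsingular_neq0 (NSu n)) Tt.
have lim s : 0 <= s <= t -> cseq (phi ^~ s) 0.
  move=> st; have Ts := inT s st.
  rewrite -(extT_DFbar_singular Ts WW WR (singular_flow T_gt0 wuU Ts Sa)).
  apply/cseqP => e e0; have [d d0 Hd] := extT_DFbar_cont Ts WW WR (h a s) e0.
  by have /cvgrPdist_lt/(_ d d0) := h_cvg Ts ua; apply: filterS => n; rewrite distrC; exact: Hd.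
have bnd n s : 0 <= s <= t -> normc (phi n s) <= 2 * (C2 / C1) ^+ 2.
  by move=> st; apply: DFbar_flow_bound; [exact: nonsingular_neq0|exact: inT].
have mI n : measurable_fun `[0, t] (fun s => Im (phi n s)).
  by have [[_ /measurable_int/measurable_EFinP]] := tf n.
have [_] := @segint_dominated R (fun n s => Im (phi n s)) (fun=> 0) 0 t (2 * (C2 / C1) ^+ 2) mI
  (fun n s st => le_trans (normc_Im_le _) (bnd n s st)) (fun s st => cseq_Im (lim s st)).
rewrite segint_cst// mul0r => L; rewrite -expi0; apply: cseq_eq (cseq_expi L) => n.
have [_ ->] := tf n; rewrite [X in _ = X / _]mulrC mulfK//.
(* [tangentE] speaks of points of the form [h a s]; at time 0 the flow is the identity, so it shows
   that the denominator is nonzero. *)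
have f0 : bdry_f U (h (u n) 0) 0 != 0 by rewrite (lm_h0 LM); exact: nonsingular_neq0.
have := tangentE T0 f0; rewrite (lm_h0 LM) in f0 *; move=> ->.
by rewrite mulf_neq0 ?invr_eq0// -normc_eq0 normc_real normr_eq0 normc_eq0 invr_eq0.
Qed.

End Tangent.

Theorem theorem3p2 (R : realType) (T0 : R) (C : R -> R) (C' : R -> R -> R)
    (c1 c2 : R -> R) (U : wave R) (V : R -> wave R) (g : R -> R -> R -> R)
    (eps : nat -> R) (h : R -> R -> R) (z : R -> R -> R[i])
    (T0_gt0 : 0 < T0)
    (wuU : wu_solution T0 C C' c1 c2 U V g eps h z) :
  (forall t : R, timeI T0 t ->
     [/\ extends_continuously ((DF U)^~ t),
         extends_continuously ((DFbar U)^~ t)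
       & forall a : R, singular U t a ->
           extT (DF U) a%:C t = 0 /\ extT (DFbar U) a%:C t = 0]) /\
  (forall t : R, timeI T0 t ->
     (forall a : R, nonsingular U 0 a ->
        let f := fun s : R => extT (DFbar U) (h a s)%:C s in
        cintegrable `[0, t] f /\
        tangent h z (h a t) t
        = tangent h z a 0 * expi (Im (cintegral `[0, t] f))) /\
     (forall (a : R) (u : nat -> R),
        singular U 0 a -> (forall n, nonsingular U 0 (u n)) ->
        u @ \oo --> a ->
        (tangent h z (h (u n) t) t / tangent h z (u n) 0 : R[i]^o)
          @[n --> \oo] --> (1 : R[i]^o))).
Proof.
split=> t Tt; first exact: part1 Tt (wu_sol wuU) (wu_reg wuU).
split=> [a fa|a u Sa NSu ua]; first exact: (tangent_flow T0_gt0 wuU (nonsingular_neq0 fa) Tt).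
exact: (tangent_ratio_cvg T0_gt0 wuU Tt Sa NSu ua).
Qed.
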